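(* Let $\Bbbk$ be a field. None of the following is determined by the face of the Kunz cone containing a numerical semigroup $S$, where $R=\Bbbk[S]$; that is, for each item there exist an integer $m$ and two numerical semigroups of multiplicity $m$ lying in the same face of $C_m$ for which the item differs: (a) the finite Betti numbers $\beta_i^Q(\operatorname{gr}_{\mathfrak m}(R))$; (b) the Poincaré series of $\operatorname{gr}_{\mathfrak m}(R)$; (c) the Koszulness of $\operatorname{gr}_{\mathfrak m}(R)$, and therefore the Koszulness of $R$.
   Context: A numerical semigroup is a cofinite additively closed set $S \subseteq \mathbb Z_{\ge 0}$ containing $0$; its multiplicity is $m = \min(S\setminus\{0\})$. Its Apéry set is $\operatorname{Ap}(S) = \{n \in S : n - m \notin S\} = \{0, a_1, \ldots, a_{m-1}\}$ with $a_i\equiv i\bmod m$. The semigroup ring is $R=\Bbbk[S]=\Bbbk[t^s:s\in S]$, and $\mathfrak m$ is its maximal monomial ideal (generated by $t^s$, $0\neq s\in S$). The Kunz cone $C_m \subseteq \mathbb R_{\ge 0}^{m-1}$ is the polyhedral cone defined by the inequalities $z_i + z_j \ge z_{i+j}$ for all $i,j \in \{1,\ldots,m-1\}$ with $i+j \not\equiv 0 \bmod m$ (subscripts modulo $m$). A numerical semigroup $S$ of multiplicity $m$ lies in a face $F$ of $C_m$ if $(a_1,\ldots,a_{m-1})$ lies in the relative interior of $F$. The associated graded ring is $\operatorname{gr}_{\mathfrak m}(R)=\bigoplus_{i\ge0}\mathfrak m^i/\mathfrak m^{i+1}$, a standard $\mathbb N$-graded $\Bbbk$-algebra. Let $Q$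 be the standard graded polynomial ring over $\Bbbk$ with one variable for each minimal generator of $S$; sending the variables to the classes in $\mathfrak m/\mathfrak m^2$ of the corresponding generators $t^{n_k}$ makes $\operatorname{gr}_{\mathfrak m}(R)$ a quotient of $Q$, and $\beta_i^Q(\operatorname{gr}_{\mathfrak m}(R))=\dim_{\Bbbk}\operatorname{Tor}^Q_i(\operatorname{gr}_{\mathfrak m}(R),\Bbbk)$. The Poincaré series of a $\Bbbk$-algebra $A=\operatorname{gr}_{\mathfrak m}(R)$ is $P^A_{\Bbbk}(z)=\sum_{i\ge0}\beta_i^A(\Bbbk)z^i$, $\beta_i^A(\Bbbk)=\dim_{\Bbbk}\operatorname{Tor}^A_i(\Bbbk,\Bbbk)$. A standard $\mathbb N$-graded $\Bbbk$-algebra $A$ is Koszul when its graded Betti numbers satisfy $\beta^A_{i,j}(\Bbbk)=0$ whenever $i\ne j$, i.e. $\Bbbk$ has a linear resolution over $A$. The $\mathbb N$-graded ring $R$ is Koszul if $\operatorname{gr}_{\mathfrak m}(R)$ is Koszul. *)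

(* Defs.v *)
From HB Require Import structures.
From mathcomp Require Import all_boot all_order all_algebra.
From mathcomp Require Import generic_quotient ring_quotient.
From mathcomp Require Import boolp classical_sets filter reals topology.
From mathcomp Require Import mpoly.

Set Implicit Arguments.
Unset Strict Implicit.
Unset Printing Implicit Defensive.

Import Order.TTheory GRing.Theory Num.Theory.
Import numFieldTopology.Exports.

Local Open Scope nat_scope.

Record numsgp := NumSgp {
  ns_mem : {pred nat};
  ns_mem0 : 0 \in ns_mem;
  ns_memD : forall a b, a \in ns_mem -> b \in ns_mem -> a + b \in ns_mem;
  ns_cofinite : exists N, forall n, N <= n -> n \in ns_mem }.

Coercion numsgp_pred (S : numsgp) : {pred nat} := ns_mem S.

Section NumSgp.
Variable S : numsgp.

Lemma mult_subproof : exists n, (0 < n) && (n \in S).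
Proof.
have [N HN] := ns_cofinite S; exists N.+1 => //=.
exact: HN (leqnSn N).
Qed.

Definition multiplicity : nat := ex_minn mult_subproof.

Lemma multiplicity_gt0 : 0 < multiplicity.
Proof. by rewrite /multiplicity; case: ex_minnP => n /andP[]. Qed.

Lemma multiplicity_in : multiplicity \in S.
Proof. by rewrite /multiplicity; case: ex_minnP => n /andP[]. Qed.

(* n - m \notin S, the difference being taken in the integers *)
Definition apery_set : {pred nat} :=
  [pred n | (n \in S) && ~~ ((multiplicity <= n) && (n - multiplicity \in S))].

Lemma apery_subproof i :
  exists n, (n \in apery_set) && (n == i %[mod multiplicity]).
Proof.
have m0 := multiplicity_gt0.
have ex : exists n, (n \in S) && (n == i %[mod multiplicity]).
  have [N HN] := ns_cofinite S; exists (N * multiplicity + i).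
  rewrite modnMDl eqxx andbT; apply: HN.
  by rewrite (leq_trans _ (leq_addr _ _)) // leq_pmulr.
case: (ex_minnP ex) => n /andP[nS ni] nmin; exists n.
rewrite ni andbT inE nS /=; apply/negP => /andP[mn nmS].
have := nmin (n - multiplicity); rewrite nmS /=.
have -> : (n - multiplicity == i %[mod multiplicity]).
  by rewrite -(eqP ni) -{2}(subnK mn) modnDr.
move=> /(_ isT); rewrite leqNgt => /negP; apply.
by rewrite ltn_subrL m0 (leq_trans m0 mn).
Qed.

(* the element of Ap(S) congruent to i modulo m *)
Definition apery (i : nat) : nat := xchoose (apery_subproof i).

Lemma aperyP i : apery i \in apery_set /\ apery i = i %[mod multiplicity].
Proof. by have /andP[-> /eqP ->] := xchooseP (apery_subproof i). Qed.

Definition is_min_gen (n : nat) : bool :=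
  [&& 0 < n, n \in S &
   [forall a : 'I_n, ((0 < a) && (val a \in S)) ==> (n - a \notin S)]].

Lemma conductor_subproof : exists N, `[< forall n, N <= n -> n \in S >].
Proof. by have [N HN] := ns_cofinite S; exists N; apply/asboolP. Qed.

Definition conductor : nat := ex_minn conductor_subproof.

(* every minimal generator is at most conductor + multiplicity, see
   mem_min_gens *)
Definition min_gens : seq nat :=
  [seq n <- iota 0 (conductor + multiplicity).+1 | is_min_gen n].

Lemma mem_min_gens n : (n \in min_gens) = is_min_gen n.
Proof.
rewrite mem_filter mem_iota /= add0n ltnS; case: (boolP (is_min_gen n)) => //=.
move=> /and3P[n0 nS /forallP nmin]; rewrite leqNgt; apply/negP => ltn.
have m0 := multiplicity_gt0.
have mn : multiplicity < n by apply: leq_ltn_trans ltn; rewrite leq_addl.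
have := nmin (Ordinal mn); rewrite /= m0 multiplicity_in /= => /negP; apply.
rewrite /conductor in ltn; case: ex_minnP ltn => N /asboolP HN _ ltn.
by apply: HN; rewrite leq_subRL ?(ltnW mn) // addnC ltnW.
Qed.

End NumSgp.

Local Open Scope ring_scope.
Local Open Scope classical_set_scope.

Section Kunz.
Variable R : realType.

(* The coordinate z 0 i stands for z_(i+1), so that i, j, l below range over
   the indices 1, ..., m - 1; such an l exists iff i + j is not 0 mod m. *)
Definition kunz_cone (m : nat) : set 'rV[R]_m.-1 :=
  [set z | (forall i, 0 <= z 0 i) /\
     forall i j l : 'I_m.-1, (i.+1 + j.+1 = l.+1 %[mod m])%N ->
       z 0 l <= z 0 i + z 0 j].

Definition is_face n (C F : set 'rV[R]_n) : Prop :=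
  exists (c : 'cV[R]_n) (b : R),
    (forall x, C x -> b <= (x *m c) 0 0) /\
    F = [set x | C x /\ (x *m c) 0 0 = b].

Definition affine_hull n (F : set 'rV[R]_n) : set 'rV[R]_n :=
  [set y | exists (q : nat) (p : 'I_q -> 'rV[R]_n) (t : 'I_q -> R),
     [/\ forall i, F (p i), \sum_i t i = 1 & y = \sum_i t i *: p i]].

Definition relative_interior n (F : set 'rV[R]_n) : set 'rV[R]_n :=
  [set x | F x /\ \forall y \near x, affine_hull F y -> F y].

Definition kunz_point (m : nat) (S : numsgp) : 'rV[R]_m.-1 :=
  \row_i (apery S i.+1)%:R.

Definition lies_in_face (m : nat) (F : set 'rV[R]_m.-1) (S : numsgp) : Prop :=
  multiplicity S = m /\ relative_interior F (kunz_point m S).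

Definition same_face (m : nat) (S S' : numsgp) : Prop :=
  exists F : set 'rV[R]_m.-1,
    [/\ is_face (@kunz_cone m) F, lies_in_face F S & lies_in_face F S'].

End Kunz.

Section Ideals.
Variable R : comNzRingType.
Implicit Types (G I J : set R).

Definition ideal_gen G : set R :=
  [set x | exists s : seq (R * R),
     (forall p, p \in s -> G p.2) /\ x = \sum_(p <- s) p.1 * p.2].

Definition ideal_mul I J : set R :=
  ideal_gen [set z | exists x y, [/\ I x, J y & z = x * y]].

Definition ideal_exp I (n : nat) : set R := iter n (ideal_mul I) setT.

Lemma ideal_gen0 G : ideal_gen G 0.
Proof. by exists [::]; rewrite big_nil. Qed.

Lemma ideal_genD G x y : ideal_gen G x -> ideal_gen G y -> ideal_gen G (x + y).
Proof.
move=> [s [sG ->]] [t [tG ->]]; exists (s ++ t); rewrite big_cat; split=> // p.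
by rewrite mem_cat => /orP[/sG|/tG].
Qed.

Lemma ideal_genM G a x : ideal_gen G x -> ideal_gen G (a * x).
Proof.
move=> [s [sG ->]]; exists [seq (a * p.1, p.2) | p <- s]; split.
  by move=> _ /mapP[p /sG ? ->].
by rewrite big_map mulr_sumr; apply: eq_bigr => p _; rewrite mulrA.
Qed.

Lemma ideal_gen_sub G x : G x -> ideal_gen G x.
Proof.
move=> Gx; exists [:: (1, x)]; rewrite big_seq1 mul1r; split=> // p.
by rewrite inE => /eqP ->.
Qed.

Lemma ideal_gen_ind G (P : R -> Prop) : P 0 ->
  (forall x y, P x -> P y -> P (x + y)) -> (forall a x, G x -> P (a * x)) ->
  forall x, ideal_gen G x -> P x.
Proof.
move=> P0 PD PM x [s [+ ->]]; elim: s => [|p s IHs] sG; first by rewrite big_nil.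
rewrite big_cons; apply: PD; first by apply/PM/sG; rewrite inE eqxx.
by apply: IHs => q qs; apply: sG; rewrite inE qs orbT.
Qed.

Lemma ideal_exp0 I n : ideal_exp I n 0.
Proof. by case: n => // n; apply: ideal_gen0. Qed.

Lemma ideal_expD I n x y :
  ideal_exp I n x -> ideal_exp I n y -> ideal_exp I n (x + y).
Proof. by case: n => // n; apply: ideal_genD. Qed.

Lemma ideal_expMl I n a x : ideal_exp I n x -> ideal_exp I n (a * x).
Proof. by case: n => // n; apply: ideal_genM. Qed.

Lemma ideal_expN I n x : ideal_exp I n x -> ideal_exp I n (- x).
Proof. by rewrite -mulN1r; apply: ideal_expMl. Qed.

Lemma ideal_exp_sum I n (T : Type) (r : seq T) (P : pred T) (F : T -> R) :
  (forall i, P i -> ideal_exp I n (F i)) ->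
  ideal_exp I n (\sum_(i <- r | P i) F i).
Proof. by move=> H; elim/big_ind: _ => //; [apply: ideal_exp0|apply: ideal_expD]. Qed.

Lemma ideal_expM I a b x y :
  ideal_exp I a x -> ideal_exp I b y -> ideal_exp I (a + b) (x * y).
Proof.
elim: a x => [|a IHa] x Ix Iy; first exact: ideal_expMl.
move: x Ix; apply: ideal_gen_ind.
- by rewrite mul0r; apply: ideal_exp0.
- by move=> u v Hu Hv; rewrite mulrDl; apply: ideal_expD.
move=> c _ [u [v [Iu Iv ->]]]; rewrite -mulrA; apply: ideal_expMl.
rewrite -mulrA; apply: ideal_gen_sub; exists u, (v * y); split=> //.
exact: IHa.
Qed.

Lemma ideal_expS I n x : ideal_exp I n.+1 x -> ideal_exp I n x.
Proof.
move: x; apply: ideal_gen_ind; [exact: ideal_exp0|exact: ideal_expD|].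
by move=> a _ [u [v [_ Iv ->]]]; do 2!apply: ideal_expMl.
Qed.

End Ideals.

Section AssociatedGraded.
Variables (R : comNzRingType) (I : set R).

(* \bigoplus_d I^d, as the ring of polynomials \sum_d f_d T^d, f_d \in I^d *)
Definition rees_pred : {pred {poly R}} :=
  fun f => `[< forall d, ideal_exp I d f`_d >].

Lemma rees_predP (f : {poly R}) : reflect (forall d, ideal_exp I d f`_d) (f \in rees_pred).
Proof. exact: asboolP. Qed.

Lemma rees_subring_closed : subring_closed rees_pred.
Proof.
split.
- by apply/rees_predP => -[|d]; rewrite coef1; [|apply: ideal_exp0].
- move=> f g /rees_predP If /rees_predP Ig; apply/rees_predP => d.
  by rewrite coefB; apply: ideal_expD => //; apply: ideal_expN.
- move=> f g /rees_predP If /rees_predP Ig; apply/rees_predP => d.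
  rewrite coefM; apply: ideal_exp_sum => i _.
  by rewrite -{1}(subnKC (leq_ord i)); apply: ideal_expM.
Qed.

HB.instance Definition _ :=
  GRing.isSubringClosed.Build {poly R} rees_pred rees_subring_closed.

Definition rees : Type := {f : {poly R} | f \in rees_pred}.

HB.instance Definition _ := SubChoice.on rees.
HB.instance Definition _ := [SubChoice_isSubComNzRing of rees by <:].

Lemma reesP (f : rees) d : ideal_exp I d (val f)`_d.
Proof. exact: (rees_predP _ (valP f)). Qed.

Hypothesis I_proper : ~ ideal_exp I 1 1.

(* \bigoplus_d I^(d+1), an ideal of \bigoplus_d I^d *)
Definition gr_kernel of ~ ideal_exp I 1 1 : {pred rees} :=
  fun f => `[< forall d, ideal_exp I d.+1 (val f)`_d >].

Lemma gr_kernelP (f : rees) :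
  reflect (forall d, ideal_exp I d.+1 (val f)`_d) (f \in gr_kernel I_proper).
Proof. exact: asboolP. Qed.

Lemma gr_kernel_idealr : idealr_closed (gr_kernel I_proper).
Proof.
split.
- by apply/gr_kernelP => d; rewrite coef0; apply: ideal_exp0.
- by apply/negP => /gr_kernelP/(_ 0%N); rewrite coef1.
- move=> a u v /gr_kernelP Iu /gr_kernelP Iv; apply/gr_kernelP => d.
  rewrite coefD; apply: ideal_expD => //.
  rewrite coefM; apply: ideal_exp_sum => i _.
  rewrite -{1}(subnKC (leq_ord i)) -addnS; apply: ideal_expM => //.
  exact: reesP.
Qed.

HB.instance Definition _ := isIdealr.Build rees (gr_kernel I_proper)
  gr_kernel_idealr.

End AssociatedGraded.

(* \bigoplus_d I^d / I^(d+1), with the product induced by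
   I^d * I^e -> I^(d+e) *)
Definition assoc_gr (R : comNzRingType) (I : set R)
  (I_proper : ~ ideal_exp I 1 1) : Type := {ideal_quot gr_kernel I_proper}.

HB.instance Definition _ R I I_proper :=
  GRing.ComNzRing.on (@assoc_gr R I I_proper).

Section AssociatedGradedTheory.
Variables (R : comNzRingType) (I : set R) (I_proper : ~ ideal_exp I 1 1).

Local Open Scope quotient_scope.

Definition gr_pi (f : rees I) : assoc_gr I_proper :=
  \pi_({ideal_quot gr_kernel I_proper}) f.

Lemma gr_pi_is_zmod_morphism : zmod_morphism gr_pi.
Proof. by move=> x y; rewrite /gr_pi rmorphB. Qed.

Lemma gr_pi_is_monoid_morphism : monoid_morphism gr_pi.
Proof. by split=> [|x y]; rewrite /gr_pi ?rmorph1 ?rmorphM. Qed.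

HB.instance Definition _ :=
  GRing.isZmodMorphism.Build (rees I) (assoc_gr I_proper) gr_pi
    gr_pi_is_zmod_morphism.
HB.instance Definition _ :=
  GRing.isMonoidMorphism.Build (rees I) (assoc_gr I_proper) gr_pi
    gr_pi_is_monoid_morphism.

(* the summand I^d / I^(d+1) *)
Definition gr_comp (d : nat) : set (assoc_gr I_proper) :=
  [set x | exists f : rees I,
     (forall e, e != d -> (val f)`_e = 0) /\ x = gr_pi f].

(* the class in I^d / I^(d+1) of an element a of I^d (junk otherwise) *)
Definition gr_class (d : nat) (a : R) : assoc_gr I_proper :=
  gr_pi (insubd 0 (a *: 'X^d)).

Lemma gr_class_val d a : ideal_exp I d a ->
  val (insubd (0 : rees I) (a *: 'X^d)) = a *: 'X^d.
Proof.
move=> Ia; rewrite insubdK //; apply/rees_predP => e.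
rewrite coefZ coefXn; case: eqP => [->|_]; first by rewrite mulr1.
by rewrite mulr0; apply: ideal_exp0.
Qed.

End AssociatedGradedTheory.

Section SemigroupRing.
Variables (k : fieldType) (S : numsgp).

Definition sgp_supp : {pred {poly k}} :=
  fun p => all (fun i => (p`_i != 0) ==> (i \in S)) (iota 0 (size p)).

Lemma sgp_suppP (p : {poly k}) :
  reflect (forall i, p`_i != 0 -> i \in S) (p \in sgp_supp).
Proof.
apply: (iffP allP) => [H i pi0|H i _]; last by apply/implyP/H.
have := H i; rewrite pi0; apply; rewrite mem_iota add0n /=.
by rewrite ltnNge; apply: contra pi0 => /leq_sizeP ->.
Qed.

Lemma sgp_supp_subalg_closed : subalg_closed sgp_supp.
Proof.
split.
- apply/sgp_suppP => i; rewrite coef1; case: (altP (i =P 0%N)) => [-> _|_].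
    exact: ns_mem0.
  by rewrite eqxx.
- move=> c p q /sgp_suppP Sp /sgp_suppP Sq; apply/sgp_suppP => i.
  rewrite coefD coefZ; case: (altP (p`_i =P 0)) => [->|/Sp //].
  by rewrite mulr0 add0r => /Sq.
- move=> p q /sgp_suppP Sp /sgp_suppP Sq; apply/sgp_suppP => i.
  apply: contraNT => iNS; rewrite coefM big1 // => j _.
  apply/eqP; rewrite mulf_eq0; apply: contraR iNS; rewrite negb_or.
  case/andP=> /Sp jS /Sq jS'; rewrite -(subnKC (leq_ord j)).
  exact: ns_memD.
Qed.

HB.instance Definition _ :=
  GRing.isSubalgClosed.Build k {poly k} sgp_supp sgp_supp_subalg_closed.

(* k[S] = k[t^s : s \in S], the polynomials with support in S *)
Definition sgp_ring : Type := {p : {poly k} | p \in sgp_supp}.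

HB.instance Definition _ := SubChoice.on sgp_ring.
HB.instance Definition _ := [SubChoice_isSubAlgebra of sgp_ring by <:].
HB.instance Definition _ := [SubNzRing_isSubComNzRing of sgp_ring by <:].

(* t^s if s \in S (and 0 otherwise) *)
Definition sgp_mono (s : nat) : sgp_ring := insubd 0 ('X^s : {poly k}).

Lemma sgp_mono_val s : s \in S -> val (sgp_mono s) = 'X^s.
Proof.
move=> sS; rewrite insubdK //; apply/sgp_suppP => i; rewrite coefXn.
by case: (altP (i =P s)) => [->|_] //; rewrite eqxx.
Qed.

Definition sgp_max : set sgp_ring :=
  ideal_gen [set x | exists2 s, s \in S & s != 0%N /\ x = sgp_mono s].

Lemma sgp_max_coef0 x : sgp_max x -> (val x)`_0 = 0.
Proof.
move: x; apply: ideal_gen_ind => [|x y Hx Hy|a _ [s sS [s0 ->]]].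
- by rewrite raddf0 coef0.
- by rewrite raddfD coefD Hx Hy addr0.
- by rewrite rmorphM /= coef0M sgp_mono_val // coefXn eq_sym (negPf s0) mulr0.
Qed.

Lemma sgp_max_exp1 x : ideal_exp sgp_max 1 x -> sgp_max x.
Proof.
move: x; apply: ideal_gen_ind; [exact: ideal_gen0|exact: ideal_genD|].
by move=> a _ [u [v [Iu _ ->]]]; rewrite (mulrC u); do 2!apply: ideal_genM.
Qed.

Lemma sgp_max_proper : ~ ideal_exp sgp_max 1 1.
Proof.
move=> /sgp_max_exp1/sgp_max_coef0/eqP.
by rewrite rmorph1 coef1 oner_eq0.
Qed.

Definition sgp_gr : comNzRingType := assoc_gr sgp_max_proper.

Definition sgp_gr_comp : nat -> set sgp_gr := @gr_comp _ _ sgp_max_proper.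

(* The structure maps k -> gr_m(k[S]) and gr_m(k[S]) -> R/m = k. *)
Definition sgp_grC (c : k) : sgp_gr :=
  gr_class sgp_max_proper 0 (c%:A : sgp_ring).

Definition sgp_gr_eps (x : sgp_gr) : k :=
  (val ((val (repr (x : {ideal_quot gr_kernel sgp_max_proper})))`_0))`_0.

Lemma sgp_grC_val c :
  val (insubd (0 : rees sgp_max) ((c%:A : sgp_ring) *: 'X^0)) = (c%:A)%:P.
Proof. by rewrite gr_class_val // expr0 alg_polyC. Qed.

Lemma sgp_grC_is_zmod_morphism : zmod_morphism sgp_grC.
Proof.
move=> a b; rewrite /sgp_grC /gr_class -rmorphB; congr gr_pi.
by apply: val_inj; rewrite rmorphB /= !sgp_grC_val scalerBl rmorphB.
Qed.

Lemma sgp_grC_is_monoid_morphism : monoid_morphism sgp_grC.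
Proof.
split=> [|a b]; rewrite /sgp_grC /gr_class.
  rewrite -(rmorph1 (gr_pi sgp_max_proper)); congr gr_pi.
  by apply: val_inj; rewrite rmorph1 /= sgp_grC_val scale1r.
rewrite -rmorphM; congr gr_pi.
apply: val_inj; rewrite rmorphM /= !sgp_grC_val -rmorphM; congr (_ %:P).
by rewrite -scalerAl mul1r scalerA.
Qed.

HB.instance Definition _ :=
  GRing.isZmodMorphism.Build k sgp_gr sgp_grC sgp_grC_is_zmod_morphism.
HB.instance Definition _ :=
  GRing.isMonoidMorphism.Build k sgp_gr sgp_grC sgp_grC_is_monoid_morphism.

Lemma sgp_gr_epsE f :
  sgp_gr_eps (gr_pi sgp_max_proper f) = (val ((val f)`_0))`_0.
Proof.
rewrite /sgp_gr_eps /gr_pi; set g := repr _.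
have /gr_kernelP/(_ 0%N) : g - f \in gr_kernel sgp_max_proper.
  by rewrite Quotient.idealrBE reprK.
rewrite (rmorphB val) coefB => /sgp_max_exp1/sgp_max_coef0.
by rewrite (rmorphB val) coefB => /eqP; rewrite subr_eq0 => /eqP.
Qed.

Lemma gr_pi_surj (x : sgp_gr) : exists f, x = gr_pi sgp_max_proper f.
Proof.
exists (repr (x : {ideal_quot gr_kernel sgp_max_proper})).
by rewrite /gr_pi reprK.
Qed.

Lemma sgp_gr_eps_is_zmod_morphism : zmod_morphism sgp_gr_eps.
Proof.
move=> x y; have [f ->] := gr_pi_surj x; have [g ->] := gr_pi_surj y.
by rewrite -rmorphB !sgp_gr_epsE (rmorphB val) coefB (rmorphB val) coefB.
Qed.

Lemma sgp_gr_eps_is_monoid_morphism : monoid_morphism sgp_gr_eps.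
Proof.
split=> [|x y].
  by rewrite -(rmorph1 (gr_pi sgp_max_proper)) sgp_gr_epsE (rmorph1 val) coef1
    (rmorph1 val) coef1.
have [f ->] := gr_pi_surj x; have [g ->] := gr_pi_surj y.
by rewrite -rmorphM !sgp_gr_epsE (rmorphM val) coef0M (rmorphM val) coef0M.
Qed.

HB.instance Definition _ :=
  GRing.isZmodMorphism.Build sgp_gr k sgp_gr_eps sgp_gr_eps_is_zmod_morphism.
HB.instance Definition _ :=
  GRing.isMonoidMorphism.Build sgp_gr k sgp_gr_eps
    sgp_gr_eps_is_monoid_morphism.

Definition sgp_poly : comNzRingType := {mpoly k[size (min_gens S)]}.

(* Q -> gr_m(k[S]), sending the i-th variable to the class of t^(n_i) in
   m / m^2 *)
Definition sgp_poly_to_gr : {rmorphism sgp_poly -> sgp_gr} :=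
  mmap sgp_grC
    (fun i => gr_class sgp_max_proper 1 (sgp_mono (tnth (in_tuple (min_gens S)) i))).

(* Q -> k, the quotient by the ideal generated by the variables *)
Definition sgp_poly_eps : {rmorphism sgp_poly -> k} := meval (fun=> 0).

End SemigroupRing.

(* B as an A-module along f : A -> B *)
Definition restr_scalars (A B : comNzRingType) (f : {rmorphism A -> B}) : Type :=
  B.

Section RestrictionOfScalars.
Variables (A B : comNzRingType) (f : {rmorphism A -> B}).

HB.instance Definition _ := GRing.Zmodule.copy (restr_scalars f) B.

Definition restr_scale (a : A) (b : restr_scalars f) : restr_scalars f :=
  f a * (b : B).

Lemma restr_scaleA a b v :
  restr_scale a (restr_scale b v) = restr_scale (a * b) v.
Proof. by rewrite /restr_scale rmorphM mulrA. Qed.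

Lemma restr_scale1 : left_id 1 restr_scale.
Proof. by move=> v; rewrite /restr_scale rmorph1 mul1r. Qed.

Lemma restr_scaleDr : right_distributive restr_scale +%R.
Proof. by move=> a u v; rewrite /restr_scale mulrDr. Qed.

Lemma restr_scaleDl v : {morph restr_scale^~ v : a b / a + b}.
Proof. by move=> a b; rewrite /restr_scale rmorphD mulrDl. Qed.

HB.instance Definition _ := GRing.Zmodule_isLmodule.Build A (restr_scalars f)
  restr_scaleA restr_scale1 restr_scaleDr restr_scaleDl.

End RestrictionOfScalars.

(* ... -> A^(n_2) -> A^(n_1) -> A^(n_0) -> M -> 0, the differentials acting on
   row vectors by right multiplication. Ranks are finite: the rings considered
   are Noetherian and the modules finitely generated. *)
Record free_resolution (A : comNzRingType) (M : lmodType A) := FreeResolution {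
  fr_rank : nat -> nat;
  fr_diff : forall i, 'M[A]_(fr_rank i.+1, fr_rank i);
  fr_aug : {linear 'rV[A]_(fr_rank 0) -> M};
  fr_aug_surj : forall y, exists x, fr_aug x = y;
  fr_exact0 : forall x, fr_aug x = 0 <-> exists y, x = y *m fr_diff 0;
  fr_exactS : forall i (x : 'rV[A]_(fr_rank i.+1)),
    x *m fr_diff i = 0 <-> exists y, x = y *m fr_diff i.+1 }.

(* A an N-graded ring with components Acomp, M an N-graded A-module with
   components Mcomp: F_i is \bigoplus_a A(- fr_shift i a), and all the maps are
   homogeneous of degree 0. *)
Record graded_resolution (A : comNzRingType) (Acomp : nat -> set A)
    (M : lmodType A) (Mcomp : nat -> set M) := GradedResolution {
  gfr_res :> free_resolution M;
  fr_shift : forall i, 'I_(fr_rank gfr_res i) -> nat;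
  fr_diff_homog : forall i a b,
    fr_diff gfr_res i a b = 0 \/
    exists2 d, (d + fr_shift b = fr_shift a)%N & Acomp d (fr_diff gfr_res i a b);
  fr_aug_homog : forall a : 'I_(fr_rank gfr_res 0),
    Mcomp (fr_shift a) (fr_aug gfr_res (delta_mx 0 a)) }.

Section Tor.
Variables (k : fieldType) (A : comNzRingType) (eps : {rmorphism A -> k}).

Section Homology.
Variables (M : lmodType A) (F : free_resolution M).

(* F_i \otimes_A k = k^(n_i), with differentials map_mx eps (fr_diff F i);
   cycles and boundaries are given as row spaces. *)
Definition tor_cycles (i : nat) : 'M[k]_(fr_rank F i) :=
  match i with
  | 0 => 1%:M
  | j.+1 => kermx (map_mx eps (fr_diff F j))
  end.

Definition tor_boundaries (i : nat) : 'M[k]_(fr_rank F i.+1, fr_rank F i) :=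
  map_mx eps (fr_diff F i).

Definition tor_dim (i : nat) : nat :=
  (\rank (tor_cycles i) - \rank (tor_boundaries i))%N.

End Homology.

(* dim_k Tor^A_i(M, k): tor_dim F i does not depend on the resolution F of M,
   and 0 is only a default for an M without resolution of finite type. *)
Definition betti (M : lmodType A) (i : nat) : nat :=
  xget 0%N [set b | exists F : free_resolution M, b = tor_dim F i].

Section GradedHomology.
Variables (Acomp : nat -> set A) (M : lmodType A) (Mcomp : nat -> set M).
Variable F : graded_resolution Acomp Mcomp.

(* the degree j component of F_i \otimes_A k *)
Definition tor_degree (i j : nat) : 'M[k]_(fr_rank F i) :=
  diag_mx (\row_a (fr_shift a == j)%:R).

Definition graded_tor_dim (i j : nat) : nat :=
  (\rank (tor_cycles F i :&: tor_degree i j)%MS -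
   \rank (tor_boundaries F i :&: tor_degree i j)%MS)%N.

End GradedHomology.

(* dim_k Tor^A_i(M, k)_j *)
Definition graded_betti (Acomp : nat -> set A) (M : lmodType A)
    (Mcomp : nat -> set M) (i j : nat) : nat :=
  xget 0%N [set b | exists F : graded_resolution Acomp Mcomp,
                      b = graded_tor_dim F i j].

Definition residue_field : lmodType A := restr_scalars eps.

Definition residue_comp (d : nat) : set residue_field :=
  [set x | d = 0%N \/ x = 0].

Definition koszul (Acomp : nat -> set A) : Prop :=
  forall i j, i != j -> graded_betti Acomp residue_comp i j = 0%N.

End Tor.

Section Invariants.
Variables (k : fieldType) (S : numsgp).

Definition sgp_finite_betti (i : nat) : nat :=
  betti (sgp_poly_eps k S) (restr_scalars (sgp_poly_to_gr k S)) i.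

(* the Poincare series of gr_m(k[S]), as the sequence of its coefficients *)
Definition sgp_poincare : nat -> nat :=
  fun i => betti (@sgp_gr_eps k S) (residue_field (@sgp_gr_eps k S)) i.

Definition sgp_gr_koszul : Prop :=
  koszul (@sgp_gr_eps k S) (@sgp_gr_comp k S).

(* k[S] is Koszul when gr_m(k[S]) is *)
Definition sgp_ring_koszul : Prop := sgp_gr_koszul.

End Invariants.

(* Main.v *)
Require Import Defs.
From HB Require Import structures.
From mathcomp Require Import all_boot all_order all_algebra.
From mathcomp Require Import generic_quotient ring_quotient.
From mathcomp Require Import boolp classical_sets filter reals topology.
From mathcomp Require Import mpoly zify ring lra.

(** * Invariants which are not constant on faces of the Kunz cone

    The associated graded ring of [k[S]] has a basis indexed by [S], and the product
    of the classes of [t^s] and [t^u] is the class of [t^(s + u)] if the largest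
    lengths of factorizations add up, and zero otherwise. The face of the Kunz cone
    records which sums of Apery elements are Apery elements, but not how far the
    other sums are from the Apery set, hence not which products vanish in the
    associated graded ring. Two pairs of semigroups exploit this.

    The semigroups generated by [4, 7, 9] and [4, 7, 17] lie in the same face. Their
    associated graded rings are polynomial rings in [x, y, z] modulo
    [(yz, z^2, y^3)] and [(xz, yz, z^2, y^4)], where [xz] vanishes because
    [17 + 4 = 7 + 7 + 7]. The numbers of relations, 3 and 4, are the first Betti
    numbers over the polynomial ring, and they contribute to the second Betti number
    of the residue field, which is 3 plus the number of relations.

    The semigroups generated by [8, 17, 18, 20] and either 31 or 47 lie in the same
    face. The three squares [y^2, z^2, w^2] and the products [ay, az, aw, a^2] are
    relations in both cases. In addition the identity between [17 + 18 + 20] and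
    [a_7] plus a multiple of 8 gives the cubic relation [yzw] in the first case and
    the quadratic relation [xa] in the second one. So the second ring is Koszul and
    the first one is not.

    In the four cases the associated graded ring is the quotient of a polynomial ring
    by monomials ([sgp_gr_monomial]); it suffices to exhibit for each relation a longer
    factorization of the same integer, and to check that the other monomials have
    distinct weights. The homological statements hold for all rings with such a
    presentation. The dimensions of [Tor] do not depend on the resolution because of
    [tor_dim_minimal_start], which compares an arbitrary resolution with the beginning
    of a minimal one; it gives [tor_dim1] and [tor_dim2]. Koszulness for quadratic
    relations ([koszul_quadratic]) follows from the filtration by ideals generated by
    variables, and the obstruction by a minimal relation of degree at least three is
    [graded_tor_dim_minimal_nonstandard]. Since Betti numbers have a default value
    for modules without resolution, resolutions must be shown to exist:
    [residue_graded_resolution] over the associated graded rings and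
    [quot_resolution] over the polynomial ring. *)

Set Implicit Arguments.
Unset Strict Implicit.
Unset Printing Implicit Defensive.

Import Order.TTheory GRing.Theory Num.Theory.
Import numFieldTopology.Exports.

Local Open Scope ring_scope.
Local Open Scope classical_set_scope.

(** * Comparison of free resolutions *)
Section Lifting.
Variable A : comNzRingType.

Lemma row_fun_choice (T : Type) n (P : 'I_n -> T -> Prop) :
  (forall i, exists y, P i y) -> exists f, forall i, P i (f i).
Proof.
by move=> H; exists (fun i => sval (cid (H i))) => i; case: cid.
Qed.

Lemma rows_lift m n p (X : 'M[A]_(m, n)) (D : 'M[A]_(p, n)) :
  (forall i, exists y, row i X = y *m D) -> exists Y, X = Y *m D.
Proof.
move=> /row_fun_choice[f fP]; exists (\matrix_i f i).
by apply/row_matrixP => i; rewrite row_mul rowK.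
Qed.

Section Comparison.
Variables (M : lmodType A) (p q : nat -> nat).
Variables (d : forall i, 'M[A]_(p i.+1, p i)) (a : {linear 'rV[A]_(p 0) -> M}).
Variables (e : forall i, 'M[A]_(q i.+1, q i)) (b : {linear 'rV[A]_(q 0) -> M}).
Variable N : nat.
Hypothesis ex0 : forall x, b x = 0 -> exists y, x = y *m e 0.
Hypothesis exS : forall i, (i < N)%N -> forall x : 'rV[A]_(q i.+1),
  x *m e i = 0 -> exists y, x = y *m e i.+1.

(** The lift is built degree by degree: once the square in degree [i] commutes,
    the rows of [d i *m f i] are killed by the next map of the target, so that
    exactness provides preimages for them. Exactness is assumed in degrees below
    [N] only, since the target will be the beginning of a resolution. *)
Lemma comparison_map :
  (forall y, exists x, b x = y) -> (forall y, a (y *m d 0) = 0) ->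
  (forall i, (i < N)%N -> d i.+1 *m d i = 0) ->
  exists f : forall i, 'M[A]_(p i, q i),
    (forall x, b (x *m f 0) = a x) /\
    forall i, (i <= N)%N -> d i *m f i = f i.+1 *m e i.
Proof.
move=> bsurj ad dd.
have [g gP] := row_fun_choice (fun i => bsurj (a (delta_mx 0 i))).
pose f0 : 'M[A]_(p 0, q 0) := \matrix_i g i.
have f0P x : b (x *m f0) = a x.
  rewrite (row_sum_delta x) mulmx_suml !linear_sum.
  apply: eq_bigr => i _; rewrite -scalemxAl !linearZ /= -rowE rowK.
  by rewrite gP.
pose f := fix f i : 'M[A]_(p i, q i) := match i return 'M[A]_(p i, q i) with
  | 0 => f0
  | j.+1 => xget 0 [set Y | d j *m f j = Y *m e j]
  end.
exists f; split=> //.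
have step i : (exists Y, d i *m f i = Y *m e i) -> d i *m f i = f i.+1 *m e i.
  by move=> ex; rewrite {2}/f -/f; have := xgetPex 0 ex.
elim=> [_|i IHi iN]; apply: step; apply: rows_lift => r.
  by apply: ex0; rewrite row_mul f0P rowE ad.
apply: (exS iN); rewrite -row_mul -mulmxA -IHi ?(ltnW iN) //.
by rewrite mulmxA dd // mul0mx row0.
Qed.

(** The same recursion for a chain map [h] which induces zero on [M]: at each
    stage [h] minus what the homotopy already accounts for has its rows in a
    kernel, hence in an image. *)
Lemma comparison_homotopy (h : forall i, 'M[A]_(p i, q i)) :
  (forall x, b (x *m h 0) = 0) ->
  (forall i, (i < N)%N -> d i *m h i = h i.+1 *m e i) ->
  (forall i, (i.+1 < N)%N -> d i.+1 *m d i = 0) ->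
  exists s : forall i, 'M[A]_(p i, q i.+1), h 0 = s 0 *m e 0 /\
    forall i, (i < N)%N -> h i.+1 = s i.+1 *m e i.+1 + d i *m s i.
Proof.
move=> h0 hd dd.
have [s0 s0P] : exists Y, h 0 = Y *m e 0.
  by apply: rows_lift => r; apply: ex0; rewrite rowE h0.
pose s := fix s i : 'M[A]_(p i, q i.+1) :=
  match i return 'M[A]_(p i, q i.+1) with
  | 0 => s0
  | j.+1 => xget 0 [set Y | h j.+1 - d j *m s j = Y *m e j.+1]
  end.
exists s; split=> //.
have step i : (exists Y, h i.+1 - d i *m s i = Y *m e i.+1) ->
    h i.+1 = s i.+1 *m e i.+1 + d i *m s i.
  move=> ex; rewrite {1}/s -/s; have := xgetPex 0 ex => <-.
  by rewrite subrK.
elim=> [N0|i IHi iN]; apply: step; apply: rows_lift => r; apply: exS => //.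
  by rewrite -row_mul mulmxBl -hd // s0P mulmxA subrr row0.
rewrite -row_mul mulmxBl -hd // IHi ?(ltnW iN) // mulmxDr !mulmxA dd //.
by rewrite mul0mx addr0 subrr row0.
Qed.

End Comparison.
End Lifting.

Section MinimalStart.
Variables (k : fieldType) (A : comNzRingType) (eps : {rmorphism A -> k}).
Variables (M : lmodType A) (F : free_resolution M).
Variables (q : nat -> nat) (e : forall i, 'M[A]_(q i.+1, q i)).
Variables (b : {linear 'rV[A]_(q 0) -> M}) (n : nat).
Hypothesis b_surj : forall y, exists x, b x = y.
Hypothesis ex0 : forall x, b x = 0 <-> exists y, x = y *m e 0.
Hypothesis exS : forall i, (i < n)%N -> forall x : 'rV[A]_(q i.+1),
  x *m e i = 0 <-> exists y, x = y *m e i.+1.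
Hypothesis min_diff : map_mx eps (e n) = 0.
Hypothesis min_ker : forall x : 'rV[A]_(q n.+1), x *m e n = 0 -> map_mx eps x = 0.

Lemma fr_diff_comp i : fr_diff F i.+1 *m fr_diff F i = 0.
Proof.
apply/row_matrixP => r; rewrite row_mul row0; apply/fr_exactS.
by exists (delta_mx 0 r); rewrite rowE.
Qed.

(** Exactness of the complex [e] up to degree [n] suffices for the Betti number in
    degree [n.+1]. The comparison maps [f] from [F] and
    [g] to [F] are inverse to each other up to homotopy. In degree [n.+1] the
    composite [g *m f] differs from the identity by a multiple of [e n], which
    dies over [k], and by rows in the kernel of [e n], which die over [k] by
    [min_ker]; so [f] maps the cycles of [F] over [k] onto [k^(q n.+1)]. The
    homotopy on the side of [F] shows that the kernel of this map consists of
    boundaries. *)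
Theorem tor_dim_minimal_start : tor_dim eps F n.+1 = q n.+1.
Proof.
have e_comp i : (i < n)%N -> e i.+1 *m e i = 0.
  move=> iN; apply/row_matrixP => r; rewrite row_mul row0; apply/(exS iN).
  by exists (delta_mx 0 r); rewrite rowE.
have Faug y : fr_aug F (y *m fr_diff F 0) = 0 by apply/fr_exact0; exists y.
have Gaug y : b (y *m e 0) = 0 by apply/ex0; exists y.
have Fex0 x : fr_aug F x = 0 -> exists y, x = y *m fr_diff F 0.
  by move/fr_exact0.
have FexS N i : (i < N)%N -> forall x : 'rV[A]_(fr_rank F i.+1),
    x *m fr_diff F i = 0 -> exists y, x = y *m fr_diff F i.+1.
  by move=> _ x /fr_exactS.
have Gex0 x : b x = 0 -> exists y, x = y *m e 0 by move/ex0.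
have GexS i : (i < n)%N -> forall x : 'rV[A]_(q i.+1), x *m e i = 0 -> exists y, x = y *m e i.+1.
  by move=> iN x /(exS iN).
have [f [f0 fd]] := comparison_map Gex0 GexS b_surj Faug
  (fun i _ => fr_diff_comp i).
have [g [g0 gd]] := comparison_map Fex0 (FexS n) (@fr_aug_surj _ _ F) Gaug e_comp.
pose l i := f i *m g i - 1%:M.
have l0 x : fr_aug F (x *m l 0) = 0.
  by rewrite /l mulmxBr mulmx1 linearB /= mulmxA g0 f0 subrr.
have ld i : (i < n.+1)%N -> fr_diff F i *m l i = l i.+1 *m fr_diff F i.
  move=> iN; rewrite /l mulmxBr mulmxBl mulmx1 mul1mx mulmxA fd //.
  by rewrite -!mulmxA gd.
have [s [_ sP]] := comparison_homotopy Fex0 (FexS n.+1) l0 ld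
  (fun i _ => fr_diff_comp i).
pose h i := g i *m f i - 1%:M.
have hd i : (i <= n)%N -> e i *m h i = h i.+1 *m e i.
  by move=> iN; rewrite /h mulmxBr mulmxBl mulmx1 mul1mx mulmxA gd // -!mulmxA fd.
have h0 x : b (x *m h 0) = 0.
  by rewrite /h mulmxBr mulmx1 linearB /= mulmxA f0 g0 subrr.
have [t [t0 tP]] := comparison_homotopy Gex0 GexS h0
  (fun i iN => hd i (ltnW iN)) (fun i iN => e_comp i (ltnW iN)).
have min_mx m (X : 'M[A]_(m, _)) : X *m e n = 0 -> map_mx eps X = 0.
  move=> X0; apply/row_matrixP => r; rewrite -map_row row0; apply: min_ker.
  by rewrite -row_mul X0 row0.
have eht i : (i <= n)%N -> e i *m (h i - t i *m e i) = 0.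
  case: i => [_|i iN]; first by rewrite t0 subrr mulmx0.
  by rewrite tP // addrC addKr mulmxA e_comp // mul0mx.
have hn : map_mx eps (h n.+1) = 0.
  rewrite -(subrK (e n *m t n) (h n.+1)) map_mxD map_mxM min_diff mul0mx addr0.
  by apply: min_mx; rewrite mulmxBl -hd // -mulmxA -mulmxBr eht.
pose fk := map_mx eps (f n.+1); pose gk := map_mx eps (g n.+1).
have gfk : gk *m fk = 1%:M.
  by apply/eqP; rewrite -subr_eq0 -map_mxM -(map_mx1 eps) -map_mxB hn.
set Z := tor_cycles eps F n.+1; set B := tor_boundaries eps F n.+1.
have BZ : (B <= Z)%MS.
  by apply/sub_kermxP; rewrite -map_mxM fr_diff_comp map_mx0.
have Bf : B *m fk = 0.
  rewrite -map_mxM; apply: min_mx.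
  by rewrite -mulmxA -fd // mulmxA fr_diff_comp mul0mx.
have gZ : (gk <= Z)%MS.
  by apply/sub_kermxP; rewrite -map_mxM -gd // map_mxM min_diff mul0mx.
have ZB : (Z :&: kermx fk <= B)%MS.
  apply/row_subP => i; have := row_sub i (Z :&: kermx fk)%MS.
  rewrite sub_capmx => /andP[/sub_kermxP zd /sub_kermxP zf].
  set z := row i _ in zd zf *.
  have := congr1 (fun X => z *m map_mx eps X) (sP n (ltnSn n)).
  rewrite map_mxB map_mxM map_mx1 mulmxBr mulmx1 mulmxA zf mul0mx sub0r.
  rewrite map_mxD !map_mxM mulmxDr (mulmxA z (map_mx eps (fr_diff F n))) zd.
  rewrite mul0mx addr0 => /(congr1 -%R); rewrite opprK => ->.
  by rewrite -mulNmx mulmxA submxMl.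
rewrite /tor_dim -/Z -/B -(mxrank_mul_ker Z fk).
have -> : \rank (Z :&: kermx fk) = \rank B.
  apply/eqP; rewrite eqn_leq !mxrankS //.
  by rewrite sub_capmx BZ; apply/sub_kermxP.
rewrite addnK; apply/eqP; rewrite eqn_leq rank_leq_col /=.
rewrite -{1}(mxrank1 k (q n.+1)) -gfk; apply: mxrankS; exact: submxMr.
Qed.

End MinimalStart.
(** * Rings with a monomial presentation *)
Section MpolyFilter.
Variables (k : fieldType) (n : nat).
Implicit Types (p : {mpoly k[n]}) (m u : 'X_{1..n}).

Definition mfilter (P : pred 'X_{1..n}) p : {mpoly k[n]} :=
  \sum_(m <- msupp p | P m) p@_m *: 'X_[m].

Lemma mcoeff_filter P p m : (mfilter P p)@_m = if P m then p@_m else 0.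
Proof.
rewrite /mfilter raddf_sum /=.
under eq_bigr do rewrite mcoeffZ mcoeffX.
have [mp|mp] := boolP (m \in msupp p); last first.
  rewrite (memN_msupp_eq0 mp) if_same big_seq_cond big1 // => u /andP[up _].
  case: eqP up => [->|_ _]; first by rewrite (negPf mp).
  by rewrite mulr0.
rewrite big_mkcond (bigD1_seq m) ?msupp_uniq //= eqxx mulr1 big1 ?addr0 // => u um.
by rewrite (negPf um) mulr0 if_same.
Qed.

Lemma mcoeff_mulX p u m :
  (p * 'X_[u])@_m = if (u <= m)%MM then p@_(m - u) else 0.
Proof.
case: ifP => um; first by rewrite -{1}(submK um) addmC mcoeffMX.
rewrite mcoeffM big1 // => -[a b] /= /eqP mab; rewrite mcoeffX.
case: eqP => [ub|_]; last by rewrite mulr0.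
by rewrite mab ub lem_addl in um.
Qed.

End MpolyFilter.

Definition standard n (gs : seq 'X_{1..n}) : pred 'X_{1..n} :=
  fun m => ~~ has (fun g => (g <= m)%MM) gs.

Lemma standard_le n (gs : seq 'X_{1..n}) m u :
  (m <= u)%MM -> standard gs u -> standard gs m.
Proof.
move=> mu; apply: contra => /hasP[g ggs gm]; apply/hasP; exists g => //.
exact: lepm_trans mu.
Qed.

(** [A] is the quotient of the polynomial ring by the ideal spanned by the
    nonstandard monomials. This is a property of a surjection [phi] rather than
    an isomorphism with a quotient ring, so that it can be established for an
    associated graded ring and its own components and augmentation. *)
Record monomial_presentation (k : fieldType) (n : nat) (gs : seq 'X_{1..n})
    (A : comNzRingType) (phi : {rmorphism {mpoly k[n]} -> A})
    (eps : {rmorphism A -> k}) (Acomp : nat -> set A) : Prop :=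
  MonomialPresentation {
    mpres_surj : forall a, exists f, a = phi f;
    mpres_ker : forall f, phi f = 0 <-> forall m, standard gs m -> f@_m = 0;
    mpres_eps : forall f, eps (phi f) = f@_0%MM;
    mpres_comp : forall d a, Acomp d a <->
      exists f, a = phi f /\ forall m, f@_m != 0 -> mdeg m = d }.

Section MonomialRing.
Variables (k : fieldType) (n : nat) (gs : seq 'X_{1..n}) (A : comNzRingType).
Variables (phi : {rmorphism {mpoly k[n]} -> A}) (eps : {rmorphism A -> k}).
Variable (Acomp : nat -> set A).
Hypothesis pres : monomial_presentation gs phi eps Acomp.

(** Two lifts of [a] have the same coefficients on the standard monomials, so
    an arbitrary choice of lift gives well defined coefficients [mcf]. *)
Definition mlift (a : A) : {mpoly k[n]} := xget 0 [set f | a = phi f].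

Lemma mliftK a : phi (mlift a) = a.
Proof. by have := xgetPex 0 (mpres_surj pres a). Qed.

Definition mcf (m : 'X_{1..n}) (a : A) : k :=
  if standard gs m then (mlift a)@_m else 0.

Lemma mcf_phi m f : mcf m (phi f) = if standard gs m then f@_m else 0.
Proof.
rewrite /mcf; case: ifP => // Em.
have /(mpres_ker pres)/(_ m Em) : phi (mlift (phi f) - f) = 0.
  by rewrite rmorphB mliftK subrr.
by rewrite mcoeffB => /eqP; rewrite subr_eq0 => /eqP.
Qed.

Lemma mcf_is_zmod_morphism m : zmod_morphism (mcf m).
Proof.
move=> a b; rewrite -(mliftK a) -(mliftK b) -rmorphB !mcf_phi.
by case: ifP => _; rewrite ?subrr // mcoeffB.
Qed.

HB.instance Definition _ m :=
  GRing.isZmodMorphism.Build A k (mcf m) (mcf_is_zmod_morphism m).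

Lemma mcf_ext a b : (forall m, standard gs m -> mcf m a = mcf m b) -> a = b.
Proof.
move=> ab; apply/eqP; rewrite -subr_eq0 -(mliftK a) -(mliftK b) -rmorphB.
apply/eqP/(mpres_ker pres) => m Em.
have := ab m Em; rewrite /mcf Em mcoeffB => ->; exact: subrr.
Qed.

Lemma mcf_nonstd m a : ~~ standard gs m -> mcf m a = 0.
Proof. by rewrite /mcf => /negPf ->. Qed.

Lemma mcf_neq0_std m a : mcf m a != 0 -> standard gs m.
Proof. by apply: contraNT => /mcf_nonstd ->. Qed.

(** Divisors of standard monomials are standard: multiplication by a monomial
    shifts the coefficients and forgets those that become nonstandard. *)
Lemma mcf_mulX m u a : mcf m (a * phi 'X_[u]) =
  if standard gs m && (u <= m)%MM then mcf (m - u) a else 0.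
Proof.
rewrite -{1}(mliftK a) -rmorphM mcf_phi mcoeff_mulX.
case: ifP => //= Em; case: ifP => // um; rewrite /mcf.
by rewrite (standard_le _ Em) // lem_subr.
Qed.

Lemma mcf_scale m c a : mcf m (phi c%:MP * a) = c * mcf m a.
Proof.
rewrite -{1}(mliftK a) -rmorphM mcf_phi mul_mpolyC mcoeffZ /mcf.
by case: ifP; rewrite ?mulr0.
Qed.

Definition mres (P : pred 'X_{1..n}) (a : A) : A := phi (mfilter P (mlift a)).

Lemma mcf_res P m a : mcf m (mres P a) = if P m then mcf m a else 0.
Proof.
by rewrite mcf_phi mcoeff_filter /mcf; case: ifP; case: ifP.
Qed.

Lemma mres_is_zmod_morphism P : zmod_morphism (mres P).
Proof.
move=> a b; apply: mcf_ext => m _; rewrite raddfB /= !mcf_res raddfB /=.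
by case: ifP; rewrite ?subrr.
Qed.

HB.instance Definition _ P :=
  GRing.isZmodMorphism.Build A A (mres P) (mres_is_zmod_morphism P).

Lemma mcf_expand a : exists s : seq 'X_{1..n},
  (forall m, m \in s -> mcf m a != 0) /\
  a = \sum_(m <- s) phi (mcf m a)%:MP * phi 'X_[m].
Proof.
exists [seq m <- msupp (mlift a) | standard gs m]; split.
  by move=> m; rewrite mem_filter /mcf mcoeff_msupp => /andP[->].
have -> : \sum_(m <- [seq m <- msupp (mlift a) | standard gs m])
    phi (mcf m a)%:MP * phi 'X_[m] = phi (mfilter (standard gs) (mlift a)).
  rewrite /mfilter rmorph_sum big_filter; apply: eq_bigr => m Em.
  by rewrite -rmorphM mul_mpolyC /mcf Em.
by apply: mcf_ext => m Em; rewrite mcf_phi mcoeff_filter /mcf Em.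
Qed.

Lemma mcf_bounded a : exists N, forall m, (N <= mdeg m)%N -> mcf m a = 0.
Proof.
exists (msize (mlift a)) => m Nm; rewrite /mcf; case: ifP => // _.
exact/memN_msupp_eq0/msize_mdeg_ge.
Qed.

Lemma standard0 : standard gs 0%MM.
Proof.
apply: contraT => E0; have /eqP : phi 1 = 0.
  apply/(mpres_ker pres) => m Em.
  have le0 : (0 <= m)%MM by apply/mnm_lepP => i; rewrite mnm0E.
  by rewrite (standard_le le0 Em) in E0.
by rewrite rmorph1 oner_eq0.
Qed.

Lemma eps_cf a : eps a = mcf 0%MM a.
Proof. by rewrite -{1}(mliftK a) (mpres_eps pres) /mcf standard0. Qed.

Lemma epsC c : eps (phi c%:MP) = c.
Proof. by rewrite (mpres_eps pres) mcoeffC eqxx mulr1. Qed.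

Lemma compP d a : Acomp d a <-> forall m, mcf m a != 0 -> mdeg m = d.
Proof.
split=> [/(mpres_comp pres)[f [-> fP]] m|ad].
  by rewrite mcf_phi; case: ifP => _; [apply: fP|rewrite eqxx].
apply/(mpres_comp pres); exists (mfilter (standard gs) (mlift a)).
split; first by apply: mcf_ext => m Em; rewrite mcf_phi mcoeff_filter /mcf Em.
move=> m; rewrite mcoeff_filter; have := ad m; rewrite /mcf.
by case: ifP => // _; rewrite eqxx.
Qed.

(** The homogeneous components of an element: the ideal of relations is spanned
    by monomials, so selecting coefficients is well defined on [A]. *)
Definition hcomp (d : nat) : A -> A := mres (fun m => mdeg m == d).

HB.instance Definition _ d := GRing.isZmodMorphism.Build A A (hcomp d)
  (mres_is_zmod_morphism (fun m => mdeg m == d)).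

Lemma mcf_hcomp d m a : mcf m (hcomp d a) = if mdeg m == d then mcf m a else 0.
Proof. exact: mcf_res. Qed.

Lemma hcompP d a : Acomp d (hcomp d a).
Proof.
by apply/compP => m; rewrite mcf_hcomp; case: (eqVneq (mdeg m) d) => //; rewrite eqxx.
Qed.

Lemma hcomp_id d a : Acomp d a -> hcomp d a = a.
Proof.
move=> /compP ad; apply: mcf_ext => m _; rewrite mcf_hcomp.
have [->|/ad ->] := eqVneq (mcf m a) 0; first by rewrite if_same.
by rewrite eqxx.
Qed.

Lemma hcomp_mulX d u a : hcomp (mdeg u + d) (a * phi 'X_[u]) = hcomp d a * phi 'X_[u].
Proof.
apply: mcf_ext => m Em; rewrite mcf_hcomp !mcf_mulX mcf_hcomp Em /=.
case: (boolP (u <= m)%MM) => um; last by rewrite if_same.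
by rewrite -{1}(submK um) mdegD addnC eqn_add2l.
Qed.

Lemma hcomp_mulX_small d u a : (d < mdeg u)%N -> hcomp d (a * phi 'X_[u]) = 0.
Proof.
move=> du; apply: mcf_ext => m Em; rewrite mcf_hcomp mcf_mulX Em raddf0 /=.
case: eqP => // md; case: (boolP (u <= m)%MM) => // um; move: du.
by rewrite -md -(submK um) mdegD ltnNge leq_addl.
Qed.

Lemma hcomp_scale d c a : hcomp d (phi c%:MP * a) = phi c%:MP * hcomp d a.
Proof.
apply: mcf_ext => m _; rewrite mcf_hcomp !mcf_scale mcf_hcomp.
by case: ifP; rewrite ?mulr0.
Qed.

Lemma hcomp_mul d e a b : Acomp d b -> hcomp (d + e) (a * b) = hcomp e a * b.
Proof.
move=> /compP bd; have [s [sP ->]] := mcf_expand b.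
rewrite !mulr_sumr raddf_sum /=; rewrite !big_seq; apply: eq_bigr => m /sP/bd <-.
by rewrite mulrCA hcomp_scale hcomp_mulX mulrCA.
Qed.

Lemma hcomp_mul_small d e a b : Acomp d b -> (e < d)%N -> hcomp e (a * b) = 0.
Proof.
move=> /compP bd ed; have [s [sP ->]] := mcf_expand b.
rewrite mulr_sumr raddf_sum /=; rewrite big_seq big1 // => m /sP/bd md.
by rewrite mulrCA hcomp_scale hcomp_mulX_small ?md // mulr0.
Qed.

Lemma compC c : Acomp 0 (phi c%:MP).
Proof.
apply/compP => m; rewrite mcf_phi mcoeffC; case: ifP; rewrite ?eqxx //= => _.
by case: (eqVneq m 0%MM) => [->|_]; rewrite ?mdeg0 // mulr0 eqxx.
Qed.

Lemma compX u : Acomp (mdeg u) (phi 'X_[u]).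
Proof.
apply/compP => m; rewrite mcf_phi mcoeffX; case: ifP; rewrite ?eqxx //= => _.
by case: (eqVneq u m) => [->|_] //; rewrite eqxx.
Qed.

Lemma comp_eps0 d a : Acomp d a -> (0 < d)%N -> eps a = 0.
Proof.
move=> /compP ad d0; rewrite eps_cf; apply/eqP; apply: contraTT d0 => /ad.
by rewrite mdeg0 => <-.
Qed.

Lemma hcomp_sum a : exists N, forall M, (N <= M)%N -> a = \sum_(d < M) hcomp d a.
Proof.
have [N NP] := mcf_bounded a; exists N => M NM; apply: mcf_ext => m Em.
rewrite raddf_sum /=; have [mM|Mm] := ltnP (mdeg m) M; last first.
  by rewrite NP ?(leq_trans NM) // big1 // => d _; rewrite mcf_hcomp NP ?if_same
    ?(leq_trans NM).
rewrite (bigD1 (Ordinal mM)) //= mcf_hcomp eqxx big1 ?addr0 // => d dm.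
rewrite mcf_hcomp; case: eqP => // dd; case/eqP: dm; exact: val_inj.
Qed.

Section Rows.
Variables (p : nat) (sh : 'I_p -> nat).

(** Component of degree [j] in the graded free module with generators in degrees
    [sh a]; nothing lives in degrees below [sh a], where the subtraction of
    natural numbers would be meaningless. *)
Definition rcomp (j : nat) (x : 'rV[A]_p) : 'rV[A]_p :=
  \row_a (if (sh a <= j)%N then hcomp (j - sh a) (x 0 a) else 0).

Lemma rcomp_is_zmod_morphism j : zmod_morphism (rcomp j).
Proof.
move=> x y; apply/rowP => a; rewrite !mxE.
by case: ifP; rewrite ?subr0 // raddfB.
Qed.

HB.instance Definition _ j := GRing.isZmodMorphism.Build 'rV[A]_p 'rV[A]_p
  (rcomp j) (rcomp_is_zmod_morphism j).

Lemma rcomp_idem j x : rcomp j (rcomp j x) = rcomp j x.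
Proof.
apply/rowP => a; rewrite !mxE; case: (sh a <= j)%N => //.
exact: hcomp_id (hcompP _ _).
Qed.

Lemma rcomp_sum x : exists M, x = \sum_(j < M) rcomp j x.
Proof.
pose N a := sval (cid (hcomp_sum (x 0 a))).
exists (\max_a (N a + sh a)); apply/rowP => a; rewrite summxE.
set M := \max_a _; have aM : (N a + sh a <= M)%N by exact: leq_bigmax.
have shM : (sh a <= M)%N by apply: leq_trans aM; apply: leq_addl.
rewrite {1}(svalP (cid (hcomp_sum (x 0 a))) (M - sh a)%N); last first.
  by rewrite leq_subRL // addnC.
under [RHS]eq_bigr do rewrite mxE.
rewrite -(big_mkord predT (fun j => if (sh a <= j)%N then hcomp (j - sh a) (x 0 a) else 0)).
rewrite (big_cat_nat (leq0n _) shM) /= [X in _ = X + _]big_nat [X in _ = X + _]big1 => [|j ja].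
  rewrite add0r -[X in \sum_(X <= _ < _) _]add0n big_addn.
  rewrite -(big_mkord predT (fun j => hcomp j (x 0 a))).
  by apply: eq_bigr => j _; rewrite leq_addl addnK.
by rewrite leqNgt; case/andP: ja => _ ->.
Qed.

End Rows.

(** Matrices of homogeneous maps of degree zero between graded free modules *)
Definition mx_homog p q (sp : 'I_p -> nat) (sq : 'I_q -> nat) (D : 'M[A]_(p, q)) :=
  forall a b, D a b = 0 \/ exists2 d, (d + sq b = sp a)%N & Acomp d (D a b).

Lemma rcomp_mul p q (sp : 'I_p -> nat) (sq : 'I_q -> nat) (D : 'M[A]_(p, q)) j x :
  mx_homog sp sq D -> rcomp sq j (x *m D) = rcomp sp j x *m D.
Proof.
move=> Dh; apply/rowP => b; rewrite !mxE.
have [bj|jb] := leqP (sq b) j; last first.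
  rewrite big1 // => a _; rewrite mxE; case: ifP; last by rewrite mul0r.
  case: (Dh a b) => [->|[d dab _]]; first by rewrite mulr0.
  by move=> aj; move: jb; rewrite ltnNge (leq_trans _ aj) // -dab leq_addl.
rewrite raddf_sum /=; apply: eq_bigr => a _; rewrite mxE.
case: (Dh a b) => [->|[d dab dD]]; first by rewrite !mulr0 raddf0.
have [aj|ja] := leqP (sp a) j; last first.
  rewrite mul0r (hcomp_mul_small _ dD) // ltn_subLR //.
  by rewrite (leq_trans ja) // -dab addnC.
rewrite -(hcomp_mul _ _ dD); congr hcomp.
by rewrite -dab in aj *; lia.
Qed.

(** * Quadratic monomial relations give Koszul rings *)

Lemma mcf_dvdX u a : (forall m, mcf m a != 0 -> (u <= m)%MM) ->
  exists b, a = b * phi 'X_[u].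
Proof.
move=> ua; have [s [sP ->]] := mcf_expand a.
exists (\sum_(m <- s) phi (mcf m a)%:MP * phi 'X_[m - u]).
rewrite mulr_suml; rewrite !big_seq; apply: eq_bigr => m /sP/ua um.
by rewrite -mulrA; congr (_ * _); rewrite -rmorphM -mpolyXD submK.
Qed.

(** The ideal generated by the variables in [T]. It is spanned by monomials, which
    makes intersections, homogeneous components and colon ideals visible on
    exponents. *)
Definition var_ideal (T : seq 'I_n) (a : A) : Prop :=
  forall m, mcf m a != 0 -> has (fun i => 0 < m i)%N T.

Lemma var_ideal0 T : var_ideal T 0.
Proof. by move=> m; rewrite raddf0 eqxx. Qed.

Lemma var_idealD T a b : var_ideal T a -> var_ideal T b -> var_ideal T (a + b).
Proof.
move=> Ja Jb m; rewrite raddfD /=; have [->|/Ja //] := eqVneq (mcf m a) 0.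
by rewrite add0r => /Jb.
Qed.

Lemma var_ideal_sum T (I : Type) (r : seq I) (f : I -> A) :
  (forall i, var_ideal T (f i)) -> var_ideal T (\sum_(i <- r) f i).
Proof.
by move=> H; elim/big_ind: _ => //; [apply: var_ideal0|apply: var_idealD].
Qed.

Lemma var_idealMX T a u : var_ideal T a -> var_ideal T (a * phi 'X_[u]).
Proof.
move=> Ja m; rewrite mcf_mulX; case: ifP => [|_]; last by rewrite eqxx.
move=> _ /Ja /hasP[i iT mi]; apply/hasP; exists i => //.
by rewrite mnmBE in mi; apply: leq_trans mi (leq_subr _ _).
Qed.

Lemma var_idealM T a b : var_ideal T a -> var_ideal T (a * b).
Proof.
move=> Ja; have [s [_ ->]] := mcf_expand b; rewrite mulr_sumr.
apply: var_ideal_sum => m; rewrite mulrCA => u; rewrite mcf_scale mulf_eq0.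
by rewrite negb_or => /andP[_]; apply: var_idealMX.
Qed.

Lemma var_ideal_hcomp T d a : var_ideal T a -> var_ideal T (hcomp d a).
Proof.
by move=> Ja m; rewrite mcf_hcomp; case: (mdeg m == d); [apply: Ja|rewrite eqxx].
Qed.

Lemma var_idealX T l a : l \in T -> var_ideal T (a * phi 'X_l).
Proof.
move=> lT m; rewrite mcf_mulX; case: ifP => [/andP[_ lm] _|_]; last by rewrite eqxx.
by apply/hasP; exists l => //; rewrite lt0n -lep1mP.
Qed.

Lemma var_ideal_nil a : var_ideal [::] a -> a = 0.
Proof.
move=> Ja; apply: mcf_ext => m _; rewrite raddf0; apply/eqP.
by apply: contraT => /Ja.
Qed.

Lemma var_ideal_all a : eps a = 0 -> var_ideal (enum 'I_n) a.
Proof.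
move=> ea m ma; have : m != 0%MM.
  by apply: contra_neq ma => ->; rewrite -eps_cf.
rewrite -mdeg_eq0 mdegE sum_nat_eq0 negb_forall => /existsP[i /= mi].
by apply/hasP; exists i; rewrite ?mem_enum // lt0n.
Qed.

Lemma var_ideal_cons l T a : var_ideal (l :: T) a ->
  exists b c, a = b * phi 'X_l + c /\ var_ideal T c.
Proof.
move=> Ja; pose c := mres (fun m => has (fun i => 0 < m i)%N T) a.
have [b bP] : exists b, a - c = b * phi 'X_l.
  apply: mcf_dvdX => m; rewrite raddfB /= mcf_res.
  case: ifPn => [_|mT]; first by rewrite subrr eqxx.
  by rewrite subr0 => /Ja /=; rewrite (negPf mT) orbF lt0n lep1mP.
exists b, c; split; first by rewrite -bP subrK.
by move=> m; rewrite mcf_res; case: ifP; rewrite ?eqxx.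
Qed.

Definition annvars (l : 'I_n) : seq 'I_n :=
  [seq i <- enum 'I_n | ~~ standard gs (U_(i) + U_(l))%MM].

Definition quadratic_gens := forall g, g \in gs ->
  exists i j, g = (U_(i) + U_(j))%MM.

(** The colon ideal of [T] by a further variable is again generated by variables.
    If a standard monomial [m] becomes nonstandard when multiplied by the variable
    [l], the quadratic relation responsible for it must involve [l], and its other
    variable divides [m] and annihilates [l]. *)
Lemma var_ideal_colon T l b : quadratic_gens -> l \notin T ->
  var_ideal T (b * phi 'X_l) -> var_ideal (T ++ annvars l) b.
Proof.
move=> quad lT Jb m mb; rewrite has_cat; have Em := mcf_neq0_std mb.
have [Eml|Eml] := boolP (standard gs (m + U_(l))%MM).
  have := Jb (m + U_(l))%MM; rewrite mcf_mulX Eml lem_addl addmK => /(_ mb).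
  case/hasP=> i iT; rewrite mnmDE mnm1E => mi; apply/orP; left.
  apply/hasP; exists i => //; move: mi; case: eqP => [li|_]; last by rewrite addn0.
  by rewrite li iT in lT.
apply/orP; right; move: Eml; rewrite negbK => /hasP[g ggs gm].
have [i [j gE]] := quad g ggs.
have gnm : ~~ (g <= m)%MM.
  by apply: contraL Em => gm'; rewrite negbK; apply/hasP; exists g.
have key u v : g = (U_(u) + U_(v))%MM -> v = l -> has (fun i => 0 < m i)%N (annvars l).
  move=> guv vl; apply/hasP; exists u.
    rewrite mem_filter mem_enum andbT negbK; apply/hasP; exists g => //.
    by rewrite guv vl lepm_refl.
  move/mnm_lepP/(_ u): gm; rewrite guv vl !mnmDE !mnm1E eqxx; lia.
have [jl|jl] := eqVneq j l; first exact: (key i j).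
have [il|il] := eqVneq i l; first by apply: (key j i) => //; rewrite gE addmC.
case/negP: gnm; apply/mnm_lepP => u; move/mnm_lepP/(_ u): gm.
rewrite gE !mnmDE !mnm1E; have [lu|] := eqVneq l u; last by rewrite addn0.
by rewrite -lu (negPf jl) (negPf il).
Qed.

Lemma var_ideal_colonV T l v :
  var_ideal (T ++ annvars l) v -> var_ideal T (v * phi 'X_l).
Proof.
move=> Jv m; rewrite mcf_mulX; case: ifP => [/andP[Em lm]|_]; last by rewrite eqxx.
move=> /Jv; rewrite has_cat => /orP[]/hasP[i iT mi]; apply/hasP.
  by exists i => //; move: mi; rewrite mnmBE => /leq_trans; apply; apply: leq_subr.
move: iT; rewrite mem_filter => /andP[+ _]; rewrite negbK => /hasP[g ggs gi].
case/negP: Em; apply/hasP; exists g => //; apply: lepm_trans gi _.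
rewrite -(submK lm); apply/mnm_lepP => u; rewrite !mnmDE leq_add2r mnm1E.
by case: eqP => // <-.
Qed.

(** A homogeneous row over the ideal of [l :: T] splits homogeneously: replace the
    two summands by their components of the right degree. *)
Lemma var_ideal_cons_homog p (sh : 'I_p -> nat) j l T (u : 'rV[A]_p) :
  rcomp sh j u = u -> (forall b, var_ideal (l :: T) (u 0 b)) ->
  exists y w, [/\ u = phi 'X_l *: y + w, forall b, var_ideal T (w 0 b) &
    if j is j'.+1 then rcomp sh j' y = y else y = 0].
Proof.
move=> uj uT.
have [Y YP] := row_fun_choice (fun b => var_ideal_cons (uT b)).
have [W WP] := row_fun_choice YP.
pose y0 := \row_b Y b; pose w0 := \row_b W b.
have u0 : u = phi 'X_l *: y0 + w0.
  by apply/rowP => b; rewrite !mxE; have [-> _] := WP b; rewrite mulrC.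
exists (if j is j'.+1 then rcomp sh j' y0 else 0), (rcomp sh j w0); split.
- rewrite -{1}uj u0 raddfD /=; congr (_ + _); apply/rowP => b.
  case: j {uj} => [|j]; rewrite !mxE.
    rewrite mulr0; case: ifP => // _; rewrite mulrC.
    by apply: hcomp_mulX_small; rewrite mdeg1.
  rewrite mulrC; have [bj|jb] := leqP (sh b) j.
    by rewrite (leqW bj) subSn // -add1n -(mdeg1 l) hcomp_mulX mulrC.
  rewrite mulr0; case: ifP => // bj; apply: hcomp_mulX_small.
  by rewrite mdeg1 ltnS leq_subLR addn0.
- move=> b; rewrite !mxE; case: ifP => _; last exact: var_ideal0.
  by apply: var_ideal_hcomp; have [] := WP b.
- by case: j {uj} => // j; rewrite rcomp_idem.
Qed.

Section KoszulChase.
Variable F : graded_resolution Acomp (@residue_comp k A eps).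

Lemma fr_aug_residue (x : 'rV[A]_(fr_rank F 0)) :
  fr_aug F x = \sum_a eps (x 0 a) * (fr_aug F (delta_mx 0 a) : k) :> k.
Proof.
rewrite {1}(row_sum_delta x) linear_sum; apply: eq_bigr => a _.
by rewrite linearZ.
Qed.

Lemma fr_aug_homog0 j x : j != 0%N -> rcomp (fr_shift (g:=F) (i:=0)) j x = x ->
  fr_aug F x = 0.
Proof.
move=> j0 xj; rewrite fr_aug_residue big1 // => a _.
have [a0|->] := fr_aug_homog (g:=F) a; last by rewrite mulr0.
rewrite -xj mxE a0 leq0n subn0 (comp_eps0 (hcompP _ _)) ?mul0r //.
by rewrite lt0n.
Qed.

Lemma fr_homog i : mx_homog (fr_shift (g:=F) (i:=i.+1)) (fr_shift (g:=F) (i:=i))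
  (fr_diff F i).
Proof. exact: fr_diff_homog. Qed.

(** Cycles of the complex obtained by reducing [F] modulo the variables in [T]. *)
Definition cycle_mod T i : 'rV[A]_(fr_rank F i) -> Prop :=
  match i with
  | 0 => fun=> True
  | h.+1 => fun x => forall b, var_ideal T ((x *m fr_diff F h) 0 b)
  end.

(** The complex [F] modulo the variables in [T] computes [Tor(k, A / (T))]; the
    statement says that it is concentrated on the diagonal. The proof is the
    Koszul filtration argument, an induction on [i] and then on [T], carried out
    on elements so that it applies to an arbitrary resolution [F] of [k]: adding
    a variable [l] to [T] gives the exact sequence of [A / (T : l)], shifted by
    one, [A / (T)] and [A / (l :: T)]. A cycle [x] modulo [l :: T] has boundary
    [l y + w]; then [y] is a cycle modulo [T : l] in homological degree [i - 1]
    and internal degree [j - 1], hence a boundary by induction, and correcting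
    [x] by [l z] yields a cycle modulo [T]. *)
Lemma koszul_chase : quadratic_gens -> forall i T j (x : 'rV[A]_(fr_rank F i)),
  i != j -> rcomp (fr_shift (g:=F) (i:=i)) j x = x -> cycle_mod T x ->
  exists y z, x = y + z *m fr_diff F i /\ forall b, var_ideal T (y 0 b).
Proof.
move=> quad; elim=> [|i IHi] T j x ij xj.
  move=> _; have /fr_exact0[z ->] : fr_aug F x = 0.
    by apply: (fr_aug_homog0 _ xj); rewrite eq_sym.
  exists 0, z; rewrite add0r; split=> // b; rewrite mxE; exact: var_ideal0.
elim: T x xj => [|l T IHT] x xj xT.
  have /fr_exactS[z ->] : x *m fr_diff F i = 0.
    by apply/rowP => b; rewrite [RHS]mxE; apply/var_ideal_nil/xT.
  by exists 0, z; rewrite add0r; split=> // b; rewrite mxE; apply: var_ideal0.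
have [lT|lT] := boolP (l \in T).
  have [|y [z [-> yT]]] := IHT _ xj.
    by move=> b m /xT /= /orP[ml|//]; apply/hasP; exists l.
  by exists y, z; split=> // b m /yT /= ->; apply: orbT.
have xdj : rcomp (fr_shift (g:=F) (i:=i)) j (x *m fr_diff F i) = x *m fr_diff F i.
  by rewrite (rcomp_mul _ _ (@fr_homog i)) xj.
have [y [w [xd wT yj]]] := var_ideal_cons_homog xdj xT.
have [y' [z [yE y'T]]] : exists y' z, y = y' + z *m fr_diff F i /\
    forall b, var_ideal (T ++ annvars l) (y' 0 b).
  case: j ij yj {xj IHT xdj} => [_ ->|j ij yj].
    exists 0, 0; rewrite mul0mx addr0; split=> // b; rewrite mxE; exact: var_ideal0.
  apply: IHi yj _ => //.
  case: i x y w xd {ij xT} wT => [//|i] x y w xd wT b.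
  apply: var_ideal_colon => //.
  have : (x *m fr_diff F i.+1 *m fr_diff F i) 0 b = 0.
    by rewrite -mulmxA fr_diff_comp mulmx0 mxE.
  rewrite xd mulmxDl -scalemxAl !mxE mulrC => /eqP; rewrite addr_eq0 => /eqP ->.
  move=> m; rewrite raddfN oppr_eq0; move: m; apply: var_ideal_sum => c.
  exact/var_idealM.
pose v := phi 'X_l *: z; pose u := x - v.
have uT b : var_ideal T ((u *m fr_diff F i) 0 b).
  rewrite mulmxBl xd yE -scalemxAl scalerDr addrAC addrK !mxE mulrC.
  by apply: var_idealD => //; apply: var_ideal_colonV.
have [|y2 [z2 [xE y2T]]] := IHT (rcomp (fr_shift (g:=F) (i:=i.+1)) j u)
    (rcomp_idem _ _ _).
  move=> b; rewrite -(rcomp_mul _ _ (@fr_homog i)) mxE.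
  by case: ifP => _; [apply: var_ideal_hcomp|apply: var_ideal0].
exists (rcomp (fr_shift (g:=F) (i:=i.+1)) j v + y2), z2; split.
  by rewrite -addrA -xE -raddfD /= (addrC v) subrK xj.
move=> b; rewrite mxE; apply: var_idealD; last first.
  by move=> m /y2T /= ->; apply: orbT.
rewrite !mxE; case: ifP => _; last exact: var_ideal0.
by apply/var_ideal_hcomp; rewrite mulrC; apply: var_idealX; rewrite mem_head.
Qed.

(** Over [k] this is [koszul_chase] for the set of all variables, applied to the
    constant lift of a cycle with coordinates in [k]. *)
Lemma graded_tor_dim_quadratic i j : quadratic_gens -> i != j ->
  graded_tor_dim eps F i j = 0%N.
Proof.
move=> quad ij; apply/eqP; rewrite subn_eq0; apply: mxrankS.
rewrite sub_capmx capmxSr andbT; apply/row_subP => r.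
have := row_sub r (tor_cycles eps F i :&: tor_degree k F i j)%MS.
rewrite sub_capmx; move: (row r _) => v /andP[vZ /submxP[c vc]].
pose x : 'rV[A]_(fr_rank F i) := \row_a phi (v 0 a)%:MP.
have vE a : v 0 a = c 0 a * (fr_shift (g:=F) (i:=i) a == j)%:R.
  rewrite vc !mxE (bigD1 a) //= big1 ?addr0 => [|b ba].
    by rewrite !mxE eqxx mulr1n.
  by rewrite !mxE (negPf ba) mulr0n mulr0.
have xj : rcomp (fr_shift (g:=F) (i:=i)) j x = x.
  apply/rowP => a; rewrite !mxE vE; case: (eqVneq (fr_shift a) j) => [->|_].
    by rewrite leqnn subnn mulr1 (hcomp_id (compC _)).
  by rewrite mulr0 !rmorph0; case: ifP => // _; rewrite raddf0.
have epsx : map_mx eps x = v by apply/rowP => a; rewrite !mxE epsC.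
have [|y [z [xE yT]]] := koszul_chase quad (T := enum 'I_n) ij xj.
  case: i v vZ x epsx {ij r c vc vE xj} => // i v vZ x epsx b.
  apply: var_ideal_all; have /sub_kermxP/rowP/(_ b) := vZ.
  by rewrite -epsx -map_mxM !mxE.
rewrite -epsx xE map_mxD map_mxM.
have -> : map_mx eps y = 0.
  apply/rowP => a; rewrite !mxE; rewrite eps_cf; apply/eqP; apply: contraT => /yT.
  by move=> /hasP[b _]; rewrite mnm0E.
by rewrite add0r; apply: submxMl.
Qed.

End KoszulChase.

Lemma koszul_quadratic : quadratic_gens -> koszul eps Acomp.
Proof.
move=> quad i j ij; rewrite /graded_betti; case: xgetP => // b _ [F ->].
exact: graded_tor_dim_quadratic.
Qed.
(** * Nonlinear relations obstruct the Koszul property *)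

Definition var_col : 'M[A]_(n, 1) := \col_i phi 'X_i.

Definition mono_row (a : A) (i : 'I_n) : 'rV[A]_n := a *: delta_mx 0 i.

Lemma mono_row_col a i : mono_row a i *m var_col = (a * phi 'X_i)%:M.
Proof.
rewrite -scalemxAl; apply/rowP => b; rewrite !mxE ord1 (bigD1 i) //= big1.
  by rewrite !mxE !eqxx mul1r addr0 mulr1n.
by move=> j ji; rewrite !mxE eqxx (negPf ji) mul0r.
Qed.

Lemma eps_var i : eps (phi 'X_i) = 0.
Proof. by apply: comp_eps0 (compX U_(i)) _; rewrite mdeg1. Qed.

Lemma var_ideal_combination T a : var_ideal T a ->
  exists b : 'I_n -> A, a = \sum_j b j * phi 'X_j.
Proof.
elim: T a => [|l T IHT] a.
  by move=> /var_ideal_nil ->; exists (fun=> 0); rewrite big1 // => j _; rewrite mul0r.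
move=> /var_ideal_cons[b [c [-> /IHT[d ->]]]].
exists (fun j => (if j == l then b else 0) + d j).
under [RHS]eq_bigr do rewrite mulrDl.
rewrite big_split /=; congr (_ + _); rewrite (bigD1 l) //= eqxx big1 ?addr0 //.
by move=> j /negPf ->; rewrite mul0r.
Qed.

Lemma eps0_combination a : eps a = 0 -> exists b : 'I_n -> A, a = \sum_j b j * phi 'X_j.
Proof. by move/var_ideal_all/var_ideal_combination. Qed.

(** The multigraded piece of degree [g] of a syzygy, summed over the variables;
    it is a well defined function on syzygies modulo the maximal ideal when all
    the proper divisors of [g] are standard. *)
Definition syz_coef (g : 'X_{1..n}) (v : 'rV[A]_n) : k :=
  \sum_(i | (U_(i) <= g)%MM) mcf (g - U_(i))%MM (v 0 i).

Lemma syz_coef_is_zmod_morphism g : zmod_morphism (syz_coef g).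
Proof.
by move=> v w; rewrite -sumrB; apply: eq_bigr => i _; rewrite !mxE raddfB.
Qed.

HB.instance Definition _ g := GRing.isZmodMorphism.Build 'rV[A]_n k (syz_coef g)
  (syz_coef_is_zmod_morphism g).

Lemma syz_coef_scale g c v : syz_coef g (phi c%:MP *: v) = c * syz_coef g v.
Proof. by rewrite mulr_sumr; apply: eq_bigr => i _; rewrite mxE mcf_scale. Qed.

Definition minimal_nonstandard (g : 'X_{1..n}) :=
  forall i, (U_(i) <= g)%MM -> standard gs (g - U_(i))%MM.

Lemma mcf_row_col h (v : 'rV[A]_n) : standard gs h ->
  mcf h ((v *m var_col) 0 0) = \sum_(i | (U_(i) <= h)%MM) mcf (h - U_(i))%MM (v 0 i).
Proof.
move=> Eh; rewrite mxE raddf_sum [RHS]big_mkcond; apply: eq_bigr => i _ /=.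
by rewrite mxE mcf_mulX Eh.
Qed.

(** For a syzygy [v] multiplied by the variable [j], the sum collects the
    coefficients of [v *m var_col] at [g - U_(j)], which is a standard monomial:
    the sum vanishes because [v] is a syzygy. *)
Lemma syz_coef_mulX g j (v : 'rV[A]_n) : minimal_nonstandard g ->
  v *m var_col = 0 -> syz_coef g (phi 'X_j *: v) = 0.
Proof.
move=> gmin v0; have [jg|jg] := boolP (U_(j) <= g)%MM; last first.
  rewrite /syz_coef big1 // => i ig; rewrite mxE mulrC mcf_mulX; case: ifP => //.
  case/andP=> _ /lepm_trans/(_ (lem_subr _ _)); by rewrite (negPf jg).
have := mcf_row_col v (gmin j jg); rewrite v0 mxE raddf0 => ->.
rewrite /syz_coef big_mkcond [RHS]big_mkcond; apply: eq_bigr => i _.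
rewrite mxE mulrC mcf_mulX.
have iff1 : (U_(i) <= g)%MM && (U_(j) <= g - U_(i))%MM = (U_(i) <= g - U_(j))%MM.
  move: jg; rewrite !lep1mP !mnmBE !mnm1E (eq_sym j i).
  by case: (eqVneq i j) => [->|ij]; rewrite ?eqxx /=; lia.
case: (boolP (U_(i) <= g)%MM) iff1 => [ig|ig] /= <- //.
by rewrite (gmin i ig) andTb !submDA (addmC U_(j)%MM).
Qed.

Lemma syz_coef_eps0 g a (v : 'rV[A]_n) : minimal_nonstandard g ->
  v *m var_col = 0 -> eps a = 0 -> syz_coef g (a *: v) = 0.
Proof.
move=> gmin v0 /eps0_combination[b ->]; rewrite scaler_suml raddf_sum big1 //= => j _.
by rewrite mulrC -scalerA syz_coef_mulX // -scalemxAl v0 scaler0.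
Qed.

Lemma syz_coef_mul g a (v : 'rV[A]_n) : minimal_nonstandard g ->
  v *m var_col = 0 -> syz_coef g (a *: v) = eps a * syz_coef g v.
Proof.
move=> gmin v0; apply/eqP; rewrite -subr_eq0 -syz_coef_scale -raddfB -scalerBl /=.
by rewrite syz_coef_eps0 // rmorphB epsC subrr.
Qed.

Lemma syz_coef_mono g a i : (U_(i) <= g)%MM ->
  syz_coef g (mono_row a i) = mcf (g - U_(i))%MM a.
Proof.
move=> ig; rewrite /syz_coef (bigD1 i) //= !mxE !eqxx mulr1 big1 ?addr0 //.
by move=> j /andP[_ ji]; rewrite !mxE eqxx (negPf ji) mulr0 raddf0.
Qed.

Lemma mono_row_scale b a i : b *: mono_row a i = mono_row (b * a) i.
Proof. by rewrite /mono_row scalerA. Qed.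

Definition res_aug (x : 'rV[A]_1) : residue_field eps := eps (x 0 0).

Lemma res_aug_is_linear : linear res_aug.
Proof. by move=> a x y; rewrite /res_aug !mxE rmorphD rmorphM. Qed.

HB.instance Definition _ := GRing.isLinear.Build A 'rV[A]_1 (residue_field eps)
  _ res_aug res_aug_is_linear.

Lemma res_aug_surj y : exists x, res_aug x = y.
Proof. by exists (phi (y : k)%:MP)%:M; rewrite /res_aug mxE mulr1n epsC. Qed.

Lemma res_aug_ex0 x : res_aug x = 0 <-> exists y, x = y *m var_col.
Proof.
split=> [/eps0_combination[b xb]|[y ->]].
  exists (\row_j b j); apply/rowP => i; rewrite ord1 xb mxE.
  by apply: eq_bigr => j _; rewrite !mxE.
rewrite /res_aug mxE rmorph_sum big1 // => j _.
by rewrite rmorphM mxE eps_var mulr0.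
Qed.

(** [A^r -> A^n -> A], with cokernel the residue field, as an infinite complex *)
Definition start_rank (r i : nat) : nat :=
  match i with 0 => 1 | 1 => n | 2 => r | _ => 0 end.

Definition start_diff r (D : 'M[A]_(r, n)) i :
    'M[A]_(start_rank r i.+1, start_rank r i) :=
  match i return 'M[A]_(start_rank r i.+1, start_rank r i) with
  | 0 => var_col | 1 => D | _ => 0 end.

Section NotKoszul.
Variable F : graded_resolution Acomp (@residue_comp k A eps).

Lemma rcomp_scaleX p (sh : 'I_p -> nat) j u (x : 'rV[A]_p) :
  rcomp sh (mdeg u + j) (phi 'X_[u] *: x) = phi 'X_[u] *: rcomp sh j x.
Proof.
apply/rowP => a; rewrite !mxE mulrC; have [aj|ja] := leqP (sh a) j.
  by rewrite (leq_trans aj (leq_addl _ _)) -addnBA // hcomp_mulX mulrC.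
rewrite mulr0; case: ifP => // aj; apply: hcomp_mulX_small; lia.
Qed.

(** If [Tor] vanishes in this bidegree, a homogeneous chain whose boundary vanishes
    over [k] is a boundary modulo the maximal ideal: its reduction is a row of the
    space of boundaries, and coordinates in [k] lift to [A]. *)
Lemma graded_tor_dim_cycle i j (x : 'rV[A]_(fr_rank F i.+1)) :
  graded_tor_dim eps F i.+1 j = 0%N ->
  rcomp (fr_shift (g:=F) (i:=i.+1)) j x = x ->
  map_mx eps (x *m fr_diff F i) = 0 ->
  exists t, map_mx eps (x - t *m fr_diff F i.+1) = 0.
Proof.
move=> /eqP; rewrite subn_eq0 => tor0 xj xd.
set Z := tor_cycles eps F i.+1 in tor0; set B := tor_boundaries eps F i.+1 in tor0.
set T := tor_degree k F i.+1 j in tor0.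
have BZ : (B <= Z)%MS.
  by apply/sub_kermxP; rewrite -map_mxM fr_diff_comp map_mx0.
have xZ : (map_mx eps x <= Z)%MS by apply/sub_kermxP; rewrite -map_mxM.
have xT : (map_mx eps x <= T)%MS.
  apply/submxP; exists (map_mx eps x); apply/rowP => a.
  rewrite !mxE (bigD1 a) //= big1 ?addr0 => [|b ba]; last first.
    by rewrite !mxE (negPf ba) mulr0n mulr0.
  rewrite !mxE eqxx mulr1n; case: (eqVneq (fr_shift a) j) => [_|aj].
    by rewrite mulr1.
  rewrite mulr0 -xj mxE; case: ifP => [aj'|_]; last exact: rmorph0.
  apply: comp_eps0 (hcompP _ _) _; lia.
have BT : (B :&: T <= Z :&: T)%MS.
  by rewrite sub_capmx capmxSr (submx_trans (capmxSl _ _) BZ).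
have ZB : (Z :&: T <= B :&: T)%MS.
  by rewrite -(geq_leqif (mxrank_leqif_sup BT)).
have /submxP[c xc] : (map_mx eps x <= B)%MS.
  by apply: submx_trans (capmxSl _ T); apply: submx_trans ZB; rewrite sub_capmx xZ.
exists (map_mx (fun c => phi c%:MP) c).
rewrite map_mxB map_mxM xc; apply/eqP; rewrite subr_eq0; apply/eqP.
by congr (_ *m _); apply/rowP => a; rewrite !mxE epsC.
Qed.

(** Write [g] as [m] times a variable [i]. If [e0] generates [k] and [z] is a
    preimage of [X_i e0] in [F_1], then [X^m z] is a cycle, because [X^g] is zero
    in [A]; it is the boundary of some [u] of internal degree [mdeg g]. Vanishing
    of [Tor_2] in this degree would make [X^m z] a combination, with coefficients
    in the maximal ideal, of boundaries. Transported to the presentation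
    [A^n -> A -> k] by a comparison map, such a combination is killed by
    [syz_coef g], while [X^m z] becomes [X^m] on the [i]-th coordinate, up to a
    multiple of a syzygy, where [syz_coef g] takes the value 1. *)
Theorem graded_tor_dim_minimal_nonstandard g : ~~ standard gs g ->
  minimal_nonstandard g -> (2 < mdeg g)%N -> graded_tor_dim eps F 2 (mdeg g) <> 0%N.
Proof.
move=> Eg gmin g2 tor0.
have [e0 [e0j e01]] : exists e0, rcomp (fr_shift (g:=F) (i:=0)) 0 e0 = e0 /\
    fr_aug F e0 = (1 : k).
  have [e e1] := fr_aug_surj F (1 : k).
  exists (rcomp (fr_shift (g:=F) (i:=0)) 0 e); split; first exact: rcomp_idem.
  have [M eM] := rcomp_sum (fr_shift (g:=F) (i:=0)) e.
  case: M eM => [|M] eM.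
    by move: e1 => /eqP; rewrite eM big_ord0 raddf0 eq_sym oner_eq0.
  rewrite -e1 [in RHS]eM big_ord_recl raddfD raddf_sum [X in _ = _ + X]big1 ?addr0 //.
  by move=> j _; apply: (fr_aug_homog0 (j := lift ord0 j)) => //; apply: rcomp_idem.
have [i ig] : exists i, (U_(i) <= g)%MM.
  have : mdeg g != 0%N by lia.
  rewrite mdegE sum_nat_eq0 negb_forall => /existsP[i /= gi].
  by exists i; rewrite lep1mP.
pose m := (g - U_(i))%MM.
have mg : (m + U_(i) = g)%MM by rewrite /m submK.
have mdg : (mdeg m + 1 = mdeg g)%N by rewrite -mg mdegD mdeg1.
have [z [zj zd]] : exists z, rcomp (fr_shift (g:=F) (i:=1)) 1 z = z /\
    phi 'X_i *: e0 = z *m fr_diff F 0.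
  have /fr_exact0[y yd] : fr_aug F (phi 'X_i *: e0) = 0.
    by rewrite linearZ /= e01 /GRing.scale /= /restr_scale eps_var mul0r.
  exists (rcomp (fr_shift (g:=F) (i:=1)) 1 y); split; first exact: rcomp_idem.
  rewrite -(rcomp_mul _ _ (@fr_homog F 0)) -yd.
  by have := rcomp_scaleX (fr_shift (g:=F) (i:=0)) 0 U_(i) e0; rewrite mdeg1 addn0 e0j.
pose w := phi 'X_[m] *: z.
have [u [uj ud]] : exists u, rcomp (fr_shift (g:=F) (i:=2)) (mdeg g) u = u /\
    w = u *m fr_diff F 1.
  have /fr_exactS[y yd] : w *m fr_diff F 0 = 0.
    rewrite -scalemxAl -zd scalerA -rmorphM -mpolyXD mg.
    suff -> : phi 'X_[g] = 0 by rewrite scale0r.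
    apply/(mpres_ker pres) => h Eh; rewrite mcoeffX; case: eqP => // gh.
    by rewrite gh Eh in Eg.
  exists (rcomp (fr_shift (g:=F) (i:=2)) (mdeg g) y); split; first exact: rcomp_idem.
  by rewrite -(rcomp_mul _ _ (@fr_homog F 1)) -yd -mdg rcomp_scaleX zj.
have epsm : eps (phi 'X_[m]) = 0 by apply: comp_eps0 (compX m) _; lia.
have [t tu] : exists t, map_mx eps (u - t *m fr_diff F 2) = 0.
  apply: (graded_tor_dim_cycle tor0 uj).
  by rewrite -ud; apply/rowP => b; rewrite !mxE rmorphM epsm mul0r.
set r := u - _ in tu.
have rd : w = r *m fr_diff F 1.
  by rewrite mulmxBl -mulmxA fr_diff_comp mulmx0 subr0.
have [b bP] := row_fun_choice (fun a => eps0_combination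
  (ltac:(by have /rowP/(_ a) := tu; rewrite !mxE) : eps (r 0 a) = 0)).
have rE : r = \sum_j phi 'X_j *: \row_a b a j.
  apply/rowP => a; rewrite summxE bP; apply: eq_bigr => j _.
  by rewrite !mxE mulrC.
have Faug y : fr_aug F (y *m fr_diff F 0) = 0 by apply/fr_exact0; exists y.
have [f [f0 fd]] := comparison_map (e := start_diff (0 : 'M[A]_(0, n)))
  (N := 0) (fun x => proj1 (res_aug_ex0 x)) (fun i Hi => ltac:(by []))
  res_aug_surj Faug (fun i _ => fr_diff_comp F i).
pose c := (e0 *m f 0) 0 0.
have epsc : eps c = 1 by have := f0 e0; rewrite e01.
have syz_d y : y *m fr_diff F 0 = 0 -> (y *m f 1) *m var_col = 0.
  by move=> yd; rewrite -mulmxA -[f 1 *m _](fd 0) // mulmxA yd mul0mx.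
have w0 : syz_coef g (w *m f 1) = 0.
  rewrite rd rE !mulmx_suml raddf_sum big1 //= => j _.
  rewrite -!scalemxAl syz_coef_mulX // syz_d // -mulmxA fr_diff_comp.
  exact: mulmx0.
have : syz_coef g (w *m f 1) = 1.
  have rho : (z *m f 1 - mono_row c i) *m var_col = 0.
    rewrite mulmxBl -mulmxA -[f 1 *m _](fd 0) // mulmxA -zd -scalemxAl mono_row_col.
    apply/eqP; rewrite subr_eq0; apply/eqP/rowP => a.
    by rewrite !mxE ord1 eqxx mulr1n mulrC /c mxE.
  rewrite -scalemxAl -(subrK (mono_row c i) (z *m f 1)) scalerDr raddfD /=.
  rewrite syz_coef_eps0 // add0r mono_row_scale syz_coef_mono // mulrC mcf_mulX.
  rewrite gmin //= lepm_refl.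
  have -> : (g - U_(i) - m = 0)%MM by apply/mnmP => a; rewrite mnmBE mnm0E subnn.
  by rewrite -eps_cf.
by move/eqP; rewrite w0 eq_sym oner_eq0.
Qed.

End NotKoszul.

Lemma not_koszul_minimal_nonstandard g :
  inhabited (graded_resolution Acomp (@residue_comp k A eps)) ->
  ~~ standard gs g -> minimal_nonstandard g -> (2 < mdeg g)%N ->
  ~ koszul eps Acomp.
Proof.
move=> [F0] Eg gmin g2 /(_ 2 (mdeg g)); rewrite /graded_betti.
case: xgetP => [b _ [F ->]|/(_ _ (ex_intro _ F0 erefl)) //].
move=> tor0; apply: (graded_tor_dim_minimal_nonstandard (F := F) Eg gmin g2).
by apply: tor0; rewrite neq_ltn g2.
Qed.
(** * The second Betti number of the residue field *)

Definition incr_pairs : pred ('I_n * 'I_n) := fun p => (p.1 < p.2)%N.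

Definition koszul_row (p : 'I_n * 'I_n) : 'rV[A]_n :=
  mono_row (phi 'X_(p.2)) p.1 - mono_row (phi 'X_(p.1)) p.2.

(** A row whose product with the column of variables is [X^m]: the whole monomial
    is put on its first variable. For a relation [m] it is a syzygy. *)
Definition first_row (m : 'X_{1..n}) : 'rV[A]_n :=
  if [pick i | (U_(i) <= m)%MM] is Some i then mono_row (phi 'X_[m - U_(i)]) i
  else 0.

Definition syz_mx : 'M[A]_(#|incr_pairs| + size gs, n) :=
  col_mx (\matrix_a koszul_row (enum_val a))
         (\matrix_b first_row (tnth (in_tuple gs) b)).

Definition in_syz (v : 'rV[A]_n) := exists y, v = y *m syz_mx.

Lemma in_syz0 : in_syz 0.
Proof. by exists 0; rewrite mul0mx. Qed.

Lemma in_syzD v w : in_syz v -> in_syz w -> in_syz (v + w).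
Proof. by move=> [y ->] [z ->]; exists (y + z); rewrite mulmxDl. Qed.

Lemma in_syzZ a v : in_syz v -> in_syz (a *: v).
Proof. by move=> [y ->]; exists (a *: y); rewrite scalemxAl. Qed.

Lemma in_syzN v : in_syz v -> in_syz (- v).
Proof. by rewrite -scaleN1r; apply: in_syzZ. Qed.

Lemma in_syz_sum (I : Type) (r : seq I) (f : I -> 'rV[A]_n) :
  (forall i, in_syz (f i)) -> in_syz (\sum_(i <- r) f i).
Proof. by move=> H; elim/big_ind: _ => //; [apply: in_syz0|apply: in_syzD]. Qed.

Lemma in_syz_row i : in_syz (row i syz_mx).
Proof. by exists (delta_mx 0 i); rewrite -rowE. Qed.

Lemma in_syz_koszul i j :
  in_syz (mono_row (phi 'X_j) i - mono_row (phi 'X_i) j).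
Proof.
wlog ij : i j / (i < j)%N => [H|].
  have [/H //|/H|/val_inj ->] := ltngtP i j; last first.
    by rewrite subrr; apply: in_syz0.
  by move/in_syzN; rewrite opprB.
have := in_syz_row (lshift _ (enum_rank_in (ij : (i, j) \in incr_pairs) (i, j))).
by rewrite /syz_mx rowKu rowK enum_rankK_in.
Qed.

Lemma in_syz_gen g : g \in gs -> in_syz (first_row g).
Proof.
move=> ggs; have gi : (index g gs < size gs)%N by rewrite index_mem.
have := in_syz_row (rshift #|incr_pairs| (Ordinal gi)).
by rewrite /syz_mx rowKd rowK (tnth_nth 0%MM) /= nth_index.
Qed.

(** Modulo the Koszul syzygies, a monomial can be moved from one coordinate to
    another; so only its product with the corresponding variable matters. *)
Lemma in_syz_mono m i : in_syz (mono_row (phi 'X_[m]) i - first_row (m + U_(i))%MM).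
Proof.
rewrite /first_row; case: pickP => [j jm|/(_ i)]; last by rewrite lem_addl.
have [->|ji] := eqVneq j i; first by rewrite addmK subrr; apply: in_syz0.
have jm' : (U_(j) <= m)%MM.
  by move: jm; rewrite !lep1mP mnmDE mnm1E (eq_sym i j) (negPf ji) addn0.
have := in_syzZ (phi 'X_[m - U_(j)]) (in_syz_koszul i j).
rewrite scalerBr !mono_row_scale -!rmorphM -!mpolyXD submK //.
suff -> : (m - U_(j) + U_(i) = m + U_(i) - U_(j))%MM by [].
by apply/mnmP => a; move/mnm_lepP/(_ a): jm'; rewrite !mnmE; lia.
Qed.

(** When that product is nonstandard it is a multiple of a relation [g], and the
    monomial is a multiple of [first_row g] modulo Koszul syzygies. *)
Lemma in_syz_nonstandard m i : (forall g, g \in gs -> (0 < mdeg g)%N) ->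
  ~~ standard gs (m + U_(i))%MM -> in_syz (mono_row (phi 'X_[m]) i).
Proof.
move=> gs0; rewrite negbK => /hasP[g ggs gm].
suff H : in_syz (first_row (m + U_(i))%MM).
  by have := in_syzD (in_syz_mono m i) H; rewrite subrK.
have [j jg] : exists j, (U_(j) <= g)%MM.
  have := gs0 g ggs; rewrite lt0n mdegE sum_nat_eq0 negb_forall.
  by move=> /existsP[j /= gj]; exists j; rewrite lep1mP.
set t := (m + U_(i))%MM in gm *.
have jt := lepm_trans jg gm.
have tj : (t - g + (g - U_(j)) + U_(j) = t)%MM by rewrite -addmA !submK.
have Sj : in_syz (phi 'X_[t - g] *: mono_row (phi 'X_[g - U_(j)]) j).
  apply: in_syzZ; rewrite -(subrK (first_row g) (mono_row _ _)).
  by apply: in_syzD (in_syz_gen ggs); rewrite -{2}(submK jg); apply: in_syz_mono.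
rewrite mono_row_scale -rmorphM -mpolyXD in Sj.
have := in_syz_mono (t - g + (g - U_(j)))%MM j; rewrite tj => /in_syzN.
by move/in_syzD/(_ Sj); rewrite opprB subrK.
Qed.

Lemma mcf_expand_bounded N a : (forall m, (N <= mdeg m)%N -> mcf m a = 0) ->
  a = \sum_(m : 'X_{1..n < N}) phi (mcf m a)%:MP * phi 'X_[m].
Proof.
move=> aN; apply: mcf_ext => m Em; rewrite raddf_sum /=.
under eq_bigr do rewrite mcf_scale mcf_phi Em mcoeffX.
have [mN|mN] := ltnP (mdeg m) N; last first.
  rewrite aN // big1 // => u _; case: eqP => [um|_]; last by rewrite mulr0.
  by have := bmdeg u; rewrite um ltnNge mN.
rewrite (bigD1 (BMultinom mN)) //= eqxx mulr1 big1 ?addr0 // => u um.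
by move: um; rewrite bmeqP eq_sym /= => /negPf; rewrite eq_sym => ->; rewrite mulr0.
Qed.

(** Linear extension of [first_row], truncated at degree [N] to remain a finite sum *)
Definition first_rows N (a : A) : 'rV[A]_n :=
  \sum_(m : 'X_{1..n < N}) phi (mcf m a)%:MP *: first_row m.

Lemma first_rows_is_zmod_morphism N : zmod_morphism (first_rows N).
Proof.
move=> a b; rewrite -sumrB; apply: eq_bigr => m _.
by rewrite raddfB /= !rmorphB scalerBl.
Qed.

HB.instance Definition _ N := GRing.isZmodMorphism.Build A 'rV[A]_n
  (first_rows N) (first_rows_is_zmod_morphism N).

Lemma first_rows_scale N c a :
  first_rows N (phi c%:MP * a) = phi c%:MP *: first_rows N a.
Proof.
rewrite scaler_sumr; apply: eq_bigr => m _.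
by rewrite mcf_scale scalerA -rmorphM -mpolyCM.
Qed.

Lemma in_syz_mono_rows N m i : (forall g, g \in gs -> (0 < mdeg g)%N) ->
  (mdeg m < N)%N ->
  in_syz (mono_row (phi 'X_[m]) i - first_rows N.+1 (phi 'X_[m] * phi 'X_i)).
Proof.
move=> gs0 mN; rewrite -rmorphM -mpolyXD /first_rows.
have [Em|Em] := boolP (standard gs (m + U_(i))%MM); last first.
  rewrite big1 ?subr0 => [|u _]; first exact: in_syz_nonstandard.
  rewrite mcf_phi mcoeffX; case: eqP => [<-|_]; first by rewrite (negPf Em) !rmorph0 scale0r.
  by rewrite if_same !rmorph0 scale0r.
have miN : (mdeg (m + U_(i))%MM < N.+1)%N by rewrite mdegD mdeg1 addn1.
rewrite (bigD1 (BMultinom miN)) //= mcf_phi Em mcoeffX eqxx !rmorph1 scale1r.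
rewrite big1 ?addr0 => [|u um]; first exact: in_syz_mono.
rewrite mcf_phi mcoeffX; move: um; rewrite bmeqP /= eq_sym => /negPf ->.
by rewrite if_same !rmorph0 scale0r.
Qed.

(** [in_syz_mono_rows] extends by linearity: every row [v] is congruent to
    [first_rows (v *m var_col)] modulo the rows of [syz_mx], and this is zero when
    [v] is a syzygy. *)
Lemma syz_mx_exact (v : 'rV[A]_n) : (forall g, g \in gs -> (0 < mdeg g)%N) ->
  v *m var_col = 0 -> in_syz v.
Proof.
move=> gs0 v0; pose B i := sval (cid (mcf_bounded (v 0 i))).
pose N := \max_i B i.
have vN i m : (N <= mdeg m)%N -> mcf m (v 0 i) = 0.
  move=> Nm; apply: (svalP (cid (mcf_bounded (v 0 i)))).
  exact: leq_trans (leq_bigmax (F := B) i) Nm.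
have vE : v = \sum_i mono_row (v 0 i) i by exact: row_sum_delta.
have v0E : first_rows N.+1 (\sum_i v 0 i * phi 'X_i) = 0.
  rewrite (_ : \sum_i _ = 0) ?raddf0 //.
  have /rowP/(_ 0) := v0; rewrite !mxE => e; rewrite -[RHS]e.
  by apply: eq_bigr => i _; rewrite mxE.
rewrite -[v]subr0 -v0E {1}vE (raddf_sum (first_rows N.+1)) -sumrB.
apply: in_syz_sum => i /=; set a := v 0 i.
have aE := mcf_expand_bounded (vN i : forall m, _ -> mcf m a = 0).
have -> : mono_row a i = \sum_(m : 'X_{1..n < N})
    phi (mcf m a)%:MP *: mono_row (phi 'X_[m]) i.
  rewrite {1}aE /mono_row scaler_suml.
  by apply: eq_bigr => m _; rewrite scalerA.
have -> : first_rows N.+1 (a * phi 'X_i) = \sum_(m : 'X_{1..n < N})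
    phi (mcf m a)%:MP *: first_rows N.+1 (phi 'X_[m] * phi 'X_i).
  rewrite {1}aE mulr_suml (raddf_sum (first_rows N.+1)).
  by apply: eq_bigr => m _ /=; rewrite -mulrA first_rows_scale.
rewrite -sumrB; apply: in_syz_sum => m; rewrite -scalerBr.
apply: in_syzZ; apply: in_syz_mono_rows => //; exact: bmdeg.
Qed.

Lemma koszul_row_col p : koszul_row p *m var_col = 0.
Proof. by rewrite mulmxBl !mono_row_col mulrC subrr. Qed.

Lemma first_row_col g : g \in gs -> first_row g *m var_col = 0.
Proof.
move=> ggs; rewrite /first_row; case: pickP => [i ig|_]; last exact: mul0mx.
rewrite mono_row_col -rmorphM -mpolyXD submK //.
suff -> : phi 'X_[g] = 0 by rewrite rmorph0.
apply/(mpres_ker pres) => h Eh; rewrite mcoeffX; case: eqP => // gh.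
by case/negP: Eh; rewrite -gh; apply/hasP; exists g; rewrite ?lepm_refl.
Qed.

Lemma syz_mx_col : syz_mx *m var_col = 0.
Proof.
apply/row_matrixP => r; rewrite row_mul row0; case: (split_ordP r) => a ->.
  by rewrite rowKu rowK koszul_row_col.
by rewrite rowKd rowK first_row_col // mem_tnth.
Qed.

Section Minimality.
Hypothesis gs_deg : forall g, g \in gs -> (1 < mdeg g)%N.
Hypothesis gs_min : forall g, g \in gs -> minimal_nonstandard g.
Hypothesis gs_uniq : uniq gs.

Lemma standard_var j : standard gs U_(j)%MM.
Proof.
apply/negP => /hasP[g ggs gj]; have := gs_deg ggs.
by rewrite -(ltn_add2r (mdeg (U_(j) - g))) addnC -mdegD addmC submK // mdeg1; lia.
Qed.

Lemma eps_syz_mx : map_mx eps syz_mx = 0.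
Proof.
apply/row_matrixP => r; rewrite row0 -map_row; case: (split_ordP r) => a ->.
  rewrite rowKu rowK; apply/rowP => b; rewrite !mxE rmorphB !rmorphM !eps_var.
  by rewrite !mul0r subrr.
rewrite rowKd rowK /first_row; case: pickP => [i ig|_]; last exact: map_mx0.
apply/rowP => b; rewrite !mxE rmorphM (comp_eps0 (compX _)) ?mul0r //.
have := gs_deg (mem_tnth a (in_tuple gs)); rewrite -{1}(submK ig) mdegD mdeg1; lia.
Qed.

Lemma syz_coef_koszul g p : syz_coef g (koszul_row p) = 0.
Proof.
rewrite raddfB /=; apply/eqP; rewrite subr_eq0; apply/eqP.
have H i j : syz_coef g (mono_row (phi 'X_j) i) =
    if (g == U_(i) + U_(j))%MM then 1 else 0.
  rewrite /syz_coef big_mkcond (bigD1 i) //= [X in _ + X]big1 ?addr0; last first.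
    by move=> u ui; rewrite !mxE (negPf ui) andbF mulr0 raddf0 if_same.
  rewrite !mxE !eqxx mulr1 mcf_phi mcoeffX.
  have [ig|ig] := boolP (U_(i) <= g)%MM; last first.
    by case: eqP => // gE; rewrite gE lem_addr in ig.
  rewrite -(eqm_add2r U_(i)) submK // eq_sym [in g == _]addmC.
  case: eqP => [gE|_]; last exact: if_same.
  by rewrite gE addmC addmK standard_var.
by rewrite !H addmC.
Qed.

Lemma syz_coef_first g h : g \in gs -> syz_coef g (first_row h) = (g == h)%:R.
Proof.
move=> ggs; rewrite /first_row; case: pickP => [i ih|h0]; last first.
  rewrite raddf0; case: eqP => // gh; have := gs_deg ggs.
  rewrite mdegE big1 // => i _; apply/eqP; have := h0 i.
  by rewrite gh lep1mP => /negbFE.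
have [ig|ig] := boolP (U_(i) <= g)%MM; last first.
  rewrite /syz_coef big1 => [|j jg]; last first.
    rewrite !mxE eqxx (_ : j == i = false) ?mulr0 ?raddf0 //.
    by apply: contraNF ig => /eqP <-.
  by case: eqP => // gh; rewrite gh ih in ig.
rewrite syz_coef_mono // mcf_phi (gs_min ggs) // mcoeffX eq_sym.
by rewrite -(eqm_add2r U_(i)) !submK.
Qed.

Lemma mcf_var_mul a b i : eps b = 0 -> mcf U_(i)%MM (a * b) = eps a * mcf U_(i)%MM b.
Proof.
move=> eb; have [c ->] := eps0_combination eb.
rewrite mulr_sumr !raddf_sum mulr_sumr; apply: eq_bigr => j _ /=.
rewrite mulrA !mcf_mulX standard_var /=; case: ifP => [ji|_]; last by rewrite mulr0.
have -> : (U_(i) - U_(j) = 0)%MM.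
  by apply/eqP; rewrite -mdeg_eq0 -(eqn_add2r (mdeg U_(j))) -mdegD submK // !mdeg1.
by rewrite -!eps_cf rmorphM.
Qed.

Lemma mcf_var_entry i j (l h : 'I_n) :
  mcf U_(i)%MM (mono_row (phi 'X_j) l 0 h) = ((i == j) && (h == l))%:R.
Proof.
rewrite !mxE eqxx /=; case: (h == l); last by rewrite mulr0 raddf0 andbF.
by rewrite mulr1 andbT mcf_phi standard_var mcoeffX eq_mnm1 eq_sym.
Qed.

(** Minimality is read off from linear forms: [syz_coef g] isolates the coefficient
    of [first_row g], as it kills the Koszul syzygies; the coefficient of the
    Koszul syzygy of [p] is then the linear coefficient in [X_(p.2)] of the
    coordinate [p.1]. *)
Lemma syz_mx_minimal (y : 'rV[A]_(#|incr_pairs| + size gs)) :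
  y *m syz_mx = 0 -> map_mx eps y = 0.
Proof.
move=> y0.
have yE : \sum_r y 0 r *: row r syz_mx = 0 by rewrite -mulmx_sum_row.
have row0 r : row r syz_mx *m var_col = 0 by rewrite -row_mul syz_mx_col row0.
have yg b : eps (y 0 (rshift _ b)) = 0.
  pose g := tnth (in_tuple gs) b; have ggs : g \in gs by exact: mem_tnth.
  have := congr1 (syz_coef g) yE; rewrite raddf0 raddf_sum => <-.
  rewrite (bigD1 (rshift _ b)) //= syz_coef_mul //; last exact: gs_min.
  rewrite rowKd rowK syz_coef_first // eqxx mulr1 big1 ?addr0 // => r rb.
  rewrite syz_coef_mul //; last exact: gs_min.
  case: (split_ordP r) rb => a -> ab.
    by rewrite rowKu rowK syz_coef_koszul mulr0.
  rewrite rowKd rowK syz_coef_first // -[_ == _]/(tnth _ b == tnth _ a).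
  rewrite !(tnth_nth 0%MM) nth_uniq //; case: eqP => [/val_inj ba|_]; last by rewrite mulr0.
  by rewrite ba eqxx in ab.
have yk a : eps (y 0 (lshift _ a)) = 0.
  have := enum_valP a; set p := enum_val a => pP.
  have := congr1 (fun v : 'rV[A]_n => mcf U_(p.2)%MM (v 0 p.1)) yE.
  rewrite summxE raddf_sum [X in _ = mcf _ X]mxE raddf0 => <-.
  have esyz r i : eps (syz_mx r i) = 0.
    by have /matrixP/(_ r i) := eps_syz_mx; rewrite !mxE.
  have kE q : q \in incr_pairs ->
      mcf U_(p.2)%MM (koszul_row q 0 p.1) = (p == q)%:R.
    move=> qP; rewrite [koszul_row q 0 p.1]mxE [X in _ + X]mxE.
    rewrite raddfB /= !mcf_var_entry.
    case: p q pP qP => [i1 j1] [i2 j2]; rewrite /in_mem /incr_pairs /= => ij1 ij2.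
    rewrite [(_, _) == _]xpair_eqE andbC [X in _ - X](_ : _ = 0) ?subr0 //.
    case: eqP => // ji; case: eqP => // ij.
    by move: ij1 ij2; rewrite ji ij => /ltnW; rewrite leqNgt => /negP.
  have synE c q : row c syz_mx = koszul_row q ->
      mcf U_(p.2)%MM (syz_mx c p.1) = mcf U_(p.2)%MM (koszul_row q 0 p.1).
    by move=> <-; rewrite [in RHS]mxE.
  have ent r : mcf U_(p.2)%MM ((y 0 r *: row r syz_mx) 0 p.1) =
      eps (y 0 r) * mcf U_(p.2)%MM (syz_mx r p.1).
    by rewrite mxE [X in _ * X]mxE mcf_var_mul ?esyz.
  rewrite (bigD1 (lshift _ a)) //= ent (synE _ p) ?rowKu ?rowK // kE // eqxx mulr1.
  rewrite big1 ?addr0 // => r ra; rewrite ent; case: (split_ordP r) ra => c ->; last first.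
    by rewrite yg mul0r.
  rewrite (inj_eq (@lshift_inj _ _)) => ca.
  rewrite (synE _ (enum_val c)) ?rowKu ?rowK // kE ?enum_valP //.
  by rewrite (inj_eq enum_val_inj) eq_sym (negPf ca) mulr0.
apply/rowP => r; rewrite !mxE; by case: (split_ordP r) => a ->.
Qed.

(** [A^r -> A^n -> A] with [syz_mx] on the left is the beginning of a minimal
    resolution of the residue field. *)
Theorem tor_dim2 (F : free_resolution (residue_field eps)) :
  tor_dim eps F 2 = (#|incr_pairs| + size gs)%N.
Proof.
have gs0 g : g \in gs -> (0 < mdeg g)%N by move=> /gs_deg /ltnW.
apply: (@tor_dim_minimal_start k A eps _ F (start_rank _) (start_diff syz_mx) res_aug 1).
- exact: res_aug_surj.
- exact: res_aug_ex0.
- case=> // _ x; split=> [|[y ->]]; first exact: syz_mx_exact.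
  by rewrite /= -mulmxA syz_mx_col mulmx0.
- exact: eps_syz_mx.
- exact: syz_mx_minimal.
Qed.

End Minimality.
(** * Existence of graded resolutions *)
Section Existence.
Variables (x0 : 'I_n) (D : nat).
Hypothesis x0_free : forall g : 'X_{1..n}, g \in gs -> g x0 = 0%N.
Hypothesis x0_bound : forall m, standard gs m -> m x0 = 0%N -> (mdeg m < D)%N.

Lemma standard_addx0 m : standard gs (m + U_(x0))%MM = standard gs m.
Proof.
apply/idP/idP; first by apply: standard_le; apply: lem_addr.
apply: contra => /hasP[g ggs gm]; apply/hasP; exists g => //.
apply/mnm_lepP => i; move/mnm_lepP/(_ i): gm; rewrite mnmDE mnm1E.
by case: eqP => [<-|_]; rewrite ?addn0 // x0_free.
Qed.

Lemma mulx0_inj a : a * phi 'X_x0 = 0 -> a = 0.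
Proof.
move=> a0; apply: mcf_ext => m Em; rewrite raddf0.
have := mcf_mulX (m + U_(x0))%MM U_(x0)%MM a.
by rewrite a0 raddf0 standard_addx0 Em lem_addl addmK.
Qed.

Lemma divx0 d a : Acomp d a -> (D <= d)%N -> exists b, a = b * phi 'X_x0.
Proof.
move=> /compP ad Dd; apply: mcf_dvdX => m ma; rewrite lep1mP.
apply/eqP => mx0; have := x0_bound (mcf_neq0_std ma) mx0.
by rewrite ad // ltnNge Dd.
Qed.

(** Take a matrix of largest rank whose row space is contained in the subspace. *)
Lemma subspace_span N (P : 'rV[k]_N -> Prop) : P 0 ->
  (forall c u v, P u -> P v -> P (c *: u + v)) ->
  exists W : 'M[k]_N, forall v, P v <-> (v <= W)%MS.
Proof.
move=> P0 PD.
pose good r := `[< exists2 W : 'M[k]_N, \rank W = r & forall v, (v <= W)%MS -> P v >].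
have ex_good : exists r, good r.
  exists 0%N; apply/asboolP; exists 0; first exact: mxrank0.
  by move=> v; rewrite submx0 => /eqP ->.
have good_le r : good r -> (r <= N)%N.
  by move=> /asboolP[W <- _]; apply: rank_leq_row.
have [r /asboolP[W Wr WP] rmax] := ex_maxnP ex_good good_le.
exists W => v; split=> [Pv|]; last exact: WP.
have : good (\rank (W + v)%MS).
  apply/asboolP; exists (W + v)%MS => // u /sub_addsmxP[[a b] /= ->].
  have -> : b *m v = b 0 0 *: v by rewrite -mul_scalar_mx -mx11_scalar.
  by rewrite addrC; apply: PD => //; apply/WP/submxMl.
move/rmax; rewrite -Wr => le; apply: submx_trans (addsmxSr W v) _.
by rewrite -(geq_leqif (mxrank_leqif_sup (addsmxSl W v))).
Qed.

Definition submodule_closed p (Q : 'rV[A]_p -> Prop) : Prop :=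
  Q 0 /\ forall a u v, Q u -> Q v -> Q (a *: u + v).

Lemma submodule_closed_sum p (Q : 'rV[A]_p -> Prop) (I : Type) (r : seq I)
    (a : I -> A) (f : I -> 'rV[A]_p) : submodule_closed Q ->
  (forall i, Q (f i)) -> Q (\sum_(i <- r) a i *: f i).
Proof.
move=> [Q0 QD] Qf; elim: r => [|i r IHr]; first by rewrite big_nil.
by rewrite big_cons; apply: QD.
Qed.

Section Kernel.
Variables (p q : nat) (sp : 'I_p -> nat) (sq : 'I_q -> nat) (C : 'M[A]_(p, q)).
Hypothesis C_homog : mx_homog sp sq C.

Definition hkernel (j : nat) (u : 'rV[A]_p) := rcomp sp j u = u /\ u *m C = 0.

Lemma hkernel_rcomp j u : u *m C = 0 -> hkernel j (rcomp sp j u).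
Proof.
move=> uC; split; first exact: rcomp_idem.
by rewrite -(rcomp_mul _ _ C_homog) uC raddf0.
Qed.

Lemma rcomp_scaleC j c (u : 'rV[A]_p) :
  rcomp sp j (phi c%:MP *: u) = phi c%:MP *: rcomp sp j u.
Proof.
apply/rowP => a; rewrite !mxE; case: ifP => _; last by rewrite mulr0.
exact: hcomp_scale.
Qed.

(** Rows of degree [j] are combinations of the finitely many rows [X^m e_a] with
    [mdeg m <= j], so that those in the kernel form a finite dimensional space.
    Generation is phrased with closed predicates [Q], to be instantiated with the
    row space of a matrix once all degrees have been put together. *)
Lemma hkernel_finite j : exists s : seq 'rV[A]_p,
  (forall u, u \in s -> hkernel j u) /\
  forall u Q, hkernel j u -> submodule_closed Q -> (forall v, v \in s -> Q v) -> Q u.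
Proof.
pose I : finType := ('I_p * 'X_{1..n < j.+1})%type.
pose ev (i : 'I_#|I|) : 'I_p * 'X_{1..n < j.+1} := enum_val i.
pose e (i : 'I_#|I|) : 'rV[A]_p := phi 'X_[(ev i).2] *: delta_mx 0 (ev i).1.
pose psi (c : 'rV[k]_#|I|) := \sum_i phi (c 0 i)%:MP *: e i.
have psiD c u v : psi (c *: u + v) = phi c%:MP *: psi u + psi v.
  rewrite scaler_sumr -big_split; apply: eq_bigr => i _ /=.
  by rewrite !mxE mpolyCD mpolyCM rmorphD rmorphM scalerDl scalerA.
have psi0 : psi 0 = 0.
  by rewrite /psi big1 // => i _; rewrite mxE mpolyC0 rmorph0 scale0r.
have [W WP] : exists W : 'M[k]_#|I|, forall v, hkernel j (psi v) <-> (v <= W)%MS.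
  apply: (subspace_span (P := fun v => hkernel j (psi v))).
    by rewrite psi0; split; rewrite ?mul0mx ?raddf0.
  move=> c u v [uj uC] [vj vC]; rewrite psiD; split.
    by rewrite raddfD /= rcomp_scaleC uj vj.
  by rewrite mulmxDl -scalemxAl uC vC scaler0 addr0.
exists [seq psi (row r W) | r <- enum 'I_#|I|]; split.
  by move=> _ /mapP[r _ ->]; apply/WP/row_sub.
move=> u Q uker Qcl Qs.
have [c uc] : exists c, u = psi c.
  exists (\row_(i < #|I|) mcf (ev i).2 (u 0 (ev i).1)).
  rewrite /psi (reindex_onto (enum_rank : I -> _) ev) /=; last first.
    by move=> i _; rewrite enum_valK.
  under eq_bigr do rewrite mxE /e /ev enum_rankK.
  rewrite (eq_bigl predT) => [|i]; last by rewrite /ev enum_rankK eqxx.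
  rewrite -(pair_big predT predT (fun a (m : 'X_{1..n < j.+1}) =>
    phi (mcf m (u 0 a))%:MP *: (phi 'X_[m] *: delta_mx 0 a))) /=.
  rewrite {1}(row_sum_delta u); apply: eq_bigr => a _.
  under eq_bigr do rewrite scalerA.
  rewrite -scaler_suml -mcf_expand_bounded // => m jm.
  have [uj _] := uker; rewrite -uj mxE; case: ifP => _; last exact: raddf0.
  by rewrite mcf_hcomp; case: eqP => // mj; move: jm; rewrite mj; lia.
have /submxP[d cd] : (c <= W)%MS by apply/WP; rewrite -uc.
have -> : u = \sum_r phi (d 0 r)%:MP *: psi (row r W).
  rewrite uc cd mulmx_sum_row.
  elim/big_rec2: _ => [|r y z _ <-]; first exact: psi0.
  by rewrite psiD.
by apply: submodule_closed_sum => // r; apply/Qs/map_f; rewrite mem_enum.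
Qed.

(** In degrees above [E] every homogeneous element is a multiple of the variable
    [x0], which is not a zero divisor: an element of the kernel in degree [j.+1]
    is [x0] times an element of the kernel in degree [j]. So the kernel is
    generated in degrees at most [E], where it is finite dimensional. *)
Lemma kernel_finite : exists s : seq ('rV[A]_p * nat),
  (forall u, u \in s -> hkernel u.2 u.1) /\
  forall u Q, u *m C = 0 -> submodule_closed Q -> (forall v, v \in s -> Q v.1) -> Q u.
Proof.
pose E := (\max_a sp a + D)%N.
pose s_ j := sval (cid (hkernel_finite j)).
exists [seq (u, j) | j <- iota 0 E.+1, u <- s_ j]; split.
  by move=> _ /allpairsPdep[j [u [_ us ->]]]; have [+ _] := svalP (cid (hkernel_finite j)); apply.
move=> u Q uC Qcl Qs.
suff Qhom j v : hkernel j v -> Q v.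
  have [M ->] := rcomp_sum sp u.
  have -> : \sum_(j < M) rcomp sp j u = \sum_(j < M) 1 *: rcomp sp j u.
    by apply: eq_bigr => j _; rewrite scale1r.
  by apply: submodule_closed_sum => // j; apply/Qhom/hkernel_rcomp.
elim: j v => [|j IHj] v vker.
  have [_ H] := svalP (cid (hkernel_finite 0)); apply: (H v Q vker Qcl) => w ws.
  by apply: (Qs (w, 0%N)); apply/allpairsPdep; exists 0%N, w.
have [jE|Ej] := leqP j.+1 E.
  have [_ H] := svalP (cid (hkernel_finite j.+1)); apply: (H v Q vker Qcl) => w ws.
  apply: (Qs (w, j.+1)); apply/allpairsPdep; exists j.+1, w; split=> //.
  by rewrite mem_iota.
have [vj vC] := vker.
have spE a : (sp a + D <= j)%N.
  by apply: leq_trans (ltnSE Ej); rewrite leq_add2r; apply: leq_bigmax.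
have [w wP] : exists w, v = phi 'X_x0 *: w.
  have [b bP] := row_fun_choice (fun a => divx0 (hcompP (j.+1 - sp a) (v 0 a))
    (ltac:(have := spE a; lia) : (D <= j.+1 - sp a)%N)).
  exists (\row_a b a); apply/rowP => a; rewrite -[in LHS]vj [LHS]mxE ifT.
    by rewrite bP !mxE mulrC.
  by have := spE a; lia.
have vE : v = phi 'X_x0 *: rcomp sp j w.
  by rewrite -rcomp_scaleX mdeg1 -wP vj.
have [Q0 QD] := Qcl; rewrite vE -[_ *: _]addr0; apply: QD => //.
apply: IHj; split; first exact: rcomp_idem.
apply/rowP => b; rewrite [RHS]mxE; apply: mulx0_inj.
by have /rowP/(_ b) := vC; rewrite vE -scalemxAl !mxE mulrC.
Qed.

Lemma kernel_matrix : exists t : {r : nat & (('I_r -> nat) * 'M[A]_(r, p))%type},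
  mx_homog (tagged t).1 sp (tagged t).2 /\
  forall x : 'rV[A]_p, x *m C = 0 <-> exists y, x = y *m (tagged t).2.
Proof.
have [s [sker sgen]] := kernel_finite.
pose S := in_tuple s.
pose B : 'M[A]_(size s, p) := \matrix_i (tnth S i).1.
exists (existT (fun r => (('I_r -> nat) * 'M[A]_(r, p))%type) (size s)
  (fun i => (tnth S i).2, B)) => /=.
have skeri i : hkernel (tnth S i).2 (tnth S i).1 by apply/sker/mem_tnth.
split.
  move=> i b; have [ui _] := skeri i; rewrite mxE -ui mxE.
  have [bi|_] := leqP; last by left.
  right; exists ((tnth S i).2 - sp b)%N; first by rewrite subnK.
  exact: hcompP.
move=> x; split=> [xC|[y ->]]; last first.
  rewrite -mulmxA; suff -> : B *m C = 0 by rewrite mulmx0.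
  by apply/row_matrixP => i; rewrite row_mul rowK row0; have [] := skeri i.
apply: (sgen x (fun x => exists y, x = y *m B) xC) => [|v vs].
  split; first by exists 0; rewrite mul0mx.
  by move=> a _ _ [y ->] [z ->]; exists (a *: y + z); rewrite mulmxDl -scalemxAl.
have vi : (index v s < size s)%N by rewrite index_mem.
exists (delta_mx 0 (Ordinal vi)); rewrite -rowE rowK (tnth_nth v) /=.
by rewrite nth_index.
Qed.

End Kernel.

(** Homogeneous matrices with their degrees; iterating [next_hmatrix] makes the
    number of columns of each one convertible to the number of rows of the
    preceding one. *)
Record hmatrix := HMatrix {
  hm_p : nat; hm_q : nat; hm_sp : 'I_hm_p -> nat; hm_sq : 'I_hm_q -> nat;
  hm_mx : 'M[A]_(hm_p, hm_q); hm_homog : mx_homog hm_sp hm_sq hm_mx }.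

Arguments hm_homog : clear implicits.

Definition next_hmatrix (C : hmatrix) : hmatrix :=
  let t := cid (kernel_matrix (hm_homog C)) in
  HMatrix (proj1 (svalP t)).

Lemma next_hmatrixP (C : hmatrix) (x : 'rV[A]_(hm_p C)) :
  x *m hm_mx C = 0 <-> exists y, x = y *m hm_mx (next_hmatrix C).
Proof. exact: (proj2 (svalP (cid (kernel_matrix (hm_homog C))))). Qed.

Lemma var_col_homog : mx_homog (fun _ : 'I_n => 1%N) (fun _ : 'I_1 => 0%N) var_col.
Proof.
by move=> i b; right; exists 1%N; rewrite // mxE -(mdeg1 i); apply: compX.
Qed.

Definition hresolution (i : nat) : hmatrix := iter i next_hmatrix (HMatrix var_col_homog).

Lemma residue_graded_resolution :
  inhabited (graded_resolution Acomp (@residue_comp k A eps)).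
Proof.
apply: inhabits; unshelve refine
 (@GradedResolution A Acomp (residue_field eps) (@residue_comp k A eps)
  (@FreeResolution A (residue_field eps) (fun i => hm_q (hresolution i))
   (fun i => hm_mx (hresolution i)) res_aug _ _ _)
  (fun i => @hm_sq (hresolution i)) _ _).
- exact: res_aug_surj.
- exact: res_aug_ex0.
- by move=> i x; apply: next_hmatrixP.
- by move=> i a b; apply: (hm_homog (hresolution i)).
- by move=> a; left.
Qed.

End Existence.

End MonomialRing.

(** * The first Betti number over the polynomial ring *)
Section FiniteBetti.
Variables (k : fieldType) (n : nat) (gs : seq 'X_{1..n}) (A : comNzRingType).
Variables (phi : {rmorphism {mpoly k[n]} -> A}) (eps : {rmorphism A -> k}).
Variable (Acomp : nat -> set A).
Hypothesis pres : monomial_presentation gs phi eps Acomp.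
Hypothesis gs_deg : forall g, g \in gs -> (1 < mdeg g)%N.
Hypothesis gs_min : forall g, g \in gs -> minimal_nonstandard gs g.
Hypothesis gs_uniq : uniq gs.

Local Notation Q := {mpoly k[n]}.
Local Notation M := (restr_scalars phi).

Definition eval0 : {rmorphism Q -> k} := meval (fun=> 0).

Lemma eval0E f : eval0 f = f@_0%MM.
Proof.
rewrite {1}(mpolyE f) raddf_sum [RHS](congr1 (mcoeff 0%MM) (mpolyE f)) raddf_sum /=.
apply: eq_bigr => m _; rewrite mevalZ mcoeffZ mevalX mcoeffX; congr (_ * _).
have [->|m0] := eqVneq m 0%MM; first by rewrite big1 // => i _; rewrite mnm0E.
apply/eqP; rewrite prodf_seq_eq0 /=.
move: m0; rewrite -mdeg_eq0 mdegE sum_nat_eq0 negb_forall => /existsP[i /= mi].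
by apply/hasP; exists i; rewrite ?mem_index_enum // expr0n (negPf mi).
Qed.

Definition gen_col : 'M[Q]_(size gs, 1) := \col_b 'X_[tnth (in_tuple gs) b].

Definition quot_aug (x : 'rV[Q]_1) : M := phi (x 0 0).

Lemma quot_aug_is_linear : linear quot_aug.
Proof. by move=> a x y; rewrite /quot_aug !mxE rmorphD rmorphM. Qed.

HB.instance Definition _ := GRing.isLinear.Build Q 'rV[Q]_1 M _
  quot_aug quot_aug_is_linear.

Lemma quot_aug_surj y : exists x, quot_aug x = y.
Proof.
have [f ->] := mpres_surj pres y; exists f%:M.
by rewrite /quot_aug mxE mulr1n.
Qed.

Lemma phi_gen g : g \in gs -> phi 'X_[g] = 0.
Proof.
move=> ggs; apply/(mpres_ker pres) => h Eh; rewrite mcoeffX; case: eqP => // gh.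
by case/negP: Eh; rewrite -gh; apply/hasP; exists g; rewrite ?lepm_refl.
Qed.

Lemma quot_aug_ex0 x : quot_aug x = 0 <-> exists y, x = y *m gen_col.
Proof.
split=> [x0|[y ->]]; last first.
  rewrite /quot_aug mxE rmorph_sum big1 // => b _.
  by rewrite rmorphM [gen_col _ _]mxE phi_gen ?mulr0 ?mem_tnth.
pose P f := exists y, f%:M = y *m gen_col.
suff : P (x 0 0) by rewrite /P -mx11_scalar.
rewrite (mpolyE (x 0 0)) big_seq; elim/big_ind: _.
- by exists 0; rewrite mul0mx raddf0.
- by move=> f g [y yE] [z zE]; exists (y + z); rewrite raddfD /= yE zE mulmxDl.
move=> m; rewrite mcoeff_msupp => xm.
have : ~~ standard gs m.
  by apply: contraNN xm => Em; rewrite ((mpres_ker pres _).1 x0).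
rewrite negbK => /hasP[g ggs gm].
have gi : (index g gs < size gs)%N by rewrite index_mem.
exists ((x 0 0)@_m *: 'X_[m - g] *: delta_mx 0 (Ordinal gi)).
rewrite -!scalemxAl -rowE; apply/rowP => i; rewrite ord1 !mxE mulr1n.
by rewrite (tnth_nth 0%MM) /= nth_index // -scalerAl -mpolyXD submK.
Qed.

(** If [g] were a proper divisor of [h] it would divide [h - U_(i)] for some [i],
    which is standard. *)
Lemma gs_antichain g h : g \in gs -> h \in gs -> (g <= h)%MM -> g = h.
Proof.
move=> ggs hgs gh; apply/mnmP => i; apply/eqP; rewrite eqn_leq.
rewrite (mnm_lepP gh) leqNgt; apply/negP => gi.
have ih : (U_(i) <= h)%MM by rewrite lep1mP; lia.
have := gs_min hgs ih; rewrite /standard => /hasPn/(_ g ggs)/negP; apply.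
apply/mnm_lepP => j; rewrite mnmBE mnm1E; have := mnm_lepP gh j.
by case: eqP => [<-|_] /=; [lia|rewrite subn0].
Qed.

Definition quot_rank i : nat := match i with 0 => 1 | 1 => size gs | _ => 0 end.

Definition quot_diff i : 'M[Q]_(quot_rank i.+1, quot_rank i) :=
  match i return 'M[Q]_(quot_rank i.+1, quot_rank i) with
  | 0 => gen_col | _ => 0 end.

(** The relations generate the kernel of [phi] minimally, since none of them divides
    another one; so they give the first map of a minimal resolution. *)
Theorem tor_dim1 (F : free_resolution M) : tor_dim eval0 F 1 = size gs.
Proof.
apply: (@tor_dim_minimal_start k Q eval0 _ F quot_rank quot_diff quot_aug 0).
- exact: quot_aug_surj.
- exact: quot_aug_ex0.
- by [].
- apply/matrixP => b i; rewrite !mxE eval0E mcoeffX.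
  case: eqP => // g0; have := gs_deg (mem_tnth b (in_tuple gs)).
  by rewrite g0 mdeg0.
move=> /= y y0; apply/rowP => b; rewrite !mxE eval0E.
have := congr1 (fun z : 'rV[Q]_1 => (z 0 0)@_(tnth (in_tuple gs) b)) y0.
rewrite !mxE raddf_sum mcoeff0 => <-.
rewrite (bigD1 b) //= mxE mcoeff_mulX lepm_refl big1 ?addr0 => [|c cb].
  by congr (_@__); apply/mnmP => i; rewrite mnmBE mnm0E subnn.
rewrite mxE mcoeff_mulX; case: ifP => // le; case/eqP: cb.
have /eqP := gs_antichain (mem_tnth c (in_tuple gs)) (mem_tnth b (in_tuple gs)) le.
by rewrite !(tnth_nth 0%MM) nth_uniq // => /eqP/val_inj.
Qed.

End FiniteBetti.

(** * A Hilbert-Burch resolution *)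
Section HilbertBurch.
Variables (k : fieldType) (n : nat).
Local Notation Q := {mpoly k[n]}.

(** The endomorphism setting the variable [i] to zero *)
Definition kill (i : 'I_n) : {rmorphism Q -> Q} :=
  mmap (@mpolyC n k) (fun j => if j == i then 0 else 'X_j).

Lemma killX i m : kill i 'X_[m] = if m i == 0%N then 'X_[m] else 0.
Proof.
rewrite [LHS]mmapX /mmap1; have [mi|mi] := eqVneq (m i) 0%N; last first.
  by rewrite (bigD1 i) //= eqxx expr0n (negPf mi) mul0r.
rewrite [RHS]mpolyXE_id; apply: eq_bigr => j _.
by case: eqP => // ->; rewrite mi !expr0.
Qed.

Lemma kill_dvd i (p : Q) : exists q, p = kill i p + q * 'X_i.
Proof.
rewrite (mpolyE p); elim/big_ind: _.
- by exists 0; rewrite rmorph0 mul0r addr0.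
- move=> f g [q {1}->] [r {1}->]; exists (q + r).
  by rewrite rmorphD mulrDl addrACA.
move=> m _; rewrite -mul_mpolyC rmorphM killX [kill i _%:MP]mmapC.
have [_|mi] := eqVneq (m i) 0%N; first by exists 0; rewrite mul0r addr0.
exists ((p@_m)%:MP * 'X_[m - U_(i)]); rewrite mulr0 add0r -mulrA -mpolyXD submK //.
by rewrite lep1mP.
Qed.

Variables y z : 'I_n.
Hypothesis yz : y != z.
Local Notation Y := ('X_y : Q).
Local Notation Z := ('X_z : Q).

Lemma mpolyX_neq0 m : 'X_[m] != 0 :> Q.
Proof.
apply/eqP => /(congr1 (mcoeff m)); rewrite mcoeffX mcoeff0 eqxx => /eqP.
by rewrite oner_eq0.
Qed.

Lemma kill_neq i j : j != i -> kill i 'X_j = 'X_j.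
Proof. by move=> /negPf ji; rewrite killX mnm1E ji. Qed.

Lemma kill_eq i : kill i 'X_i = 0.
Proof. by rewrite killX mnm1E eqxx. Qed.

(** Setting [Z] to zero shows that [Z] divides [w]; after division by [Z], setting
    [Y] to zero shows that [Y] divides [v]. *)
Lemma hilbert_burch (u v w : Q) : u * (Y * Z) + v * Z ^+ 2 + w * Y ^+ 3 = 0 ->
  exists a b, [/\ u = a * Z + b * Y ^+ 2, v = - (a * Y) & w = - (b * Z)].
Proof.
have Y0 : Y != 0 := mpolyX_neq0 _; have Z0 : Z != 0 := mpolyX_neq0 _.
move=> e; have [c wc] := kill_dvd z w.
have /eqP := congr1 (kill z) e; rewrite !(rmorphD, rmorphM, rmorphXn, rmorph0).
rewrite kill_eq (kill_neq yz) !(mulr0, add0r) !mulf_eq0 (negPf Y0) !orbF => /eqP kw.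
rewrite kw add0r in wc.
have {e} e : u * Y + v * Z + c * Y ^+ 3 = 0.
  apply: (mulIf Z0); rewrite mul0r -e wc; ring.
have [d vd] := kill_dvd y v.
have /eqP := congr1 (kill y) e; rewrite !(rmorphD, rmorphM, rmorphXn, rmorph0).
have zy : z != y by rewrite eq_sym.
rewrite kill_eq (kill_neq zy) !(mulr0, add0r, addr0) mulf_eq0 (negPf Z0) orbF => /eqP kv.
rewrite kv add0r in vd.
have {}e : u + d * Z + c * Y ^+ 2 = 0.
  apply: (mulIf Y0); rewrite mul0r -e vd; ring.
exists (- d), (- c); split; last 2 first.
- by rewrite vd; ring.
- by rewrite wc; ring.
by apply/eqP; rewrite -subr_eq0 -e; apply/eqP; ring.
Qed.

Variables (A : comNzRingType) (phi : {rmorphism Q -> A}) (eps : {rmorphism A -> k}).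
Variable (Acomp : nat -> set A).
Let gs := [:: (U_(y) + U_(z))%MM; (U_(z) *+ 2)%MM; (U_(y) *+ 3)%MM].
Hypothesis pres : monomial_presentation gs phi eps Acomp.

Definition hb_mx : 'M[Q]_(2, 3) := \matrix_(i, j)
  nth 0 (nth [::] [:: [:: Z; - Y; 0]; [:: Y ^+ 2; 0; - Z]] i) j.

Definition hb_rank i : nat := match i with 0 => 1 | 1 => 3 | 2 => 2 | _ => 0 end.

Definition hb_diff i : 'M[Q]_(hb_rank i.+1, hb_rank i) :=
  match i return 'M[Q]_(hb_rank i.+1, hb_rank i) with
  | 0 => gen_col k gs | 1 => hb_mx | _ => 0 end.

Lemma hb_mx_mul (x : 'rV[Q]_2) (a := x 0 0) (b := x 0 1) :
  x *m hb_mx = \row_j nth 0 [:: a * Z + b * Y ^+ 2; - (a * Y); - (b * Z)] j.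
Proof.
apply/rowP => j; rewrite !mxE !big_ord_recl big_ord0 !mxE /=.
have -> : lift ord0 ord0 = 1 :> 'I_2 by apply: val_inj.
by case: j => [[|[|[|//]]] jP] /=; rewrite /a /b; ring.
Qed.

Lemma gen_col_mul (x : 'rV[Q]_3) : (x *m gen_col k gs) 0 0 =
  x 0 0 * (Y * Z) + x 0 1 * Z ^+ 2 + x 0 2%:R * Y ^+ 3.
Proof.
rewrite mxE !big_ord_recl big_ord0 !mxE !(tnth_nth 0%MM) /= addr0 addrA.
rewrite mpolyXD -!mpolyXn; congr (_ * _ + _ * _ + _ * _); congr (x 0 _); exact: val_inj.
Qed.

Lemma quot_resolution : inhabited (free_resolution (restr_scalars phi)).
Proof.
have Y0 : Y != 0 := mpolyX_neq0 _; have Z0 : Z != 0 := mpolyX_neq0 _.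
apply: inhabits; unshelve refine
  (@FreeResolution Q (restr_scalars phi) hb_rank hb_diff (quot_aug phi) _ _ _).
- exact: quot_aug_surj pres.
- exact: quot_aug_ex0 pres.
case=> [|[|i]] x /=.
- split=> [x0|[w ->]].
    have := gen_col_mul x; rewrite x0 mxE => /esym/hilbert_burch[a [b [ua vb wc]]].
    exists (\row_j nth 0 [:: a; b] j); rewrite hb_mx_mul; apply/rowP => j.
    rewrite !mxE; case: j => [[|[|[|//]]] jP] /=; rewrite -?ua -?vb -?wc; congr (x 0 _);
      exact: val_inj.
  apply/rowP => i; rewrite ord1 gen_col_mul hb_mx_mul !mxE /=; ring.
- split=> [|[w ->]]; last by rewrite mulmx0 mul0mx.
  rewrite hb_mx_mul => x0; exists 0; rewrite mul0mx; apply/rowP => j.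
  have /rowP/(_ 2%:R) := x0; have /rowP/(_ 1) := x0; rewrite !mxE /= => /eqP a0 /eqP b0.
  move: a0 b0; rewrite !oppr_eq0 !mulf_eq0 (negPf Y0) (negPf Z0) !orbF => /eqP a0 /eqP b0.
  by case: j => [[|[|//]] jP]; [rewrite -[RHS]a0|rewrite -[RHS]b0]; congr (x 0 _); apply: val_inj.
split=> [_|_]; last by rewrite mulmx0.
by exists 0; case: i x => [|i] x; apply/rowP => -[].
Qed.

End HilbertBurch.

(** * Associated graded rings of semigroup rings *)
Section GrPresentation.
Variables (k : fieldType) (S : numsgp) (gens : seq nat).
Let n := size gens.
Implicit Types (m : 'X_{1..n}) (s d : nat).

Definition weight m : nat := \sum_i m i * nth 0 gens i.

Variable rels : seq 'X_{1..n}.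

Hypothesis gens_pos : forall g, g \in gens -> (0 < g)%N.
Hypothesis gens_mem : forall g, g \in gens -> g \in S.
Hypothesis gens_gen : forall s, s \in S -> exists m, weight m = s.
(** A relation is an exponent vector whose weight has a longer factorization; on the
    vectors which no relation divides, the weight is assumed to be injective. *)
Hypothesis rels_longer : forall r, r \in rels ->
  exists r', weight r' = weight r /\ (mdeg r < mdeg r')%N.
Hypothesis weight_inj : forall m1 m2,
  standard rels m1 -> standard rels m2 -> weight m1 = weight m2 -> m1 = m2.

Local Notation R := (sgp_ring k S).
Local Notation I := (@sgp_max k S).
Local Notation gr := (sgp_gr k S).
Local Notation mono := (@sgp_mono k S).
Local Notation prop := (@sgp_max_proper k S).
Local Notation cls := (gr_class prop).

Lemma mnm_ind (P : 'X_{1..n} -> Prop) : P 0%MM ->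
  (forall i m, P m -> P (U_(i) + m)%MM) -> forall m, P m.
Proof.
move=> P0 PU m; have [d] := ubnP (mdeg m); elim: d m => // d IHd m md.
have [->//|] := eqVneq m 0%MM.
rewrite -mdeg_eq0 mdegE sum_nat_eq0 negb_forall => /existsP[i /= mi].
have im : (U_(i) <= m)%MM by rewrite lep1mP.
rewrite -(submK im) addmC; apply/PU/IHd.
by move: md; rewrite -{1}(submK im) mdegD mdeg1 addn1.
Qed.

Lemma weight0 : weight 0%MM = 0%N.
Proof. by rewrite /weight big1 // => i _; rewrite mnm0E mul0n. Qed.

Lemma weightD m1 m2 : weight (m1 + m2) = (weight m1 + weight m2)%N.
Proof. by rewrite -big_split; apply: eq_bigr => i _; rewrite mnmDE mulnDl. Qed.

Lemma weightU i : weight U_(i)%MM = nth 0%N gens i.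
Proof.
rewrite /weight (bigD1 i) //= mnm1E eqxx mul1n big1 ?addn0 // => j ji.
by rewrite mnm1E eq_sym (negPf ji) mul0n.
Qed.

Lemma mdeg_le_weight m : (mdeg m <= weight m)%N.
Proof.
rewrite mdegE; apply: leq_sum => i _; rewrite leq_pmulr //.
by apply/gens_pos/mem_nth.
Qed.

Lemma weight_mem m : weight m \in S.
Proof.
elim/mnm_ind: m => [|i m IHm]; first by rewrite weight0; apply: ns_mem0.
by rewrite weightD weightU; apply: ns_memD IHm; apply/gens_mem/mem_nth.
Qed.

Lemma nonstandard_longer m : ~~ standard rels m ->
  exists m', weight m' = weight m /\ (mdeg m < mdeg m')%N.
Proof.
rewrite negbK => /hasP[r rr rm]; have [r' [wr dr]] := rels_longer rr.
exists (m - r + r')%MM; rewrite -{2 3}(submK rm) !weightD !mdegD wr; split=> //.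
by rewrite ltn_add2l.
Qed.

(** Replacing relations by longer factorizations increases the length, which is
    bounded by the weight; the process ends with a standard vector. *)
Lemma standard_longest m : exists m',
  [/\ weight m' = weight m, (mdeg m <= mdeg m')%N & standard rels m'].
Proof.
have [d] := ubnP (weight m - mdeg m); elim: d m => // d IHd m md.
have [Em|/nonstandard_longer[m1 [w1 d1]]] := boolP (standard rels m).
  by exists m.
have [|m2 [w2 d2 E2]] := IHd m1; first by have := mdeg_le_weight m1; lia.
by exists m2; split=> //; [rewrite w2|lia].
Qed.

Definition has_length d s := exists m, weight m = s /\ (d <= mdeg m)%N.

(** A longer factorization could be lengthened to a standard one, which must be [m]
    itself because the weight separates standard vectors. *)
Lemma standard_max_length m : standard rels m -> ~ has_length (mdeg m).+1 (weight m).
Proof.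
move=> Em [m1 [w1 d1]]; have [m2 [w2 d2 E2]] := standard_longest m1.
have m2m : m2 = m by apply: weight_inj; rewrite // w2.
by move: d1; rewrite -m2m ltnNge d2.
Qed.

Lemma sgp_mono1 : mono 0 = 1.
Proof. by apply: val_inj; rewrite sgp_mono_val ?ns_mem0 ?rmorph1. Qed.

Lemma sgp_monoM s t : s \in S -> t \in S -> mono s * mono t = mono (s + t).
Proof.
move=> sS tS; apply: val_inj.
by rewrite rmorphM /= !sgp_mono_val ?ns_memD // exprD.
Qed.

Lemma sgp_ring_mem (f : R) s : (val f)`_s != 0 -> s \in S.
Proof. by have /sgp_suppP := valP f; apply. Qed.

Lemma sgp_valZ c (f : R) : val (c *: f) = c *: val f.
Proof. exact: linearZ. Qed.

Lemma sgp_ring_expand (f : R) :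
  f = \sum_(s < size (val f)) (val f)`_s *: mono s.
Proof.
apply: val_inj; rewrite raddf_sum -{1}(coefK (val f)) poly_def.
apply: eq_bigr => s _; rewrite [RHS]sgp_valZ.
have [->|fs] := eqVneq (val f)`_s 0; first by rewrite !scale0r.
by rewrite sgp_mono_val //; exact: sgp_ring_mem fs.
Qed.

Lemma sgp_max_length (f : R) s : I f -> (val f)`_s != 0 -> has_length 1 s.
Proof.
move=> If fs; have sS : s \in S by apply: sgp_ring_mem fs.
have [m ms] := gens_gen sS; exists m; split=> //.
rewrite lt0n mdeg_eq0; apply: contraNneq fs => m0.
by rewrite -ms m0 weight0 sgp_max_coef0.
Qed.

Lemma has_lengthD d e s t : has_length d s -> has_length e t ->
  has_length (d + e) (s + t).
Proof.
move=> [m [<- dm]] [m' [<- em]]; exists (m + m')%MM.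
by rewrite weightD mdegD leq_add.
Qed.

Lemma sgp_max_exp_length d (f : R) : ideal_exp I d f ->
  forall s, (val f)`_s != 0 -> has_length d s.
Proof.
elim: d f => [|d IHd] f.
  move=> _ s fs; have [m ms] := gens_gen (sgp_ring_mem fs).
  by exists m.
move: f; apply: ideal_gen_ind.
- by move=> s; rewrite raddf0 coef0 eqxx.
- move=> x y Hx Hy s; rewrite raddfD coefD.
  by have [->|/Hx //] := eqVneq (val x)`_s 0; rewrite add0r => /Hy.
move=> a _ [x [y [Ix Iy ->]]] s.
have [/existsP[j /andP[axj yj]] _|] := boolP [exists j : 'I_s.+1,
    ((val (a * x))`_j != 0) && ((val y)`_(s - j) != 0)].
  rewrite -(subnKC (leq_ord j)) -add1n; apply: has_lengthD (IHd y Iy _ yj).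
  by apply: sgp_max_length axj; apply: ideal_genM.
rewrite negb_exists => /forallP H; rewrite mulrA rmorphM coefM big1 ?eqxx //.
by move=> j _; apply/eqP; rewrite mulf_eq0; have := H j; rewrite negb_and !negbK.
Qed.

Lemma weight_exp m : ideal_exp I (mdeg m) (mono (weight m)).
Proof.
elim/mnm_ind: m => [|i m IHm]; first by rewrite mdeg0.
rewrite mdegD mdeg1 weightD weightU -sgp_monoM ?weight_mem //; last first.
  by apply/gens_mem/mem_nth.
apply: ideal_gen_sub; exists (mono (nth 0 gens i)), (mono (weight m)); split=> //.
apply: ideal_gen_sub; have gi := mem_nth 0 (ltn_ord i).
by exists (nth 0 gens i); [apply: gens_mem|split=> //; rewrite -lt0n gens_pos].
Qed.

Lemma ideal_exp_le d e (f : R) : (d <= e)%N -> ideal_exp I e f -> ideal_exp I d f.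
Proof.
move=> /subnKC <-; elim: (e - d)%N => [|i IHi]; first by rewrite addn0.
by rewrite addnS => /ideal_expS.
Qed.

Lemma sgp_scale_alg c (f : R) : c *: f = c%:A * f.
Proof. by rewrite -scalerAl mul1r. Qed.

(** The powers of the maximal ideal are spanned by the monomials [t^s] that they
    contain, and [t^s] is in the [d]-th power when [s] is a sum of at least [d]
    generators. *)
Lemma sgp_max_expP d (f : R) :
  ideal_exp I d f <-> forall s, (val f)`_s != 0 -> has_length d s.
Proof.
split; first exact: sgp_max_exp_length.
move=> H; rewrite (sgp_ring_expand f); apply: ideal_exp_sum => s _.
have [->|/H[m [<- dm]]] := eqVneq (val f)`_s 0.
  by rewrite scale0r; apply: ideal_exp0.
rewrite sgp_scale_alg; apply: ideal_expMl.
exact: ideal_exp_le dm (weight_exp m).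
Qed.

Lemma gr_pi0P (f : rees I) : gr_pi prop f = 0 <-> forall d, ideal_exp I d.+1 (val f)`_d.
Proof.
rewrite -(rmorph0 (gr_pi prop)); split.
  move=> /eqP; rewrite /gr_pi -Quotient.idealrBE subr0 => /gr_kernelP //.
move=> H; apply/eqP; rewrite /gr_pi -Quotient.idealrBE subr0.
exact/gr_kernelP.
Qed.

Lemma gr_class0 d (a : R) : ideal_exp I d.+1 a -> cls d a = 0.
Proof.
move=> Ia; apply/gr_pi0P => e; rewrite gr_class_val ?coefZ ?coefXn; last first.
  exact: ideal_expS.
by case: eqP => [->|_]; rewrite ?mulr1 // mulr0; apply: ideal_exp0.
Qed.

Lemma gr_classM d e (a b : R) : ideal_exp I d a -> ideal_exp I e b ->
  cls d a * cls e b = cls (d + e) (a * b).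
Proof.
move=> Ia Ib; rewrite /gr_class -rmorphM; congr gr_pi; apply: val_inj.
rewrite rmorphM /= !gr_class_val //; last exact: ideal_expM.
by rewrite -scalerAl -scalerAr scalerA exprD.
Qed.

Lemma gr_classD d (a b : R) : ideal_exp I d a -> ideal_exp I d b ->
  cls d (a + b) = cls d a + cls d b.
Proof.
move=> Ia Ib; rewrite /gr_class -rmorphD; congr gr_pi; apply: val_inj.
rewrite rmorphD /= !gr_class_val //; last exact: ideal_expD.
by rewrite scalerDl.
Qed.

Lemma gr_classZ d c (a : R) : ideal_exp I d a ->
  cls d (c *: a) = sgp_grC S c * cls d a.
Proof.
by move=> Ia; rewrite /sgp_grC gr_classM // add0n sgp_scale_alg.
Qed.

Definition sgp_presentation : {rmorphism {mpoly k[n]} -> gr} :=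
  mmap (@sgp_grC k S) (fun i => cls 1 (mono (tnth (in_tuple gens) i))).

Local Notation phi := sgp_presentation.

Lemma phiC c : phi c%:MP = sgp_grC S c.
Proof. exact: mmapC. Qed.

Lemma phiX m : phi 'X_[m] = cls (mdeg m) (mono (weight m)).
Proof.
elim/mnm_ind: m => [|i m IHm].
  rewrite mpolyX0 [LHS]rmorph1 mdeg0 weight0 sgp_mono1.
  have := rmorph1 (@sgp_grC k S); rewrite /= /sgp_grC scale1r => <-.
  by [].
have gi : nth 0%N gens i \in gens by exact: mem_nth.
rewrite mpolyXD rmorphM IHm mdegD weightD mdeg1 weightU.
rewrite -sgp_monoM ?weight_mem ?gens_mem // -gr_classM; last 2 first.
- by have := weight_exp U_(i)%MM; rewrite mdeg1 weightU.
- exact: weight_exp.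
by congr (_ * _); rewrite [LHS]mmapX mmap1U (tnth_nth 0%N).
Qed.

Lemma phi_nonstandard m : ~~ standard rels m -> phi 'X_[m] = 0.
Proof.
move=> /nonstandard_longer[m' [wm dm]]; rewrite phiX; apply: gr_class0.
by rewrite -wm; apply: ideal_exp_le dm (weight_exp m').
Qed.

Lemma phi_expand f : phi f = \sum_(m <- msupp f) sgp_grC S f@_m * phi 'X_[m].
Proof.
rewrite {1}(mpolyE f) rmorph_sum; apply: eq_bigr => m _.
by rewrite -mul_mpolyC rmorphM -phiC.
Qed.

Definition rees_mono c m : rees I := insubd 0 ((c *: mono (weight m)) *: 'X^(mdeg m)).

Lemma rees_mono_exp c m : ideal_exp I (mdeg m) (c *: mono (weight m)).
Proof. by rewrite sgp_scale_alg; apply/ideal_expMl/weight_exp. Qed.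

Lemma gr_pi_rees_mono c m : gr_pi prop (rees_mono c m) = sgp_grC S c * phi 'X_[m].
Proof. by rewrite phiX -gr_classZ //; apply: weight_exp. Qed.

Lemma rees_mono_coef c m d s :
  (val (val (rees_mono c m))`_d)`_s = if (d == mdeg m) && (s == weight m) then c else 0.
Proof.
rewrite gr_class_val; last exact: rees_mono_exp.
rewrite coefZ coefXn; case: eqP => _; last by rewrite mulr0 raddf0 coef0.
rewrite mulr1 sgp_valZ coefZ sgp_mono_val ?weight_mem // coefXn.
by case: eqP; rewrite ?mulr1 ?mulr0.
Qed.

(** A standard [m] has maximal length among the factorizations of its weight, and it
    is the only factorization of that length; so the coefficient at
    [t^(weight m)] in degree [mdeg m] is that of [m], and it has to vanish if the
    image is zero because [t^(weight m)] is not in the next power of the maximal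
    ideal. *)
Lemma phi_kernel f : phi f = 0 <-> forall m, standard rels m -> f@_m = 0.
Proof.
split=> [|H]; last first.
  rewrite phi_expand big1 // => m _; have [Em|Em] := boolP (standard rels m).
    by rewrite H // rmorph0 mul0r.
  by rewrite phi_nonstandard // mulr0.
rewrite phi_expand.
under eq_bigr do rewrite -gr_pi_rees_mono.
rewrite -rmorph_sum => /gr_pi0P H m Em.
apply/eqP; apply: contra_notT (standard_max_length Em) => fm.
apply: (proj1 (sgp_max_expP _ _) (H (mdeg m))); rewrite raddf_sum coef_sum raddf_sum coef_sum.
rewrite (bigD1_seq m) ?msupp_uniq ?mcoeff_msupp //= rees_mono_coef !eqxx /=.
rewrite big1 ?addr0 // => m' m'm; rewrite rees_mono_coef.
case: eqP => //= dm; case: eqP => // wm; case/eqP: m'm.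
apply: weight_inj => //; apply: contraT => /nonstandard_longer[m1 [w1 d1]].
by case: (standard_max_length Em); exists m1; rewrite w1 dm.
Qed.

Lemma gr_class_phi d (a : R) : ideal_exp I d a ->
  exists f, cls d a = phi f /\ forall m, f@_m != 0 -> mdeg m = d.
Proof.
move=> /sgp_max_expP Ia.
pose P (b : R) := ideal_exp I d b /\
  exists f, cls d b = phi f /\ forall m, f@_m != 0 -> mdeg m = d.
suff : P a by case.
rewrite (sgp_ring_expand a); elim/big_ind: _.
- split; first exact: ideal_exp0.
  exists 0; rewrite rmorph0 gr_class0; last exact: ideal_exp0.
  by split=> // m; rewrite mcoeff0 eqxx.
- move=> x y [Ix [f [xf fd]]] [Iy [g [yg gd]]]; split; first exact: ideal_expD.
  exists (f + g); rewrite gr_classD // xf yg rmorphD; split=> // m.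
  by rewrite mcoeffD; have [->|/fd //] := eqVneq f@_m 0; rewrite add0r => /gd.
move=> s _; have [->|/Ia[m [<- dm]]] := eqVneq (val a)`_s 0.
  rewrite scale0r; split; first exact: ideal_exp0.
  exists 0; rewrite rmorph0 gr_class0; last exact: ideal_exp0.
  by split=> // m; rewrite mcoeff0 eqxx.
set c := (val a)`_(weight m); have Im := ideal_exp_le dm (rees_mono_exp c m).
split; first exact: Im.
have [dE|dN] := eqVneq (mdeg m) d.
  exists (c%:MP * 'X_[m]); rewrite rmorphM phiC phiX dE -gr_classZ; last first.
    by rewrite -dE; apply: weight_exp.
  split=> // u; rewrite mul_mpolyC mcoeffZ mcoeffX.
  by have [<-|_] := eqVneq m u; rewrite // mulr0 eqxx.
exists 0; rewrite rmorph0 gr_class0; last first.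
  by apply: ideal_exp_le (rees_mono_exp c m); rewrite ltn_neqAle eq_sym dN.
by split=> // u; rewrite mcoeff0 eqxx.
Qed.

Lemma phi_surj (x : gr) : exists f, x = phi f.
Proof.
have [f ->] := gr_pi_surj x.
have -> : f = \sum_(d < size (val f)) insubd 0 ((val f)`_d *: 'X^d).
  apply: val_inj; rewrite raddf_sum /= -{1}(coefK (val f)) poly_def.
  by apply: eq_bigr => d _; rewrite gr_class_val //; apply: reesP.
rewrite rmorph_sum; elim/big_ind: _ => [|y z [g ->] [h ->]|d _].
- by exists 0; rewrite rmorph0.
- by exists (g + h); rewrite rmorphD.
by have [g [gE _]] := gr_class_phi (reesP f d); exists g.
Qed.

Lemma sgp_gr_compP d (x : gr) : sgp_gr_comp d x <->
  exists f, x = phi f /\ forall m, f@_m != 0 -> mdeg m = d.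
Proof.
split=> [[f [fd ->]]|[f [-> fd]]].
  suff -> : f = insubd 0 ((val f)`_d *: 'X^d) by apply: gr_class_phi (reesP f d).
  apply: val_inj; rewrite gr_class_val; last exact: reesP.
  apply/polyP => e; rewrite coefZ coefXn; have [->|/fd ->] := eqVneq e d.
    by rewrite mulr1.
  by rewrite mulr0.
exists (\sum_(m <- msupp f) rees_mono f@_m m); split; last first.
  rewrite phi_expand (rmorph_sum (gr_pi prop)).
  by apply: eq_bigr => m _ /=; rewrite gr_pi_rees_mono.
move=> e ed; rewrite raddf_sum coef_sum big_seq big1 // => m.
rewrite mcoeff_msupp => /fd md; apply: val_inj; apply/polyP => s.
by rewrite rees_mono_coef md (negPf ed) raddf0 coef0.
Qed.

Lemma sgp_gr_eps_phi f : sgp_gr_eps (phi f) = f@_0%MM.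
Proof.
rewrite phi_expand rmorph_sum /= [RHS](congr1 (mcoeff 0%MM) (mpolyE f)) raddf_sum /=.
apply: eq_bigr => m _; rewrite -gr_pi_rees_mono sgp_gr_epsE rees_mono_coef.
rewrite mcoeffZ mcoeffX eq_sym mdeg_eq0 eq_sym; have [->|_] := eqVneq m 0%MM.
  by rewrite weight0 mulr1.
by rewrite mulr0.
Qed.

(** If a semigroup element is determined by its standard factorization, the
    associated graded ring is the monomial ring with the given relations: a product
    of generators is either a factorization of maximal length or it vanishes. *)
Theorem sgp_gr_monomial :
  monomial_presentation rels sgp_presentation (@sgp_gr_eps k S) (@sgp_gr_comp k S).
Proof.
split; [exact: phi_surj | exact: phi_kernel | exact: sgp_gr_eps_phi |].
exact: sgp_gr_compP.
Qed.

End GrPresentation.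

(** * Faces of the Kunz cone *)
Section KunzFace.
Variable R : realType.

Lemma apery_mem (S : numsgp) i : apery S i \in S.
Proof. by have [+ _] := aperyP S i; rewrite inE => /andP[]. Qed.

Lemma apery_le (S : numsgp) i s : s \in S -> s = i %[mod multiplicity S] ->
  (apery S i <= s)%N.
Proof.
move=> sS si; have [] := aperyP S i; rewrite inE => /andP[aS aN] ai.
rewrite leqNgt; apply: contra aN => sa.
set m := multiplicity S in si ai *; have m0 : (0 < m)%N by apply: multiplicity_gt0.
have /dvdnP[q qE] : (m %| apery S i - s)%N.
  by rewrite -eqn_mod_dvd ?(ltnW sa) //; apply/eqP; rewrite ai si.
case: q qE => [|q] qE; first by move/eqP: qE; rewrite mul0n subn_eq0 leqNgt sa.
have aE : apery S i = (s + q * m + m)%N by move: qE; rewrite mulSn; lia.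
rewrite aE leq_addl addnK /=; elim: q {qE aE} => [|q IHq]; first by rewrite addn0.
by rewrite mulSn addnCA; apply: ns_memD IHq; apply: multiplicity_in.
Qed.

Lemma apery_gt0 (S : numsgp) i : ~~ (multiplicity S %| i)%N -> (0 < apery S i)%N.
Proof.
rewrite lt0n; apply: contra => /eqP a0; have [_ ai] := aperyP S i.
by rewrite /dvdn -ai a0 mod0n.
Qed.

Variables (m : nat) (S : numsgp).
Hypothesis Sm : multiplicity S = m.

(** The index of an inequality [z_i + z_j >= z_l] of the Kunz cone *)
Definition kunz_triple (t : 'I_m.-1 * 'I_m.-1 * 'I_m.-1) : bool :=
  (t.1.1.+1 + t.1.2.+1 == t.2.+1 %[mod m])%N.

Definition slack (t : 'I_m.-1 * 'I_m.-1 * 'I_m.-1) (x : 'rV[R]_m.-1) : R :=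
  x 0 t.1.1 + x 0 t.1.2 - x 0 t.2.

Definition tight_face (T : pred ('I_m.-1 * 'I_m.-1 * 'I_m.-1)) : set 'rV[R]_m.-1 :=
  [set x | kunz_cone x /\ forall t, kunz_triple t -> T t -> slack t x = 0].

Lemma kunz_cone_slack x t : kunz_cone x -> kunz_triple t -> 0 <= slack t x.
Proof.
by move=> [_ Cx] /eqP tm; rewrite subr_ge0; apply: Cx.
Qed.

(** The functional is the sum of the slacks of the selected inequalities; each is
    nonnegative on the cone, so that the sum vanishes only if all of them do. *)
Lemma tight_face_is_face T : is_face (@kunz_cone R m) (tight_face T).
Proof.
pose c : 'cV[R]_m.-1 := \sum_(t | kunz_triple t && T t)
  (delta_mx t.1.1 0 + delta_mx t.1.2 0 - delta_mx t.2 0).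
have cE x : (x *m c) 0 0 = \sum_(t | kunz_triple t && T t) slack t x.
  rewrite mulmx_sumr summxE; apply: eq_bigr => t _.
  by rewrite mulmxBr mulmxDr -!colE !mxE.
exists c, 0; split=> [x Cx|].
  by rewrite cE sumr_ge0 // => t /andP[tm _]; apply: kunz_cone_slack.
rewrite predeqE => x; split=> -[Cx Hx]; split=> //.
  by rewrite cE big1 // => t /andP[tm Tt]; apply: Hx.
move=> t tm Tt; apply/eqP; move/eqP: Hx; rewrite cE psumr_eq0.
  by move=> /allP/(_ t); rewrite mem_index_enum tm Tt => /(_ isT).
by move=> u /andP[um _]; apply: kunz_cone_slack.
Qed.

Local Notation x0 := (kunz_point R m S).

Lemma kunz_point_cone : kunz_cone x0.
Proof.
split=> [i|i j l]; rewrite !mxE; first exact: ler0n.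
move=> ijl; rewrite -natrD ler_nat; apply: apery_le.
  by apply: ns_memD; apply: apery_mem.
rewrite Sm -ijl -modnDm -[in RHS]modnDm; congr (_ %% _)%N.
by have [_] := aperyP S i.+1; have [_] := aperyP S j.+1; rewrite Sm => -> ->.
Qed.

Definition tight_triple (t : 'I_m.-1 * 'I_m.-1 * 'I_m.-1) : bool :=
  (apery S t.1.1.+1 + apery S t.1.2.+1 == apery S t.2.+1)%N.

Lemma slack_kunz_point t : slack t x0 =
  (apery S t.1.1.+1 + apery S t.1.2.+1)%N%:R - (apery S t.2.+1)%:R.
Proof. by rewrite /slack !mxE natrD. Qed.

Lemma slack_tight t : tight_triple t -> slack t x0 = 0.
Proof. by rewrite slack_kunz_point => /eqP ->; rewrite subrr. Qed.

Lemma slack_not_tight t : kunz_triple t -> ~~ tight_triple t -> 1 <= slack t x0.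
Proof.
move=> tm tt; have := kunz_cone_slack kunz_point_cone tm.
rewrite slack_kunz_point subr_ge0 ler_nat lerBrDr nat1r ler_nat => le.
by rewrite ltn_neqAle le andbT eq_sym.
Qed.

Lemma affine_hull_slack (T : pred ('I_m.-1 * 'I_m.-1 * 'I_m.-1)) t
    (y : 'rV[R]_m.-1) : kunz_triple t -> T t ->
  affine_hull (tight_face T) y -> slack t y = 0.
Proof.
move=> tm Tt [q [p [u [pF _ ->]]]]; rewrite /slack !summxE -big_split -sumrB.
rewrite big1 //= => i _; rewrite !mxE -mulrDr -mulrBr.
by have [_ /(_ t tm Tt)] := pF i; rewrite /slack => ->; rewrite mulr0.
Qed.

(** The equalities hold on the affine hull. The other inequalities, being strict
    between integers, have slack at least 1 at the point; moving the three
    coordinates by less than 1/3 keeps them valid. *)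
Lemma lies_in_tight_face : lies_in_face (tight_face tight_triple) S.
Proof.
split=> //; split.
  by split=> [|t _]; [exact: kunz_point_cone|exact: slack_tight].
exists (fun i j => ball (x0 i j) (1 / 3%:R)).
  by move=> i j; apply: nbhsx_ballx; rewrite divr_gt0 ?ltr0n.
move=> y yx hull; have dist j : `|x0 0 j - y 0 j| < 1 / 3%:R by exact: yx.
split; last by move=> t tm tt; apply: affine_hull_slack hull.
split=> [i|i j l ijl].
  have : 1 <= x0 0 i.
    rewrite mxE ler1n apery_gt0 // Sm gtnNdvd //.
    by have := ltn_ord i; lia.
  have := dist i; rewrite ltr_norml => /andP[_]; lra.
pose t := (i, j, l); have tm : kunz_triple t by apply/eqP.
have [tt|tt] := boolP (tight_triple t).
  by rewrite -subr_ge0 -[X in 0 <= X]/(slack t y) (affine_hull_slack tm tt hull).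
have := slack_not_tight tm tt; rewrite /slack /=.
have := dist i; have := dist j; have := dist l.
rewrite !ltr_norml => /andP[? ?] /andP[? ?] /andP[? ?]; lra.
Qed.

End KunzFace.

(** The face cut out by the common equalities contains both points in its relative
    interior, by [lies_in_tight_face]. *)
Lemma same_face_tight (R : realType) m (S S' : numsgp) :
  multiplicity S = m -> multiplicity S' = m ->
  (forall t : 'I_m.-1 * 'I_m.-1 * 'I_m.-1, kunz_triple t ->
    tight_triple S t = tight_triple S' t) ->
  same_face R m S S'.
Proof.
move=> Sm S'm SS'; exists (tight_face (tight_triple S)).
split; [exact: tight_face_is_face|exact: lies_in_tight_face|].
suff -> : tight_face (R := R) (@tight_triple m S) = tight_face (@tight_triple m S').
  exact: lies_in_tight_face.
rewrite predeqE => x; split=> -[Cx Hx]; split=> // t tm.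
  by rewrite -SS' //; apply: Hx.
by rewrite SS' //; apply: Hx.
Qed.

(** * Semigroups given by their Apery set *)
Section TableSemigroup.
Variable a : seq nat.
Let m := size a.

(** [a] lists [0, a_1, ..., a_(m-1)] with [a_i] congruent to [i] modulo [m]; the last
    two conditions say that the multiplicity is [m] and that the set is closed under
    addition. *)
Definition table_ok : bool :=
  [&& (0 < m)%N, nth 0 a 0 == 0%N,
      all (fun i => (nth 0 a i %% m)%N == i) (iota 0 m),
      all (fun i => m < nth 0 a i)%N (iota 1 m.-1) &
      all (fun i => all (fun j => nth 0 a ((i + j) %% m) <= nth 0 a i + nth 0 a j)%N
        (iota 0 m)) (iota 0 m)].

Hypothesis a_ok : table_ok.

Definition table_mem : {pred nat} := [pred s | (nth 0 a (s %% m) <= s)%N].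

Lemma table_m0 : (0 < m)%N. Proof. by case/and5P: a_ok. Qed.

Lemma table_mod i : (i < m)%N -> (nth 0 a i %% m)%N = i.
Proof.
by move=> im; case/and5P: a_ok => _ _ /allP/(_ i) + _ _; rewrite mem_iota => /(_ im)/eqP.
Qed.

Lemma table_mem0 : 0%N \in table_mem.
Proof. by rewrite inE mod0n; case/and5P: a_ok => _ /eqP ->. Qed.

Lemma table_memD s t : s \in table_mem -> t \in table_mem -> (s + t)%N \in table_mem.
Proof.
rewrite !inE => sm tm; apply: leq_trans (leq_add sm tm).
have lt u : (u %% m < m)%N by rewrite ltn_mod table_m0.
case/and5P: a_ok => _ _ _ _ /allP/(_ (s %% m)%N); rewrite mem_iota => /(_ (lt s)).
by move=> /allP/(_ (t %% m)%N); rewrite mem_iota modnDm => /(_ (lt t)).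
Qed.

Lemma table_cofinite : exists N, forall s, (N <= s)%N -> s \in table_mem.
Proof.
exists (\max_(x <- a) x) => s; rewrite inE; apply: leq_trans.
by apply: leq_bigmax_seq => //; rewrite mem_nth // ltn_mod table_m0.
Qed.

Definition table_sgp : numsgp := NumSgp table_mem0 table_memD table_cofinite.

Local Notation S := table_sgp.

Lemma table_sgpE s : (s \in S) = (nth 0 a (s %% m) <= s)%N.
Proof. by []. Qed.

Lemma table_multiplicity : multiplicity S = m.
Proof.
rewrite /multiplicity; case: ex_minnP => q /andP[q0]; rewrite table_sgpE => qS qmin.
have mS : m \in S.
  rewrite table_sgpE modnn; have := table_mem0.
  by rewrite inE mod0n leqn0 => /eqP ->.
apply/eqP; rewrite eqn_leq qmin ?mS ?table_m0 //= leqNgt; apply/negP => qm.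
case/and5P: a_ok => _ _ _ /allP/(_ q) + _; rewrite mem_iota q0 add1n prednK ?table_m0 //.
by move=> /(_ qm); rewrite ltnNge; move: qS; rewrite modn_small // => /leq_trans -> //; apply: ltnW.
Qed.

Lemma table_apery i : apery S i = nth 0 a (i %% m).
Proof.
have im : (i %% m < m)%N by rewrite ltn_mod table_m0.
have [_ ai] := aperyP S i; rewrite table_multiplicity in ai.
apply/eqP; rewrite eqn_leq; apply/andP; split.
  by apply: apery_le; rewrite ?table_sgpE ?table_multiplicity table_mod.
by have := apery_mem S i; rewrite table_sgpE ai.
Qed.

Variable gens : seq nat.

(** Elements other than the multiplicity and the [a_i] have the multiplicity as a
    proper summand, so only the [a_i] have to be tested. *)
Definition gens_ok : bool :=
  [&& m \in gens, sorted ltn gens,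
      all (fun i => (nth 0 a i \in gens) ||
        has (fun b => (b \in S) && ((nth 0 a i - b)%N \in S)) (iota 1 (nth 0 a i).-1))
        (iota 1 m.-1) &
      all (fun g => [&& (0 < g)%N, g \in S &
        all (fun b => (b \in S) ==> ((g - b)%N \notin S)) (iota 1 g.-1)]) gens].

Hypothesis g_ok : gens_ok.

Lemma table_split s : s \in S -> (0 < s)%N ->
  s \in gens \/ exists b, [/\ (0 < b < s)%N, b \in S & (s - b)%N \in S].
Proof.
rewrite table_sgpE => sS s0; case/and4P: g_ok => mg _ /allP cover _.
have m0 := table_m0; have sm : (s %% m < m)%N by rewrite ltn_mod.
have [sE|sN] := eqVneq s (nth 0 a (s %% m)).
  have i0 : (0 < s %% m)%N.
    rewrite lt0n; apply: contraL s0 => /eqP i0; rewrite sE i0.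
    by case/and5P: a_ok => _ /eqP ->.
  have := cover (s %% m)%N; rewrite mem_iota i0 add1n prednK // => /(_ sm).
  rewrite -sE => /orP[|/hasP[b + /andP[bS sbS]]]; first by left.
  by rewrite mem_iota add1n prednK // => bs; right; exists b.
have ls : (nth 0 a (s %% m) < s)%N by rewrite ltn_neqAle eq_sym sN.
have ms : (m <= s - nth 0 a (s %% m))%N.
  apply: dvdn_leq; first by rewrite subn_gt0.
  by rewrite -eqn_mod_dvd ?(ltnW ls) // table_mod.
have [->|sm'] := eqVneq s m; first by left.
right; exists m; split.
- by rewrite m0 /= ltn_neqAle eq_sym sm' (leq_trans ms) ?leq_subr.
- by have := multiplicity_in S; rewrite table_multiplicity.
rewrite table_sgpE; have -> : (s - m = s %[mod m])%N.
  by rewrite -{2}(subnK (leq_trans ms (leq_subr _ _))) modnDr.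
by move: ms; lia.
Qed.

Lemma gens_min_gen g : g \in gens -> is_min_gen S g.
Proof.
case/and4P: g_ok => _ _ _ /allP gP /gP /and3P[g0 gS /allP bP].
apply/and3P; split=> //; apply/forallP => b; apply/implyP => /andP[b0 bS].
have := bP b; rewrite mem_iota b0 add1n prednK // ltn_ord => /(_ isT)/implyP.
exact.
Qed.

Lemma table_min_gens : min_gens S = gens.
Proof.
apply: (irr_sorted_eq ltn_trans ltnn).
- by rewrite sorted_filter ?iota_ltn_sorted //; apply: ltn_trans.
- by case/and4P: g_ok.
move=> g; rewrite mem_min_gens; apply/idP/idP; last exact: gens_min_gen.
case/and3P=> g0 gS /forallP gmin; have [//|[b [/andP[b0 bg] bS gbS]]] := table_split gS g0.
by have := gmin (Ordinal bg); rewrite /= b0 bS gbS.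
Qed.

Lemma gens_table_pos g : g \in gens -> (0 < g)%N.
Proof. by case/gens_min_gen/and3P. Qed.

Lemma gens_table_mem g : g \in gens -> g \in S.
Proof. by case/gens_min_gen/and3P. Qed.

Lemma gens_table_gen s : s \in S -> exists u : 'X_{1..size gens}, weight u = s.
Proof.
have [d] := ubnP s; elim: d s => // d IHd s sd sS.
have [->|] := eqVneq s 0%N; first by exists 0%MM; rewrite weight0.
rewrite -lt0n => /(table_split sS)[gs|[b [/andP[b0 bs] bS sbS]]].
  have gi : (index s gens < size gens)%N by rewrite index_mem.
  by exists U_(Ordinal gi)%MM; rewrite weightU /= nth_index.
have [|u ub] := IHd b _ bS; first exact: leq_trans bs _.
have [|v vb] := IHd (s - b)%N _ sbS; first by lia.
by exists (u + v)%MM; rewrite weightD ub vb subnKC // ltnW.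
Qed.

End TableSemigroup.

(** * Certificates for monomial presentations *)

Definition mnm_of_seq n (s : seq nat) : 'X_{1..n} := [multinom nth 0%N s i | i < n].

Lemma mnm_of_seqE n s i : mnm_of_seq n s i = nth 0%N s i.
Proof. exact: mnmE. Qed.

Lemma all_iotaP n (P : pred nat) : reflect (forall i : 'I_n, P i) (all P (iota 0 n)).
Proof.
apply: (iffP allP) => [H i|H i]; first by apply: H; rewrite mem_iota ltn_ord.
by rewrite mem_iota => /= ni; apply: (H (Ordinal ni)).
Qed.

Lemma mnm_of_seq_le n s t : (mnm_of_seq n s <= mnm_of_seq n t)%MM =
  all (fun i => nth 0%N s i <= nth 0%N t i)%N (iota 0 n).
Proof.
apply/mnm_lepP/all_iotaP => H i; have := H i; by rewrite !mnm_of_seqE.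
Qed.

Lemma mnm_of_seqP n (m : 'X_{1..n}) : exists2 s, size s = n & m = mnm_of_seq n s.
Proof.
exists [seq m i | i <- enum 'I_n]; first by rewrite size_map size_enum_ord.
by apply/mnmP => i; rewrite mnm_of_seqE (nth_map i) ?size_enum_ord // nth_ord_enum.
Qed.

Lemma sum_ord_iota n (F : nat -> nat) : \sum_(i < n) F i = sumn [seq F i | i <- iota 0 n].
Proof. by rewrite sumnE big_map -(big_mkord xpredT) /index_iota subn0. Qed.

Lemma mdeg_of_seq n s : mdeg (mnm_of_seq n s) = sumn [seq nth 0%N s i | i <- iota 0 n].
Proof.
by rewrite mdegE -sum_ord_iota; apply: eq_bigr => i _; rewrite mnm_of_seqE.
Qed.

Lemma weight_of_seq gens s : weight (mnm_of_seq (size gens) s) =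
  sumn [seq (nth 0 s i * nth 0 gens i)%N | i <- iota 0 (size gens)].
Proof.
by rewrite -sum_ord_iota; apply: eq_bigr => i _; rewrite mnm_of_seqE.
Qed.

(** The hypotheses of the previous parts on a list of relations, as computations on
    lists of exponents; [longer] lists factorizations that beat the relations. *)
Section Certificates.
Variables (gens : seq nat) (rels longer : seq (seq nat)).
Let n := size gens.

Definition mrels : seq 'X_{1..n} := [seq mnm_of_seq n r | r <- rels].

Definition divides (s t : seq nat) := all (fun i => nth 0%N s i <= nth 0%N t i)%N (iota 0 n).
Definition avoids (t : seq nat) := all (fun r => ~~ divides r t) rels.
Definition len (s : seq nat) := sumn [seq nth 0%N s i | i <- iota 0 n].
Definition wgt (s : seq nat) := sumn [seq (nth 0 s i * nth 0 gens i)%N | i <- iota 0 n].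
Definition pred_at (s : seq nat) (i : nat) :=
  [seq (nth 0 s j - (i == j))%N | j <- iota 0 n].

Lemma standard_of_seq t : standard mrels (mnm_of_seq n t) = avoids t.
Proof.
rewrite /standard has_map /avoids -all_predC; apply: eq_all => r /=.
by rewrite mnm_of_seq_le.
Qed.

Definition rels_ok :=
  [&& all (fun r => has (fun r' => (wgt r' == wgt r) && (len r < len r')%N) longer) rels,
      all (fun r => 1 < len r)%N rels,
      all (fun r => all (fun i => (0 < nth 0%N r i)%N ==> avoids (pred_at r i)) (iota 0 n)) rels &
      pairwise (fun r t => ~~ (divides r t && divides t r)) rels].

Lemma mrels_free (i : 'I_n) : all (fun r => nth 0%N r i == 0%N) rels ->
  forall g, g \in mrels -> g i = 0%N.
Proof. by move=> /allP H g /mapP[r /H/eqP r0 ->]; rewrite mnm_of_seqE. Qed.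

Definition quadratic_check := all (fun r => has (fun i => has (fun j =>
    all (fun h => nth 0%N r h == (i == h) + (j == h))%N (iota 0 n))
  (iota 0 n)) (iota 0 n)) rels.

Lemma mrels_quadratic : quadratic_check -> quadratic_gens mrels.
Proof.
move=> /allP H g /mapP[r /H/hasP[i + /hasP[j + /all_iotaP rE]] ->].
rewrite !mem_iota /= => ni nj; exists (Ordinal ni), (Ordinal nj); apply/mnmP => h.
by rewrite mnm_of_seqE mnmDE !mnm1E (eqP (rE h)).
Qed.

Hypothesis r_ok : rels_ok.

Lemma mrels_longer r : r \in mrels ->
  exists r', @weight gens r' = @weight gens r /\ (mdeg r < mdeg r')%N.
Proof.
case/mapP=> s sr ->; case/and4P: r_ok => /allP/(_ s sr)/hasP[t _ /andP[/eqP wt lt]] _ _ _.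
by exists (mnm_of_seq n t); rewrite !weight_of_seq !mdeg_of_seq.
Qed.

Lemma mrels_deg r : r \in mrels -> (1 < mdeg r)%N.
Proof.
by case/mapP=> s sr ->; case/and4P: r_ok => _ /allP/(_ s sr) + _ _; rewrite mdeg_of_seq.
Qed.

Lemma mrels_minimal r : r \in mrels -> minimal_nonstandard mrels r.
Proof.
case/mapP=> s sr -> i; case/and4P: r_ok => _ _ /allP/(_ s sr)/all_iotaP/(_ i) + _.
rewrite lep1mP mnm_of_seqE -lt0n => /implyP H /H; rewrite -standard_of_seq.
congr (standard _ _); apply/mnmP => j.
by rewrite mnm_of_seqE mnmBE mnm_of_seqE mnm1E /pred_at (nth_map 0%N) ?size_iota // nth_iota.
Qed.

Lemma mrels_uniq : uniq mrels.
Proof.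
rewrite uniq_pairwise pairwise_map; case/and4P: r_ok => _ _ _; apply: sub_pairwise.
move=> s t; apply: contraNneq => st.
by rewrite /divides -!mnm_of_seq_le st lepm_refl.
Qed.

End Certificates.

(** * Comparison of two tables and values of Betti numbers *)
Section SameFace.
Variables (R : realType) (a a' : seq nat) (a_ok : table_ok a) (a'_ok : table_ok a').

Definition tight_check :=
  all (fun i => all (fun j => all (fun l =>
    ((i.+1 + j.+1) %% size a == l.+1 %% size a)%N ==>
    (((nth 0 a i.+1 + nth 0 a j.+1 == nth 0 a l.+1)%N) ==
     ((nth 0 a' i.+1 + nth 0 a' j.+1 == nth 0 a' l.+1)%N)))
  (iota 0 (size a).-1)) (iota 0 (size a).-1)) (iota 0 (size a).-1).

Lemma same_face_table : size a' = size a -> tight_check ->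
  same_face R (size a) (table_sgp a_ok) (table_sgp a'_ok).
Proof.
move=> sa' check; apply: same_face_tight.
- exact: table_multiplicity.
- by rewrite table_multiplicity.
move=> [[i j] l] tm; rewrite /tight_triple /= !table_apery sa'.
have small (h : 'I_(size a).-1) : (h.+1 %% size a = h.+1)%N.
  by rewrite modn_small //; have := ltn_ord h; lia.
rewrite !small.
have /all_iotaP/(_ i)/all_iotaP/(_ j)/all_iotaP/(_ l) := check.
by move=> /implyP/(_ tm)/eqP.
Qed.

End SameFace.

Section BettiValue.
Variables (k : fieldType) (A : comNzRingType) (eps : {rmorphism A -> k}).
Variables (M : lmodType A) (i b : nat).
Hypothesis tor_b : forall F : free_resolution M, tor_dim eps F i = b.

(** The default value 0 of [betti] is the only other possibility, so that two modules
    can be distinguished by exhibiting a resolution of one of them. *)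
Lemma betti_or0 : betti eps M i = b \/ betti eps M i = 0%N.
Proof.
by rewrite /betti; case: xgetP => [c _ [F ->]|_]; [left; apply: tor_b|right].
Qed.

Lemma betti_eq : inhabited (free_resolution M) -> betti eps M i = b.
Proof.
case=> F; rewrite /betti; case: xgetP => [c _ [F' ->]|]; first exact: tor_b.
by move=> /(_ b); case; exists F.
Qed.

End BettiValue.

Lemma sgp_finite_betti_gens (k : fieldType) (S : numsgp) gens i :
  min_gens S = gens ->
  sgp_finite_betti k S i =
  betti (eval0 k (size gens)) (restr_scalars (sgp_presentation k S gens)) i.
Proof. by move=> <-. Qed.

(** * The four semigroups *)

(** Each semigroup carries the name of its largest generator. In the first pair, with
    generators [4, 7, 9] and [4, 7, 17], the only Kunz equality is [a_2 = 2 a_3]. In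
    the second pair the generators are [8, 17, 18, 20] and [a_7], equal to 31 or 47,
    and the equalities express [a_3], [a_5], [a_6] as sums of two of [a_1], [a_2],
    [a_4]. *)

Definition tab9 := [:: 0; 9; 14; 7]%N.
Definition gens9 := [:: 4; 7; 9]%N.
Definition rels9 := [:: [:: 0; 1; 1]; [:: 0; 0; 2]; [:: 0; 3; 0]]%N.
Definition long9 := [:: [:: 4; 0; 0]; [:: 1; 2; 0]; [:: 3; 0; 1]]%N.
Lemma tab9_ok : table_ok tab9. Proof. by []. Qed.
Definition sgp9 := table_sgp tab9_ok.
Lemma gens9_ok : gens_ok tab9_ok gens9. Proof. by []. Qed.
Lemma rels9_ok : rels_ok gens9 rels9 long9. Proof. by []. Qed.

Definition tab17 := [:: 0; 17; 14; 7]%N.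
Definition gens17 := [:: 4; 7; 17]%N.
(* 17 + 4 is a sum of three sevens: the class of t^17 is killed by that of t^4. *)
Definition rels17 := [:: [:: 1; 0; 1]; [:: 0; 1; 1]; [:: 0; 0; 2]; [:: 0; 4; 0]]%N.
Definition long17 := [:: [:: 0; 3; 0]; [:: 6; 0; 0]; [:: 5; 2; 0]; [:: 7; 0; 0]]%N.
Lemma tab17_ok : table_ok tab17. Proof. by []. Qed.
Definition sgp17 := table_sgp tab17_ok.
Lemma gens17_ok : gens_ok tab17_ok gens17. Proof. by []. Qed.
Lemma rels17_ok : rels_ok gens17 rels17 long17. Proof. by []. Qed.

Definition tab31 := [:: 0; 17; 18; 35; 20; 37; 38; 31]%N.
Definition gens31 := [:: 8; 17; 18; 20; 31]%N.
(* 17 + 18 + 20 = 31 + 3 * 8 is the relation of degree three, the last one. *)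
Definition rels31 := [:: [:: 0; 2; 0; 0; 0]; [:: 0; 0; 2; 0; 0]; [:: 0; 0; 0; 2; 0];
  [:: 0; 1; 0; 0; 1]; [:: 0; 0; 1; 0; 1]; [:: 0; 0; 0; 1; 1]; [:: 0; 0; 0; 0; 2];
  [:: 0; 1; 1; 1; 0]]%N.
Definition long31 := [:: [:: 2; 0; 1; 0; 0]; [:: 2; 0; 0; 1; 0]; [:: 5; 0; 0; 0; 0];
  [:: 6; 0; 0; 0; 0]; [:: 4; 1; 0; 0; 0]; [:: 2; 1; 1; 0; 0]; [:: 3; 0; 1; 1; 0];
  [:: 3; 0; 0; 0; 1]]%N.
Lemma tab31_ok : table_ok tab31. Proof. by []. Qed.
Definition sgp31 := table_sgp tab31_ok.
Lemma gens31_ok : gens_ok tab31_ok gens31. Proof. by []. Qed.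
Lemma rels31_ok : rels_ok gens31 rels31 long31. Proof. by []. Qed.

Definition tab47 := [:: 0; 17; 18; 35; 20; 37; 38; 47]%N.
Definition gens47 := [:: 8; 17; 18; 20; 47]%N.
(* 17 + 18 + 20 = 47 + 8: here the longer side is the sum of three generators, and
   the relation is the quadratic one between 8 and 47, the fourth one. *)
Definition rels47 := [:: [:: 0; 2; 0; 0; 0]; [:: 0; 0; 2; 0; 0]; [:: 0; 0; 0; 2; 0];
  [:: 1; 0; 0; 0; 1]; [:: 0; 1; 0; 0; 1]; [:: 0; 0; 1; 0; 1]; [:: 0; 0; 0; 1; 1];
  [:: 0; 0; 0; 0; 2]]%N.
Definition long47 := [:: [:: 2; 0; 1; 0; 0]; [:: 2; 0; 0; 1; 0]; [:: 5; 0; 0; 0; 0];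
  [:: 0; 1; 1; 1; 0]; [:: 8; 0; 0; 0; 0]; [:: 6; 1; 0; 0; 0]; [:: 4; 1; 1; 0; 0];
  [:: 7; 0; 1; 1; 0]]%N.
Lemma tab47_ok : table_ok tab47. Proof. by []. Qed.
Definition sgp47 := table_sgp tab47_ok.
Lemma gens47_ok : gens_ok tab47_ok gens47. Proof. by []. Qed.
Lemma rels47_ok : rels_ok gens47 rels47 long47. Proof. by []. Qed.

Definition weight_separates gens rels := forall u v : 'X_{1..size gens},
  standard (mrels gens rels) u -> standard (mrels gens rels) v ->
  weight u = weight v -> u = v.

Lemma table_monomial (k : fieldType) a (a_ok : table_ok a) gens rels longer :
  gens_ok a_ok gens -> rels_ok gens rels longer -> weight_separates gens rels ->
  monomial_presentation (mrels gens rels) (sgp_presentation k (table_sgp a_ok) gens)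
    (@sgp_gr_eps k (table_sgp a_ok)) (@sgp_gr_comp k (table_sgp a_ok)).
Proof.
move=> g_ok r_ok sep; apply: sgp_gr_monomial sep.
- exact: gens_table_pos g_ok.
- exact: gens_table_mem g_ok.
- exact: gens_table_gen g_ok.
- exact: mrels_longer r_ok.
Qed.

Lemma separates9 : weight_separates gens9 rels9.
Proof.
move=> u v; case: (mnm_of_seqP u) => -[|x [|y [|z []]]] // _ ->.
case: (mnm_of_seqP v) => -[|x' [|y' [|z' []]]] // _ ->.
rewrite !standard_of_seq !weight_of_seq /avoids /divides /=.
move=> H H' e; congr (mnm_of_seq _ _); congr [:: _; _; _]; lia.
Qed.

Lemma separates17 : weight_separates gens17 rels17.
Proof.
move=> u v; case: (mnm_of_seqP u) => -[|x [|y [|z []]]] // _ ->.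
case: (mnm_of_seqP v) => -[|x' [|y' [|z' []]]] // _ ->.
rewrite !standard_of_seq !weight_of_seq /avoids /divides /=.
move=> H H' e; congr (mnm_of_seq _ _); congr [:: _; _; _]; lia.
Qed.

Lemma separates31 : weight_separates gens31 rels31.
Proof.
move=> u v; case: (mnm_of_seqP u) => -[|x [|y [|z [|w [|t []]]]]] // _ ->.
case: (mnm_of_seqP v) => -[|x' [|y' [|z' [|w' [|t' []]]]]] // _ ->.
rewrite !standard_of_seq !weight_of_seq /avoids /divides /= !andbT => H H' e.
have [yb zb wb tb] : [/\ (y < 2), (z < 2), (w < 2) & (t < 2)]%N by split; lia.
have [yb' zb' wb' tb'] : [/\ (y' < 2), (z' < 2), (w' < 2) & (t' < 2)]%N by split; lia.
have [-> -> -> -> ->] : [/\ x = x', y = y', z = z', w = w' & t = t'].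
  case: y yb H e => [|[|//]] _; case: z zb => [|[|//]] _;
  case: w wb => [|[|//]] _; case: t tb => [|[|//]] _ //= _;
  case: y' yb' H' => [|[|//]] _; case: z' zb' => [|[|//]] _;
  case: w' wb' => [|[|//]] _; case: t' tb' => [|[|//]] _ //= _ e; split; lia.
by [].
Qed.

Lemma separates47 : weight_separates gens47 rels47.
Proof.
move=> u v; case: (mnm_of_seqP u) => -[|x [|y [|z [|w [|t []]]]]] // _ ->.
case: (mnm_of_seqP v) => -[|x' [|y' [|z' [|w' [|t' []]]]]] // _ ->.
rewrite !standard_of_seq !weight_of_seq /avoids /divides /= !andbT => H H' e.
have [yb zb wb tb] : [/\ (y < 2), (z < 2), (w < 2) & (t < 2)]%N by split; lia.
have [yb' zb' wb' tb'] : [/\ (y' < 2), (z' < 2), (w' < 2) & (t' < 2)]%N by split; lia.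
have [-> -> -> -> ->] : [/\ x = x', y = y', z = z', w = w' & t = t'].
  case: t tb H e => [|[|//]] _; case: y yb => [|[|//]] _; case: z zb => [|[|//]] _;
  case: w wb => [|[|//]] _; rewrite /= ?andbF // => H;
  case: t' tb' H' => [|[|//]] _; case: y' yb' => [|[|//]] _; case: z' zb' => [|[|//]] _;
  case: w' wb' => [|[|//]] _; rewrite /= ?andbF // => H' e; split; lia.
by [].
Qed.

Section Examples.
Variables (R : realType) (k : fieldType).

Let pres9 := table_monomial k gens9_ok rels9_ok separates9.
Let pres17 := table_monomial k gens17_ok rels17_ok separates17.
Let pres31 := table_monomial k gens31_ok rels31_ok separates31.
Let pres47 := table_monomial k gens47_ok rels47_ok separates47.

Lemma same_face_9_17 : same_face R 4 sgp9 sgp17.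
Proof. exact: (@same_face_table R tab9 tab17). Qed.

Lemma same_face_31_47 : same_face R 8 sgp31 sgp47.
Proof. exact: (@same_face_table R tab31 tab47). Qed.

(** The resolution needed here is the Hilbert-Burch resolution of the ideal generated
    by [Y Z], [Z ^ 2], [Y ^ 3]. *)
Lemma finite_betti9 : sgp_finite_betti k sgp9 1 = 3.
Proof.
rewrite (sgp_finite_betti_gens _ _ (table_min_gens gens9_ok)).
apply: betti_eq => [F|].
  by rewrite (tor_dim1 pres9 (mrels_deg rels9_ok) (mrels_minimal rels9_ok) (mrels_uniq rels9_ok)).
pose y : 'I_(size gens9) := Ordinal (erefl : (1 < 3)%N).
pose z : 'I_(size gens9) := Ordinal (erefl : (2 < 3)%N).
have rE : mrels gens9 rels9 = [:: (U_(y) + U_(z))%MM; (U_(z) *+ 2)%MM; (U_(y) *+ 3)%MM].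
  by congr [:: _; _; _]; apply/mnmP => -[[|[|[|//]]] iP];
    rewrite mnm_of_seqE ?mnmDE ?mulmnE ?mnm1E.
by have := pres9; rewrite rE => /quot_resolution; apply.
Qed.

(** The ideal of relations needs four generators. *)
Lemma finite_betti17 : sgp_finite_betti k sgp17 1 <> 3.
Proof.
rewrite (sgp_finite_betti_gens _ _ (table_min_gens gens17_ok)).
by have [->|->] := betti_or0 (tor_dim1 pres17 (mrels_deg rels17_ok)
  (mrels_minimal rels17_ok) (mrels_uniq rels17_ok)).
Qed.

(** The second Betti number is the number of Koszul syzygies plus the number of
    relations. *)
Lemma poincare_9_17 : sgp_poincare k sgp9 2 <> sgp_poincare k sgp17 2.
Proof.
pose r := #|@incr_pairs 3|.
have -> : sgp_poincare k sgp9 2 = (r + 3)%N.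
  apply: betti_eq => [F|].
    exact: (tor_dim2 pres9 (mrels_deg rels9_ok) (mrels_minimal rels9_ok) (mrels_uniq rels9_ok)).
  have [||F] := residue_graded_resolution pres9 (x0 := ord0) (D := 4);
    last exact: (inhabits (gfr_res F)).
    exact: mrels_free.
  move=> m; case: (mnm_of_seqP m) => -[|x [|y [|z []]]] // _ ->.
  by rewrite standard_of_seq mnm_of_seqE mdeg_of_seq /avoids /divides /=; lia.
rewrite /sgp_poincare -[sgp17]/(table_sgp tab17_ok).
have [->|->] := betti_or0 (tor_dim2 pres17 (mrels_deg rels17_ok)
  (mrels_minimal rels17_ok) (mrels_uniq rels17_ok)); rewrite /= /r; lia.
Qed.

(** All relations are quadratic. *)
Lemma koszul47 : sgp_gr_koszul k sgp47.
Proof.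
apply: (koszul_quadratic pres47); exact: mrels_quadratic.
Qed.

(** The cubic relation [Y Z W] is minimal. *)
Lemma not_koszul31 : ~ sgp_gr_koszul k sgp31.
Proof.
apply: (not_koszul_minimal_nonstandard pres31 (g := mnm_of_seq _ [:: 0; 1; 1; 1; 0]%N)).
- apply: (residue_graded_resolution pres31 (x0 := ord0) (D := 5)).
  + exact: mrels_free.
  move=> m; case: (mnm_of_seqP m) => -[|x [|y [|z [|w [|t []]]]]] // _ ->.
  by rewrite standard_of_seq mnm_of_seqE mdeg_of_seq /avoids /divides /=; lia.
- by rewrite standard_of_seq.
- by apply: (mrels_minimal rels31_ok); apply/mapP; exists [:: 0; 1; 1; 1; 0]%N.
- by rewrite mdeg_of_seq.
Qed.
End Examples.

Theorem proposition5p5 (R : realType) (k : fieldType) :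
  (exists (m : nat) (S S' : numsgp), same_face R m S S' /\
     exists i : nat, sgp_finite_betti k S i <> sgp_finite_betti k S' i) /\
  (exists (m : nat) (S S' : numsgp), same_face R m S S' /\
     sgp_poincare k S <> sgp_poincare k S') /\
  (exists (m : nat) (S S' : numsgp), same_face R m S S' /\
     ~ (sgp_gr_koszul k S <-> sgp_gr_koszul k S') /\
     ~ (sgp_ring_koszul k S <-> sgp_ring_koszul k S')).
Proof.
have koszul_differs : ~ (sgp_gr_koszul k sgp31 <-> sgp_gr_koszul k sgp47).
  by move=> /proj2/(_ (koszul47 k)); apply: not_koszul31.
split; [|split].
- exists 4%N, sgp9, sgp17; split; first exact: same_face_9_17.
  exists 1%N; rewrite finite_betti9 => /esym; exact: finite_betti17.
- exists 4%N, sgp9, sgp17; split; first exact: same_face_9_17.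
  by move=> e; apply: (poincare_9_17 (k := k)); rewrite e.
by exists 8%N, sgp31, sgp47; split; first exact: same_face_31_47.
Qed.
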